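(* Let $n\ge 1$, let $\mathcal{Q}\subseteq H^2(\mathbb{T}^n)$ be a quotient module, and let $X\in\mathcal{B}_1(\mathcal{Q})$ be a module map. Set $\psi=X(P_{\mathcal{Q}}1)$, \[ \mathcal{M}_{\mathcal{Q}}=\mathcal{Q}^{conj}+\mathcal{M}_n+H^2_0(\mathbb{T}^n),\qquad \tilde{\mathcal{M}}_{\mathcal{Q},X}=(\mathcal{Q}^{conj}\ominus\{\bar\psi\})+\mathcal{M}_n+H^2_0(\mathbb{T}^n), \] both regarded as linear subspaces of $L^1(\mathbb{T}^n)$ with the norm $\|\cdot\|_1$. Then the following are equivalent: (1) $X$ is liftable; (2) the functional $X_{\mathcal{Q}}:(\mathcal{M}_{\mathcal{Q}},\|\cdot\|_1)\to\mathbb{C}$, $X_{\mathcal{Q}}f=\int_{\mathbb{T}^n}\psi f\,d\mu$, is contractive, i.e. $|\int_{\mathbb{T}^n}\psi f\,d\mu|\le\|f\|_1$ for all $f\in\mathcal{M}_{\mathcal{Q}}$; (3) $\operatorname{dist}_{L^1(\mathbb{T}^n)}\big(\bar\psi/\|\psi\|_2^2,\ \tilde{\mathcal{M}}_{\mathcal{Q},X}\big)\ge 1$.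
   Context: $\mathbb{D}$ is the open unit disc, $\mathbb{T}$ the unit circle, $\mu$ the normalized Lebesgue measure on $\mathbb{T}^n$. $H^2(\mathbb{T}^n)$ is the closed subspace of $L^2(\mathbb{T}^n)$ of functions whose Fourier coefficients vanish off $\mathbb{Z}_+^n$ (identified with analytic functions on $\mathbb{D}^n$ via radial limits); $\|\cdot\|_p$ is the $L^p(\mathbb{T}^n,\mu)$ norm. $H^\infty(\mathbb{D}^n)$ is the algebra of bounded analytic functions on $\mathbb{D}^n$ with the sup norm, and $\mathcal{S}(\mathbb{D}^n)$ is its closed unit ball. For $\varphi\in H^\infty(\mathbb{D}^n)$, $T_\varphi f=\varphi f$ on $H^2(\mathbb{T}^n)$; $T_{z_i}$ is multiplication by the coordinate $z_i$. A closed subspace $\mathcal{Q}\subseteq H^2(\mathbb{T}^n)$ is a quotient module if $T_{z_i}^*\mathcal{Q}\subseteq\mathcal{Q}$ for $i=1,\dots,n$; $P_{\mathcal{Q}}$ is the orthogonal projection of $H^2(\mathbb{T}^n)$ onto $\mathcal{Q}$ and $S_\varphi=P_{\mathcal{Q}}T_\varphi|_{\mathcal{Q}}$ (in particular $S_{z_i}=P_{\mathcal{Q}}T_{z_i}|_{\mathcal{Q}}$). $\mathcal{B}_1(\mathcal{Q})$ is the set of contractions on $\mathcal{Q}$. $X\in\mathcal{B}(\mathcal{Q})$ is a module map if $XS_{z_i}=S_{z_i}X$ for all $i$; a contractive module map $X$ is liftable if there exists $\varphi\in\mathcal{S}(\mathbb{D}^n)$ with $X=S_\varphi$. For $S\subseteq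 L^2(\mathbb{T}^n)$, $S^{conj}=\{\bar f:f\in S\}$. $H^2_0(\mathbb{T}^n)=\{f\in H^2(\mathbb{T}^n):f(0)=0\}$. $\mathcal{M}_n=L^2(\mathbb{T}^n)\ominus(H^2(\mathbb{T}^n)^{conj}+H^2(\mathbb{T}^n))$, the closed span of the monomials $z^k$, $k\in\mathbb{Z}^n$, having at least one positive and at least one negative exponent. The sums above are sums of mutually orthogonal subspaces of $L^2$; $\mathcal{Q}^{conj}\ominus\{\bar\psi\}$ is the orthogonal complement of $\bar\psi$ in $\mathcal{Q}^{conj}$. $\operatorname{dist}_{L^1}(g,M)=\inf_{h\in M}\|g-h\|_1$.
   Formalization: Condition (3) is undefined when ψ = 0 (e.g. X = 0), so its equivalence with (1) is stated only for ‖ψ‖₂ ≠ 0, while (1)⇔(2) is unconditional; the Schur class is taken via boundary values on the torus (|φ| ≤ 1 a.e., Fourier coefficients vanishing off Z_+^n). *)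

(* Defs.v *)
From mathcomp Require Import all_boot all_order all_algebra.
From mathcomp Require Import all_classical all_reals all_analysis.
From mathcomp Require Import complex.
From Stdlib Require Import ClassicalEpsilon.
Import Order.TTheory GRing.Theory Num.Theory.
Import ComplexField.

Set Implicit Arguments.
Unset Strict Implicit.
Unset Printing Implicit Defensive.

Local Open Scope ring_scope.
Local Open Scope classical_set_scope.

(* The torus T^n is parametrized by angles t in [0,1]^n (an n-tuple of reals)*)
(* via z_j = exp(2 pi i t_j); the normalized Lebesgue measure mu on T^n     *)
(* corresponds to Lebesgue measure on [0,1]^n.  Functions on T^n are thus    *)
(* functions  n.-tuple R -> R[i].                                            *)

Section Torus.
Context {R : realType}.

Definition tfun (n : nat) := n.-tuple R -> R[i].

(* iterated Lebesgue integral over [0,1]^n (= integral against the product  *)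
(* Lebesgue measure on [0,1]^n, i.e. normalized Haar measure mu on T^n, for  *)
(* nonnegative measurable integrands, by Tonelli)                           *)
Fixpoint itint (n : nat) : (n.-tuple R -> \bar R) -> \bar R :=
  match n return (n.-tuple R -> \bar R) -> \bar R with
  | 0 => fun g => g [tuple]
  | m.+1 => fun g =>
      (\int[@lebesgue_measure R]_(x in `[0%R, 1%R]) itint (fun t => g [tuple of x :: t]))%E
  end.

Definition cmod (z : R[i]) : R := Num.sqrt (complex.Re z ^+ 2 + complex.Im z ^+ 2).

Definition fadd n (f g : tfun n) : tfun n := fun t => f t + g t.
Definition fsub n (f g : tfun n) : tfun n := fun t => f t - g t.
Definition fmul n (f g : tfun n) : tfun n := fun t => f t * g t.
Definition fscale n (c : R[i]) (f : tfun n) : tfun n := fun t => c * f t.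
Definition fconj n (f : tfun n) : tfun n := fun t => conjc (f t).
Definition fconst n (c : R[i]) : tfun n := fun _ => c.

Definition measC n (f : tfun n) :=
  measurable_fun setT (fun t => complex.Re (f t)) /\ measurable_fun setT (fun t => complex.Im (f t)).

Definition L1norm n (f : tfun n) : \bar R := itint (fun t => (cmod (f t))%:E).
Definition L2sq n (f : tfun n) : \bar R := itint (fun t => (cmod (f t) ^+ 2)%:E).
Definition L2norm n (f : tfun n) : R := Num.sqrt (fine (L2sq f)).
Definition inL2 n (f : tfun n) := measC f /\ (L2sq f < +oo)%E.

Definition rint n (g : n.-tuple R -> R) : R :=
  fine (itint (fun t => (Num.max (g t) 0)%:E))
  - fine (itint (fun t => (Num.max (- g t) 0)%:E)).

Definition cint n (f : tfun n) : R[i] :=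
  (rint (fun t => complex.Re (f t)) +i* rint (fun t => complex.Im (f t)))%C.

Definition inner n (f g : tfun n) : R[i] := cint (fun t => f t * conjc (g t)).

Definition expi (x : R) : R[i] := (cos x +i* sin x)%C.

Definition monom n (k : 'I_n -> int) : tfun n :=
  fun t => expi (2 * pi * \sum_(i < n) (k i)%:~R * tnth t i).

Definition zcoord n (i : 'I_n) : tfun n := fun t => expi (2 * pi * tnth t i).

Definition fourier n (f : tfun n) (k : 'I_n -> int) : R[i] := inner f (monom k).

Definition H2 n (f : tfun n) :=
  inL2 f /\ forall k : 'I_n -> int, (exists i, k i < 0) -> fourier f k = 0.

(* H^2_0: f in H^2 with f(0) = 0, i.e. zeroth Fourier coefficient 0 *)
Definition H2_0 n (f : tfun n) := H2 f /\ fourier f (fun _ => 0) = 0.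

Definition Mn n (f : tfun n) :=
  inL2 f /\ (forall g, H2 g -> inner f g = 0) /\ (forall g, H2 g -> inner f (fconj g) = 0).

(* closed linear subspace of L^2 (as a set of representatives; closedness in *)
(* the L^2 norm makes it saturated under a.e. equality)                      *)
Definition closed_subspace n (Q : set (tfun n)) :=
  [/\ (forall f, Q f -> inL2 f),
      Q (@fconst n 0),
      (forall f g, Q f -> Q g -> Q (fadd f g)),
      (forall c f, Q f -> Q (fscale c f)) &
      (forall f, inL2 f ->
         (forall e : R, 0 < e -> exists g, Q g /\ L2norm (fsub f g) < e) -> Q f)].

(* quotient module: closed subspace of H^2 invariant under T_{z_i}^*,        *)
(* where T_{z_i}^* f is the g in H^2 with <g,h> = <f, z_i h> for all h in H^2 *)
Definition quotient_module n (Q : set (tfun n)) :=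
  [/\ closed_subspace Q,
      (forall f, Q f -> H2 f) &
      (forall (i : 'I_n) f, Q f -> exists g, Q g /\
         forall h, H2 h -> inner g h = inner f (fmul (zcoord i) h))].

Definition is_proj n (Q : set (tfun n)) (F q : tfun n) :=
  Q q /\ forall h, Q h -> inner (fsub F q) h = 0.

Definition PQ n (Q : set (tfun n)) (F : tfun n) : tfun n :=
  epsilon (inhabits (@fconst n 0)) (is_proj Q F).

Definition Scomp n (Q : set (tfun n)) (phi f : tfun n) : tfun n := PQ Q (fmul phi f).

(* X in B_1(Q): a linear contraction on Q (equalities in L^2, i.e. a.e.) *)
Definition contraction_on n (Q : set (tfun n)) (X : tfun n -> tfun n) :=
  [/\ (forall f, Q f -> Q (X f)),
      (forall f g, Q f -> Q g -> L2norm (fsub (X (fadd f g)) (fadd (X f) (X g))) = 0),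
      (forall c f, Q f -> L2norm (fsub (X (fscale c f)) (fscale c (X f))) = 0) &
      (forall f, Q f -> L2norm (X f) <= L2norm f)].

Definition module_map n (Q : set (tfun n)) (X : tfun n -> tfun n) :=
  forall (i : 'I_n) f, Q f ->
    L2norm (fsub (X (Scomp Q (zcoord i) f)) (Scomp Q (zcoord i) (X f))) = 0.

(* Schur class S(D^n), via boundary values: bounded analytic functions on    *)
(* D^n of sup norm <= 1 are identified with their radial limits, i.e. with   *)
(* measurable phi on T^n with |phi| <= 1 a.e. and Fourier coefficients       *)
(* vanishing off Z_+^n                                                       *)
Definition schur n (phi : tfun n) :=
  [/\ measC phi,
      itint (fun t => (if 1 < cmod (phi t) then 1 else 0)%:E) = 0%E &
      forall k : 'I_n -> int, (exists i, k i < 0) -> fourier phi k = 0].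

Definition liftable n (Q : set (tfun n)) (X : tfun n -> tfun n) :=
  exists phi, schur phi /\ forall f, Q f -> L2norm (fsub (X f) (Scomp Q phi f)) = 0.

Definition setconj n (S : set (tfun n)) : set (tfun n) :=
  fun f => exists g, S g /\ f = fconj g.

Definition sum3 n (A B C : set (tfun n)) : set (tfun n) :=
  fun f => exists a b c, [/\ A a, B b, C c & f = fadd (fadd a b) c].

Definition MQ n (Q : set (tfun n)) := sum3 (setconj Q) (@Mn n) (@H2_0 n).

Definition MtQ n (Q : set (tfun n)) (psi : tfun n) :=
  sum3 (fun g => setconj Q g /\ inner g (fconj psi) = 0) (@Mn n) (@H2_0 n).

Definition distL1 n (g : tfun n) (M : set (tfun n)) : \bar R :=
  ereal_inf [set L1norm (fsub g h) | h in M].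

End Torus.

(* Main.v *)
From HB Require Import structures.
Require Import Defs.
From mathcomp Require Import all_boot all_order all_algebra.
From mathcomp Require Import all_classical all_reals all_analysis.
From mathcomp Require Import measurable_realfun complex ring lra zify.
Import Order.TTheory GRing.Theory Num.Theory.
Import ComplexField.
Import numFieldNormedType.Exports.

(* On the closed subspace Q the equality X = S_phi is tested against projected
   monomials, so X is lifted by phi in the Schur class as soon as psi - phi is
   orthogonal to Q.  This uses that phi S is orthogonal to Q, where S is the
   orthogonal complement of Q in H^2; it follows from the uniformly bounded Fejer
   means of phi.  In that case psi and phi have the same pairing with M_Q, and
   (1) implies (2).

   Conversely, let K be the set of measurable functions of modulus at most 1.
   The element g of least norm in the L^2-closure of the convex set
   psi - K - S is orthogonal to S, so conj g lies in M_Q and (2) bounds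
   Re <psi, g> by ||g||_1; minimality tested at phi = g/|g| gives
   ||g||_2^2 + ||g||_1 <= Re <psi, g>, whence g = 0.  Nested bounded convex sets
   in L^2 having a common closure point, psi lies in K + S itself.  This replaces
   Hahn-Banach and the duality of L^1 and L^infinity.

   Orthogonality between H^2_0 and conj H^2, and density of polynomials, rest on
   the completeness of the monomials: the measurable sets whose indicators
   multiply functions with vanishing Fourier coefficients into such functions form
   a sigma-algebra, which contains all half-spaces t_i > b. *)

Set Implicit Arguments.
Unset Strict Implicit.
Unset Printing Implicit Defensive.

Local Open Scope ring_scope.
Local Open Scope classical_set_scope.

(** * Haar measure in angle coordinates and the iterated integral *)

Section TorusMeasure.
Context {R : realType}.

(** Behind the choice of M_Q is the identity M_Q = conj(S^perp), the complement being taken in L^2.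
    Condition (2) thus bounds psi on the annihilator of S, and a lift is an element of the coset psi
    + S with sup norm at most 1.

    Condition (3) is condition (2) on the affine hyperplane where X_Q takes the value 1: that
    hyperplane is the translate of the subspace in (3) by conj psi / ||psi||_2^2, and homogeneity
    recovers all of M_Q.

    Two obstacles shape the details. Functions are representatives, and [X] is linear and commutes
    with the compressions only up to functions of L^2 norm 0; its identities are therefore used in
    weak form, inside [inner (X f) h]. And K is not compact in the L^2 norm, so minimization only
    approximates psi by K + S; the nested convex sets close this gap in place of weak compactness.

    One tool, the element of least norm in the closure of a convex set, serves three times: for
    orthogonal projections, for the separation step and for the nested sets. *)

Definition tcons n (p : measurableTypeR R * n.-tuple R) : n.+1.-tuple R := [tuple of p.1 :: p.2].

Lemma measurable_tcons n : measurable_fun setT (@tcons n).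
Proof. exact: measurable_cons. Qed.

HB.instance Definition _ n := isMeasurableFun.Build _ _ _ _ (@tcons n) (@measurable_tcons n).

Definition mu01 : probability (measurableTypeR R) R := uniform_prob (@ltr01 R).

(** The n-fold product of [mu01]. The recursion peels coordinates in the order of [itint], so each
    step of the comparison is one application of Tonelli. *)
Fixpoint torus_measure n : probability (n.-tuple R) R :=
  match n return probability (n.-tuple R) R with
  | 0 => dirac [tuple]
  | m.+1 => distribution (mu01 \x torus_measure m)%E (@tcons m)
  end.

(** Tonelli confines this to nonnegative measurable integrands; signed ones reach it through their
    positive and negative parts, as in [rint]. *)
Lemma itintE n (g : n.-tuple R -> \bar R) : measurable_fun [set: n.-tuple R] g ->
  (forall t, 0 <= g t)%E -> itint g = (\int[torus_measure n]_t g t)%E.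
Proof.
elim: n g => [g mg g0|n IH g mg g0] /=.
  by rewrite integral_dirac// diracT mul1e.
rewrite ge0_integral_distribution// fubini_tonelli1//=; last first.
  exact: measurableT_comp.
rewrite integral_uniform//=; last 2 first.
- apply: (measurable_fun_fubini_tonelli_F (g \o @tcons n)) => //=.
  exact: measurableT_comp.
- by move=> x; apply: integral_ge0 => y _; exact: g0.
rewrite subr0 invr1 mul1e; apply: eq_integral => x _.
rewrite IH//=.
- apply: (measurableT_comp mg); exact: measurable_cons.
Qed.

End TorusMeasure.

#[global] Arguments inner : simpl never.
#[global] Arguments cint : simpl never.
#[global] Arguments rint : simpl never.
#[global] Arguments cmod : simpl never.
#[global] Arguments conjc : simpl never.

(** * The modulus of a complex number as a real number *)

Section Cmod.
Context {R : realType}.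
Implicit Types z w : R[i].

Lemma cmodE z : ((cmod z)%:C)%C = `|z|.
Proof. by rewrite normc_def. Qed.

Lemma cmod_ge0 z : 0 <= cmod z.
Proof. exact: sqrtr_ge0. Qed.

Lemma cmodM z w : cmod (z * w) = cmod z * cmod w.
Proof. by apply: complexI; rewrite rmorphM/= !cmodE normrM. Qed.

Lemma cmodD z w : cmod (z + w) <= cmod z + cmod w.
Proof. by rewrite -lecR rmorphD/= !cmodE ler_normD. Qed.

Lemma cmodN z : cmod (- z) = cmod z.
Proof. by apply: complexI; rewrite !cmodE normrN. Qed.

Lemma cmodB z w : cmod (z - w) = cmod (w - z).
Proof. by rewrite -cmodN opprB. Qed.

Lemma cmodJ z : cmod (conjc z) = cmod z.
Proof. by apply: complexI; rewrite !cmodE normcJ. Qed.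

Lemma cmodR (x : R) : cmod (x%:C)%C = `|x|.
Proof. by rewrite /cmod/= expr0n addr0 sqrtr_sqr. Qed.

Lemma cmod0 : cmod 0 = 0 :> R.
Proof. by rewrite (cmodR 0) normr0. Qed.

Lemma cmod1 : cmod 1 = 1 :> R.
Proof. by rewrite (cmodR 1) normr1. Qed.

Lemma cmod_eq0 z : (cmod z == 0) = (z == 0).
Proof. by rewrite -(inj_eq (@complexI _)) cmodE normr_eq0. Qed.

Lemma sqr_cmod z : cmod z ^+ 2 = complex.Re z ^+ 2 + complex.Im z ^+ 2.
Proof. by rewrite sqr_sqrtr// addr_ge0// sqr_ge0. Qed.

Lemma le_Re_cmod z : `|complex.Re z| <= cmod z.
Proof.
by rewrite -(ler_pXn2r (ltn0Sn 1)) ?nnegrE ?cmod_ge0//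
  sqr_cmod real_normK ?num_real// lerDl sqr_ge0.
Qed.

Lemma le_Im_cmod z : `|complex.Im z| <= cmod z.
Proof.
by rewrite -(ler_pXn2r (ltn0Sn 1)) ?nnegrE ?cmod_ge0//
  sqr_cmod real_normK ?num_real// lerDr sqr_ge0.
Qed.

Lemma cmod_le_ReIm z : cmod z <= `|complex.Re z| + `|complex.Im z|.
Proof.
rewrite -(ler_pXn2r (ltn0Sn 1)) ?nnegrE ?cmod_ge0 ?addr_ge0//.
rewrite sqr_cmod sqrrD !real_normK ?num_real//.
by rewrite lerD2r lerDl mulrn_wge0// mulr_ge0.
Qed.

Lemma mul_conjc z : z * conjc z = ((cmod z ^+ 2)%:C)%C.
Proof. by rewrite rmorphXn/= cmodE sqr_normc. Qed.

Lemma cReM z w : complex.Re (z * w) =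
  complex.Re z * complex.Re w - complex.Im z * complex.Im w.
Proof. by case: z => ? ?; case: w. Qed.

Lemma cImM z w : complex.Im (z * w) =
  complex.Re z * complex.Im w + complex.Im z * complex.Re w.
Proof. by case: z => ? ?; case: w. Qed.

Lemma cReD z w : complex.Re (z + w) = complex.Re z + complex.Re w.
Proof. by case: z => ? ?; case: w. Qed.

Lemma cImD z w : complex.Im (z + w) = complex.Im z + complex.Im w.
Proof. by case: z => ? ?; case: w. Qed.

Lemma cReN z : complex.Re (- z) = - complex.Re z. Proof. by case: z. Qed.
Lemma cImN z : complex.Im (- z) = - complex.Im z. Proof. by case: z. Qed.
Lemma cReJ z : complex.Re (conjc z) = complex.Re z. Proof. by case: z. Qed.
Lemma cImJ z : complex.Im (conjc z) = - complex.Im z. Proof. by case: z. Qed.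

Lemma conjcD z w : conjc (z + w) = conjc z + conjc w.
Proof. exact: rmorphD. Qed.

Lemma conjcB z w : conjc (z - w) = conjc z - conjc w.
Proof. exact: rmorphB. Qed.

Lemma conjcM z w : conjc (z * w) = conjc z * conjc w.
Proof. exact: rmorphM. Qed.

Lemma conjcN z : conjc (- z) = - conjc z.
Proof. exact: rmorphN. Qed.

Lemma conjcR (x : R) : conjc (x%:C)%C = (x%:C)%C.
Proof. by rewrite /conjc/= oppr0. Qed.

Lemma complex_ext z w : complex.Re z = complex.Re w ->
  complex.Im z = complex.Im w -> z = w.
Proof. by case: z => ? ?; case: w => ? ? /= -> ->. Qed.

End Cmod.

(** * Complex-valued integrals over the torus *)

Section ComplexIntegral.
Context {R : realType} {n : nat}.
Local Notation mu := (@torus_measure R n).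
Implicit Types f g h : @tfun R n.

Lemma measCD f g : measC f -> measC g -> measC (fun t => f t + g t).
Proof.
move=> [f1 f2] [g1 g2]; split.
- by under eq_fun do rewrite cReD; exact: measurable_funD.
- by under eq_fun do rewrite cImD; exact: measurable_funD.
Qed.

Lemma measCN f : measC f -> measC (fun t => - f t).
Proof.
move=> [f1 f2]; split.
- by under eq_fun do rewrite cReN; exact: measurableT_comp.
- by under eq_fun do rewrite cImN; exact: measurableT_comp.
Qed.

Lemma measCM f g : measC f -> measC g -> measC (fun t => f t * g t).
Proof.
move=> [f1 f2] [g1 g2]; split.
- by under eq_fun do rewrite cReM; apply: measurable_funB; exact: measurable_funM.
- by under eq_fun do rewrite cImM; apply: measurable_funD; exact: measurable_funM.
Qed.

Lemma measCJ f : measC f -> measC (fun t => conjc (f t)).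
Proof.
move=> [f1 f2]; split.
- by under eq_fun do rewrite cReJ.
- by under eq_fun do rewrite cImJ; exact: measurableT_comp.
Qed.

Lemma measC_cst (c : R[i]) : measC (fun _ : n.-tuple R => c).
Proof. by split; exact: measurable_cst. Qed.

Lemma measC_R (u : n.-tuple R -> R) : measurable_fun [set: n.-tuple R] u ->
  measC (fun t => ((u t)%:C)%C).
Proof. by move=> mu_; split => //=; exact: measurable_cst. Qed.

Lemma measurable_cmod f : measC f -> measurable_fun [set: n.-tuple R] (fun t => cmod (f t)).
Proof.
move=> [f1 f2]; apply: measurableT_comp => //.
  apply: (@measurable_funS _ _ _ _ setT) => //.
  exact: continuous_measurable_fun (@sqrt_continuous R).
by apply: measurable_funD; apply: measurable_funX.
Qed.

Definition cintegrable f :=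
  mu.-integrable setT (fun t => (complex.Re (f t))%:E) /\
  mu.-integrable setT (fun t => (complex.Im (f t))%:E).

Lemma cintegrable_le f (G : n.-tuple R -> R) : measC f ->
  mu.-integrable setT (fun t => (G t)%:E) -> (forall t, cmod (f t) <= G t) ->
  cintegrable f.
Proof.
move=> [f1 f2] iG fG; split; apply: le_integrable iG => //=.
- exact/measurable_EFinP.
- by move=> t _; rewrite lee_fin (le_trans (le_Re_cmod _))// (le_trans (fG _)) ?ler_norm.
- exact/measurable_EFinP.
- by move=> t _; rewrite lee_fin (le_trans (le_Im_cmod _))// (le_trans (fG _)) ?ler_norm.
Qed.

Lemma cintegrable_meas f : cintegrable f -> measC f.
Proof.
by move=> [/integrableP[/measurable_EFinP ? _] /integrableP[/measurable_EFinP ? _]].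
Qed.

Lemma integrable_cmod f : cintegrable f ->
  mu.-integrable setT (fun t => (cmod (f t))%:E).
Proof.
move=> fi; have [f1 f2] := fi.
apply: (@le_integrable _ _ _ mu _ measurableT _ (fun t => (`|complex.Re (f t)|%:E + `|complex.Im (f t)|%:E)%E)) => //.
- by apply/measurable_EFinP; apply: measurable_cmod; exact: cintegrable_meas.
- move=> t _; rewrite -EFinD !abse_EFin lee_fin ger0_norm ?cmod_ge0//.
  by rewrite ger0_norm ?addr_ge0// cmod_le_ReIm.
- by apply: integrableD => //; exact: integrable_norm.
Qed.

(** Integrability makes the integrals of both parts finite; [fine] would turn an infinite one into
    0. *)
Lemma rintE (g : n.-tuple R -> R) : mu.-integrable setT (fun t => (g t)%:E) ->
  rint g = Rintegral mu setT g.
Proof.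
move=> gi; have /integrableP[/measurable_EFinP mg _] := gi.
rewrite /Rintegral integralE fineB; last 2 first.
- exact: integrable_pos_fin_num.
- exact: integrable_neg_fin_num.
rewrite /rint !itintE.
- congr (fine _ - fine _); apply: eq_integral => t _; rewrite ?funeposE ?funenegE.
  + by rewrite EFin_max.
  + by rewrite EFin_max EFinN.
- by apply/measurable_EFinP; apply: measurable_maxr => //; exact: measurableT_comp.
- by move=> t; rewrite lee_fin le_max lexx orbT.
- by apply/measurable_EFinP; apply: measurable_maxr.
- by move=> t; rewrite lee_fin le_max lexx orbT.
Qed.

Lemma cintE f : cintegrable f -> cint f =
  (Rintegral mu setT (fun t => complex.Re (f t)) +i*
   Rintegral mu setT (fun t => complex.Im (f t)))%C.
Proof. by move=> [? ?]; rewrite /cint !rintE. Qed.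

Lemma cintegrableD f g : cintegrable f -> cintegrable g ->
  cintegrable (fun t => f t + g t).
Proof.
move=> [f1 f2] [g1 g2]; split.
- by under eq_fun do rewrite cReD EFinD; exact: integrableD.
- by under eq_fun do rewrite cImD EFinD; exact: integrableD.
Qed.

Lemma cintD f g : cintegrable f -> cintegrable g ->
  cint (fun t => f t + g t) = cint f + cint g.
Proof.
move=> fi gi; rewrite !cintE//; last exact: cintegrableD.
have [[f1 f2] [g1 g2]] := (fi, gi).
apply: complex_ext => /=.
- by under eq_Rintegral do rewrite cReD; rewrite RintegralD.
- by under eq_Rintegral do rewrite cImD; rewrite RintegralD.
Qed.

Lemma integrable_RZ (a : R) (u : n.-tuple R -> R) :
  mu.-integrable setT (fun t => (u t)%:E) -> mu.-integrable setT (fun t => (a * u t)%:E).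
Proof. by move=> ui; under eq_fun do rewrite EFinM; exact: integrableZl. Qed.

Lemma cintegrableZ c f : cintegrable f -> cintegrable (fun t => c * f t).
Proof.
move=> [f1 f2]; split.
- under eq_fun do rewrite cReM EFinB; apply: integrableB => //; exact: integrable_RZ.
- under eq_fun do rewrite cImM EFinD; apply: integrableD => //; exact: integrable_RZ.
Qed.

Lemma cintZ c f : cintegrable f -> cint (fun t => c * f t) = c * cint f.
Proof.
move=> fi; rewrite !cintE//; last exact: cintegrableZ.
have [f1 f2] := fi.
apply: complex_ext => /=; rewrite ?cReM ?cImM/=.
- under eq_Rintegral do rewrite cReM.
  by rewrite RintegralB//= ?RintegralZl//; exact: integrable_RZ.
- under eq_Rintegral do rewrite cImM.
  by rewrite RintegralD//= ?RintegralZl//; exact: integrable_RZ.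
Qed.

Lemma cintegrableJ f : cintegrable f -> cintegrable (fun t => conjc (f t)).
Proof.
move=> [f1 f2]; split.
- by under eq_fun do rewrite cReJ.
- by under eq_fun do rewrite cImJ EFinN; exact: integrableN.
Qed.

Lemma cintJ f : cintegrable f -> cint (fun t => conjc (f t)) = conjc (cint f).
Proof.
move=> fi; rewrite !cintE//; last exact: cintegrableJ.
have [f1 f2] := fi.
apply: complex_ext => /=.
- by apply: eq_Rintegral => t _; rewrite cReJ.
- under eq_Rintegral do rewrite cImJ -mulN1r.
  by rewrite RintegralZl// mulN1r.
Qed.

Lemma L1normE f : measC f -> L1norm f = (\int[mu]_t (cmod (f t))%:E)%E.
Proof.
move=> mf; rewrite /L1norm itintE//.
- by apply/measurable_EFinP; exact: measurable_cmod.
- by move=> t; rewrite lee_fin cmod_ge0.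
Qed.

Lemma Re_cint_le f : cintegrable f ->
  complex.Re (cint f) <= Rintegral mu setT (fun t => cmod (f t)).
Proof.
move=> fi; have [f1 f2] := fi; rewrite cintE//=.
apply: le_Rintegral => //; first exact: integrable_cmod.
by move=> t _; rewrite (le_trans (ler_norm _) (le_Re_cmod _)).
Qed.

Lemma cmod_cint_le f : cintegrable f ->
  cmod (cint f) <= Rintegral mu setT (fun t => cmod (f t)).
Proof.
move=> fi; have [->|z0] := eqVneq (cint f) 0.
  by rewrite cmod0; apply: Rintegral_ge0 => t _; exact: cmod_ge0.
(* rotating f by the phase of its integral makes the latter nonnegative *)
pose c := ((cmod (cint f))^-1%:C)%C * conjc (cint f).
have cm0 : cmod (cint f) != 0 by rewrite cmod_eq0.
have c1 : cmod c = 1.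
  by rewrite cmodM cmodR cmodJ ger0_norm ?invr_ge0 ?cmod_ge0// mulVf.
have -> : cmod (cint f) = complex.Re (cint (fun t => c * f t)).
  rewrite cintZ// /c -mulrA [conjc _ * _]mulrC mul_conjc -rmorphM/=.
  by rewrite expr2 mulrA mulVf// mul1r.
apply: (le_trans (Re_cint_le (cintegrableZ c fi))).
by under eq_Rintegral do rewrite cmodM c1 mul1r.
Qed.

Lemma cmod_cint_leL1 f : cintegrable f -> ((cmod (cint f))%:E <= L1norm f)%E.
Proof.
move=> fi; rewrite L1normE; last exact: cintegrable_meas.
have h := integrable_cmod fi.
rewrite -(fineK (integrable_fin_num measurableT h)) lee_fin.
exact: cmod_cint_le.
Qed.

End ComplexIntegral.

(** * L^2 as a seminormed inner product space *)

Section L2.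
Context {R : realType} {n : nat}.
Local Notation mu := (@torus_measure R n).
Implicit Types f g h : @tfun R n.

Lemma L2sqE f : measC f -> L2sq f = (\int[mu]_t (cmod (f t) ^+ 2)%:E)%E.
Proof.
move=> mf; rewrite /L2sq itintE//.
- by apply/measurable_EFinP; apply: measurable_funX; exact: measurable_cmod.
- by move=> t; rewrite lee_fin sqr_ge0.
Qed.

Lemma inL2_meas f : inL2 f -> measC f. Proof. by case. Qed.

Lemma inL2P f : measC f ->
  inL2 f <-> mu.-integrable setT (fun t => (cmod (f t) ^+ 2)%:E).
Proof.
move=> mf; rewrite /inL2 L2sqE//; split=> [[_ fi]|/integrableP[_]].
  apply/integrableP; split.
    by apply/measurable_EFinP; apply: measurable_funX; exact: measurable_cmod.
  by under eq_integral do rewrite abse_EFin ger0_norm ?sqr_ge0//.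
by under eq_integral do rewrite abse_EFin ger0_norm ?sqr_ge0//.
Qed.

Lemma integrable_sqr_cmod f : inL2 f ->
  mu.-integrable setT (fun t => (cmod (f t) ^+ 2)%:E).
Proof. by move=> fL; apply/inL2P => //; exact: inL2_meas. Qed.

Lemma inL2_le f (G : n.-tuple R -> R) : measC f ->
  mu.-integrable setT (fun t => (G t)%:E) -> (forall t, cmod (f t) ^+ 2 <= G t) ->
  inL2 f.
Proof.
move=> mf iG fG; apply/inL2P => //.
apply: le_integrable iG => //=.
- by apply/measurable_EFinP; apply: measurable_funX; exact: measurable_cmod.
- move=> t _; rewrite lee_fin ger0_norm ?sqr_ge0//.
  by rewrite (le_trans (fG t))// ler_norm.
Qed.

Lemma L2norm_ge0 f : 0 <= L2norm f. Proof. exact: sqrtr_ge0. Qed.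
Hint Resolve L2norm_ge0 : core.

Lemma sqr_L2norm f : inL2 f ->
  L2norm f ^+ 2 = Rintegral mu setT (fun t => cmod (f t) ^+ 2).
Proof.
move=> fL; rewrite /L2norm L2sqE; last exact: inL2_meas.
rewrite sqr_sqrtr//; apply: fine_ge0; apply: integral_ge0 => t _.
by rewrite lee_fin sqr_ge0.
Qed.

Lemma L2norm_ext f g : (forall t, cmod (f t) = cmod (g t)) -> L2norm f = L2norm g.
Proof.
move=> fg; rewrite /L2norm /L2sq; congr (Num.sqrt (fine (itint _))).
by apply/funext => t; rewrite fg.
Qed.

Lemma inL2_cst (c : R[i]) : inL2 (@fconst R n c).
Proof.
apply: (@inL2_le _ (fun=> cmod c ^+ 2)) => //.
exact: finite_measure_integrable_cst.
Qed.

Lemma inL2D f g : inL2 f -> inL2 g -> inL2 (fadd f g).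
Proof.
move=> fL gL; have fi := integrable_sqr_cmod fL; have gi := integrable_sqr_cmod gL.
apply: (@inL2_le _ (fun t => 2 * (cmod (f t) ^+ 2) + 2 * (cmod (g t) ^+ 2))).
- by apply: measCD; exact: inL2_meas.
- by under eq_fun do rewrite EFinD; apply: integrableD => //; exact: integrable_RZ.
- move=> t; apply: (@le_trans _ _ ((cmod (f t) + cmod (g t)) ^+ 2)).
    by rewrite ler_pXn2r ?nnegrE ?addr_ge0 ?cmod_ge0// cmodD.
  by have := sqr_ge0 (cmod (f t) - cmod (g t)); lra.
Qed.

Lemma inL2Z c f : inL2 f -> inL2 (fscale c f).
Proof.
move=> fL; have fi := integrable_sqr_cmod fL.
apply: (@inL2_le _ (fun t => cmod c ^+ 2 * (cmod (f t) ^+ 2))).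
- by apply: measCM; [exact: measC_cst|exact: inL2_meas].
- exact: integrable_RZ.
- by move=> t; rewrite cmodM exprMn.
Qed.

Lemma fsubE f g : fsub f g = fadd f (fscale (-1) g).
Proof. by apply/funext => t; rewrite /fsub /fadd /fscale mulN1r. Qed.

Lemma inL2B f g : inL2 f -> inL2 g -> inL2 (fsub f g).
Proof. by move=> fL gL; rewrite fsubE; apply: inL2D => //; exact: inL2Z. Qed.

Lemma inL2J f : inL2 f -> inL2 (fconj f).
Proof.
move=> fL; have fi := integrable_sqr_cmod fL.
apply: (@inL2_le _ (fun t => cmod (f t) ^+ 2)) => //.
- by apply: measCJ; exact: inL2_meas.
- by move=> t; rewrite cmodJ.
Qed.

Lemma fconjK f : fconj (fconj f) = f.
Proof. by apply/funext => t; rewrite /fconj conjcK. Qed.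

Lemma cintegrable_mul f g : inL2 f -> inL2 g -> cintegrable (fun t => f t * g t).
Proof.
move=> fL gL; have fi := integrable_sqr_cmod fL; have gi := integrable_sqr_cmod gL.
apply: (@cintegrable_le _ _ _ (fun t => cmod (f t) ^+ 2 + cmod (g t) ^+ 2)).
- by apply: measCM; exact: inL2_meas.
- by under eq_fun do rewrite EFinD; exact: integrableD.
- move=> t; rewrite cmodM; have := sqr_ge0 (cmod (f t) - cmod (g t)).
  have := sqr_ge0 (cmod (f t)); have := sqr_ge0 (cmod (g t)); lra.
Qed.

Lemma cintegrable_inner f g : inL2 f -> inL2 g ->
  cintegrable (fun t => f t * conjc (g t)).
Proof. by move=> fL gL; apply: (cintegrable_mul fL (inL2J gL)). Qed.

Lemma cintegrable_L2 f : inL2 f -> cintegrable f.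
Proof.
move=> fL; have := cintegrable_mul fL (inL2_cst 1).
by under eq_fun do rewrite mulr1.
Qed.

Lemma innerDl f g h : inL2 f -> inL2 g -> inL2 h ->
  inner (fadd f g) h = inner f h + inner g h.
Proof.
move=> fL gL hL; rewrite /inner -cintD; [|exact: cintegrable_inner..].
by congr cint; apply/funext => t; rewrite /fadd mulrDl.
Qed.

Lemma innerZl c f g : inL2 f -> inL2 g -> inner (fscale c f) g = c * inner f g.
Proof.
move=> fL gL; rewrite /inner -cintZ; last exact: cintegrable_inner.
by congr cint; apply/funext => t; rewrite /fscale mulrA.
Qed.

Lemma innerC f g : inL2 f -> inL2 g -> inner g f = conjc (inner f g).
Proof.
move=> fL gL; rewrite /inner -cintJ; last exact: cintegrable_inner.
by congr cint; apply/funext => t; rewrite conjcM conjcK mulrC.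
Qed.

Lemma innerBl f g h : inL2 f -> inL2 g -> inL2 h ->
  inner (fsub f g) h = inner f h - inner g h.
Proof.
move=> fL gL hL; rewrite fsubE innerDl// ?innerZl// ?mulN1r//; exact: inL2Z.
Qed.

Lemma innerDr f g h : inL2 f -> inL2 g -> inL2 h ->
  inner f (fadd g h) = inner f g + inner f h.
Proof.
move=> fL gL hL; rewrite (innerC (inL2D gL hL) fL) innerDl// conjcD.
by rewrite -!innerC.
Qed.

Lemma innerZr c f g : inL2 f -> inL2 g -> inner f (fscale c g) = conjc c * inner f g.
Proof.
by move=> fL gL; rewrite (innerC (inL2Z c gL) fL) innerZl// conjcM -innerC.
Qed.

Lemma innerBr f g h : inL2 f -> inL2 g -> inL2 h ->
  inner f (fsub g h) = inner f g - inner f h.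
Proof.
move=> fL gL hL; rewrite (innerC (inL2B gL hL) fL) innerBl// conjcB.
by rewrite -!innerC.
Qed.

Lemma inner_self f : inL2 f -> inner f f = ((L2norm f ^+ 2)%:C)%C.
Proof.
move=> fL; rewrite /inner cintE; last exact: cintegrable_inner.
apply: complex_ext => /=.
- by rewrite sqr_L2norm//; apply: eq_Rintegral => t _; rewrite mul_conjc.
- under eq_Rintegral do rewrite mul_conjc/=.
  by rewrite Rintegral_cst//= mul0r.
Qed.

Lemma sqr_L2normD f g : inL2 f -> inL2 g ->
  L2norm (fadd f g) ^+ 2 = L2norm f ^+ 2 + L2norm g ^+ 2 + 2 * complex.Re (inner f g).
Proof.
move=> fL gL; apply: complexI; rewrite -inner_self; last exact: inL2D.
rewrite innerDl//; last exact: inL2D.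
rewrite !innerDr// !inner_self// (innerC fL gL).
apply: complex_ext; rewrite ?cReD ?cImD/= ?cReJ ?cImJ; first by ring.
by rewrite !(addr0, add0r) addrN.
Qed.

Lemma L2norm_scale c f : inL2 f -> L2norm (fscale c f) = cmod c * L2norm f.
Proof.
move=> fL; apply/eqP; rewrite -(eqrXn2 (ltn0Sn 1)) ?mulr_ge0 ?cmod_ge0//.
apply/eqP/complexI; rewrite -inner_self; last exact: inL2Z.
rewrite innerZl ?innerZr ?inner_self//; last exact: inL2Z.
by rewrite mulrA mul_conjc exprMn -rmorphM.
Qed.

Lemma sqr_L2normB f g : inL2 f -> inL2 g ->
  L2norm (fsub f g) ^+ 2 = L2norm f ^+ 2 + L2norm g ^+ 2 - 2 * complex.Re (inner f g).
Proof.
move=> fL gL; rewrite fsubE sqr_L2normD//; last exact: inL2Z.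
rewrite L2norm_scale// cmodN cmod1 mul1r innerZr// conjcN conjc1 mulN1r cReN; ring.
Qed.

Lemma L2normBC f g : L2norm (fsub f g) = L2norm (fsub g f).
Proof. by apply: L2norm_ext => t; rewrite /fsub cmodB. Qed.

Lemma cauchy_schwarz f g : inL2 f -> inL2 g ->
  cmod (inner f g) <= L2norm f * L2norm g.
Proof.
move=> fL gL; set a := inner f g.
rewrite -(ler_pXn2r (ltn0Sn 1)) ?nnegrE ?mulr_ge0 ?cmod_ge0// exprMn.
(* The squared norm of [f - s a g] for real [s] is a quadratic polynomial in [s]. *)
have key s : 0 <= L2norm f ^+ 2 - 2 * s * cmod a ^+ 2 + s ^+ 2 * cmod a ^+ 2 * L2norm g ^+ 2.
  have := sqr_ge0 (L2norm (fsub f (fscale ((s%:C)%C * a) g))).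
  rewrite sqr_L2normB//; last exact: inL2Z.
  rewrite L2norm_scale// innerZr// -/a conjcM conjcR -mulrA [conjc a * a]mulrC.
  rewrite mul_conjc cmodM cmodR !exprMn real_normK ?num_real//.
  rewrite cReM/= mul0r subr0; congr (_ <= _); ring.
have [g0|g0] := eqVneq (L2norm g ^+ 2) 0.
  (* [g] may be a nonzero null function. The polynomial is then affine in [s], and unless [a]
     vanishes the chosen [s] gives it the value -1. *)
  rewrite g0 mulr0; rewrite leNgt; apply/negP => a0.
  have := key ((L2norm f ^+ 2 + 1) / (2 * cmod a ^+ 2)).
  rewrite g0 mulr0 addr0.
  have -> : 2 * ((L2norm f ^+ 2 + 1) / (2 * cmod a ^+ 2)) * cmod a ^+ 2 = L2norm f ^+ 2 + 1.
    by field; rewrite -sqrf_eq0 gt_eqF.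
  lra.
have := key (L2norm g ^+ 2)^-1.
have -> : L2norm f ^+ 2 - 2 * (L2norm g ^+ 2)^-1 * cmod a ^+ 2 +
  (L2norm g ^+ 2)^-1 ^+ 2 * cmod a ^+ 2 * L2norm g ^+ 2 =
  L2norm f ^+ 2 - cmod a ^+ 2 / L2norm g ^+ 2.
  by field; rewrite -sqrf_eq0.
by rewrite subr_ge0 ler_pdivrMr// lt_def g0 sqr_ge0.
Qed.

Lemma L2normD f g : inL2 f -> inL2 g -> L2norm (fadd f g) <= L2norm f + L2norm g.
Proof.
move=> fL gL; rewrite -(ler_pXn2r (ltn0Sn 1)) ?nnegrE ?addr_ge0//.
rewrite sqr_L2normD// sqrrD.
have := le_trans (le_trans (ler_norm _) (le_Re_cmod (inner f g))) (cauchy_schwarz fL gL).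
lra.
Qed.

Lemma L2norm_triangle f g h : inL2 f -> inL2 g -> inL2 h ->
  L2norm (fsub f h) <= L2norm (fsub f g) + L2norm (fsub g h).
Proof.
move=> fL gL hL; rewrite (_ : fsub f h = fadd (fsub f g) (fsub g h)).
  by apply: L2normD; exact: inL2B.
by apply/funext => t; rewrite /fadd /fsub; ring.
Qed.

Lemma L2norm_fconj f : L2norm (fconj f) = L2norm f.
Proof. by apply: L2norm_ext => t; rewrite /fconj cmodJ. Qed.

Lemma L2norm_eq0_inner f g : inL2 f -> inL2 g -> L2norm f = 0 -> inner f g = 0.
Proof.
move=> fL gL f0; apply/eqP; rewrite -cmod_eq0 eq_le cmod_ge0 andbT.
by rewrite (le_trans (cauchy_schwarz fL gL))// f0 mul0r.
Qed.

Lemma L2norm_sub0_inner f g h : inL2 f -> inL2 g -> inL2 h ->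
  L2norm (fsub f g) = 0 -> inner f h = inner g h.
Proof.
move=> fL gL hL fg; apply/eqP; rewrite -subr_eq0 -innerBl//.
by rewrite L2norm_eq0_inner//; exact: inL2B.
Qed.

(** Cauchy-Schwarz against the constant 1, whose norm is 1 because the measure is a probability. *)
Lemma Rint_cmod_le_L2norm f : inL2 f ->
  Rintegral mu setT (fun t => cmod (f t)) <= L2norm f.
Proof.
move=> fL; pose g : tfun n := fun t => ((cmod (f t))%:C)%C.
have gL : inL2 g.
  apply: (@inL2_le _ (fun t => cmod (f t) ^+ 2)).
  - by apply: measC_R; exact: measurable_cmod (inL2_meas fL).
  - exact: integrable_sqr_cmod.
  - by move=> t; rewrite cmodR ger0_norm ?cmod_ge0.
have := cauchy_schwarz gL (inL2_cst 1).
have -> : L2norm g = L2norm f.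
  by apply: L2norm_ext => t; rewrite cmodR ger0_norm ?cmod_ge0.
have -> : L2norm (@fconst R n 1) = 1.
  apply/eqP; rewrite -(eqrXn2 (ltn0Sn 1))// expr1n sqr_L2norm; last exact: inL2_cst.
  under eq_Rintegral do rewrite /fconst cmod1 expr1n.
  by rewrite Rintegral_cst//= mul1r probability_setT.
rewrite mulr1; apply: le_trans.
rewrite (le_trans _ (le_Re_cmod _))// (le_trans _ (ler_norm _))//.
rewrite /inner cintE/=; last by apply: (cintegrable_inner gL (inL2_cst 1)).
rewrite le_eqVlt; apply/orP; left; apply/eqP; apply: eq_Rintegral => t _.
by rewrite mulr1 mul0r subr0.
Qed.

(** The bound holds almost everywhere, as in [schur]; the unit ball K is [bdd 1]. *)
Definition bdd (M : R) f := measC f /\ {ae mu, forall t, cmod (f t) <= M}.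

Lemma sqr_L2norm_le_ae f (G : n.-tuple R -> R) : measC f ->
  mu.-integrable setT (fun t => (G t)%:E) ->
  {ae mu, forall t, cmod (f t) ^+ 2 <= G t} ->
  inL2 f /\ L2norm f ^+ 2 <= Rintegral mu setT G.
Proof.
move=> mf iG fG.
have mf2 : measurable_fun [set: n.-tuple R] (fun t => (cmod (f t) ^+ 2)%:E).
  by apply/measurable_EFinP; apply: measurable_funX; exact: measurable_cmod.
have le : (\int[mu]_t (cmod (f t) ^+ 2)%:E <= \int[mu]_t (G t)%:E)%E.
  (* [G] is known to be nonnegative only almost everywhere; its positive part is so everywhere and
     has the same integral. *)
  have iG' : mu.-integrable setT (fun t => (Num.max (G t) 0)%:E).
    have := integrable_funepos measurableT iG.
    by apply: eq_integrable => // t _; rewrite funeposE EFin_max.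
  have -> : (\int[mu]_t (G t)%:E = \int[mu]_t (Num.max (G t) 0)%:E)%E.
    apply: ae_eq_integral => //; [by case/integrableP: iG|by case/integrableP: iG'|].
    apply: filterS fG => t fG _; congr EFin; apply/esym/max_idPl.
    exact: le_trans (sqr_ge0 _) fG.
  apply: ae_ge0_le_integral => //.
  - by move=> t _; rewrite lee_fin sqr_ge0.
  - by move=> t _; rewrite lee_fin le_max lexx orbT.
  - by case/integrableP: iG'.
  - by apply: filterS fG => t fG _; rewrite lee_fin le_max fG.
have fL : inL2 f.
  by split=> //; rewrite L2sqE// (le_lt_trans le)// (integrable_lty measurableT iG).
split=> //; rewrite sqr_L2norm//; apply: fine_le => //.
- exact: (integrable_fin_num measurableT (integrable_sqr_cmod fL)).
- exact: (integrable_fin_num measurableT iG).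
Qed.

Lemma bdd_mul M f g : 0 <= M -> bdd M f -> inL2 g ->
  inL2 (fmul f g) /\ L2norm (fmul f g) <= M * L2norm g.
Proof.
move=> M0 [mf fM] gL; have gi := integrable_sqr_cmod gL.
have [] := @sqr_L2norm_le_ae (fmul f g) (fun t => M ^+ 2 * (cmod (g t) ^+ 2)).
- by apply: measCM => //; exact: inL2_meas.
- exact: integrable_RZ.
- apply: filterS fM => t fM; rewrite cmodM exprMn ler_wpM2r ?sqr_ge0//.
  by rewrite ler_pXn2r ?nnegrE ?cmod_ge0.
- move=> h1; rewrite RintegralZl// -sqr_L2norm// -exprMn.
  by rewrite ler_pXn2r ?nnegrE ?mulr_ge0.
Qed.

Lemma bdd_inL2 M f : 0 <= M -> bdd M f -> inL2 f.
Proof.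
move=> M0 fM; have [+ _] := bdd_mul M0 fM (inL2_cst 1).
by rewrite (_ : fmul _ _ = f)//; apply/funext => t; rewrite /fmul mulr1.
Qed.

Lemma bdd_everywhere M f : measC f -> (forall t, cmod (f t) <= M) -> bdd M f.
Proof. by move=> mf fM; split=> //; exact: aeW. Qed.

Lemma L2norm_eq0_ae f : inL2 f -> L2norm f = 0 -> {ae mu, forall t, f t = 0}.
Proof.
move=> fL f0.
have : (\int[mu]_t `|(cmod (f t) ^+ 2)%:E| = 0)%E.
  have fi := integrable_sqr_cmod fL.
  under eq_integral do rewrite abse_EFin ger0_norm ?sqr_ge0//.
  rewrite -(fineK (integrable_fin_num measurableT fi)).
  by rewrite -[fine _]/(Rintegral mu setT _) -sqr_L2norm// f0 expr0n.
move/(ae_eq_integral_abs mu measurableT) => h.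
have : ae_eq mu setT (fun t => (cmod (f t) ^+ 2)%:E) (cst 0%E).
  apply: h; case/integrableP: (integrable_sqr_cmod fL) => //.
apply: filterS => t /(_ I)[] /eqP.
by rewrite sqrf_eq0 cmod_eq0 => /eqP.
Qed.

Lemma ae_eq0_L2norm f : measC f -> {ae mu, forall t, f t = 0} -> inL2 f /\ L2norm f = 0.
Proof.
move=> mf f0; have [] := @sqr_L2norm_le_ae f (fun=> 0) mf.
- exact: finite_measure_integrable_cst.
- by apply: filterS f0 => t ->; rewrite cmod0 expr0n.
- move=> fL; rewrite Rintegral_cst// mul0r => h; split=> //.
  by apply/eqP; rewrite -sqrf_eq0 eq_le h sqr_ge0.
Qed.

End L2.

(** * Completeness of L^2 *)

Section Completeness.
Context {R : realType} {n : nat}.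
Local Notation mu := (@torus_measure R n).
Implicit Types f g h : @tfun R n.

Lemma limn_einf_le (u : (\bar R)^nat) (c : \bar R) :
  (forall k, u k <= c)%E -> (limn_einf u <= c)%E.
Proof.
move=> uc; rewrite limn_einf_lim; apply: lime_le; first exact: is_cvg_einfs.
by apply: nearW => k; apply: le_trans (uc k); apply: ereal_inf_lbound; exists k => /=.
Qed.

Lemma sum_half_le2 k : \sum_(0 <= j < k) (2 ^+ j : R)^-1 <= 2.
Proof.
suff -> : \sum_(0 <= j < k) (2 ^+ j : R)^-1 = 2 - 2 * (2 ^+ k)^-1.
  by rewrite gerBl mulr_ge0// invr_ge0 exprn_ge0.
elim: k => [|k IH]; first by rewrite big_nil expr0 invr1; lra.
by rewrite big_nat_recr//= IH exprS; field; rewrite expf_neq0.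
Qed.

(** Riesz-Fischer. The L^1 norms of the increments are summable, so their moduli sum to a finite [G]
    almost everywhere and the sequence converges there; Fatou transfers the L^2 bounds to the
    limit. *)
Lemma L2_fast_complete (u : nat -> tfun n) : (forall j, inL2 (u j)) ->
  (forall j, L2norm (fsub (u j.+1) (u j)) <= (2 ^+ j)^-1) ->
  exists f, inL2 f /\ forall j, L2norm (fsub f (u j)) <= 2 * (2 ^+ j)^-1.
Proof.
move=> uL du.
pose a j t := cmod (fsub (u j.+1) (u j) t).
have dL j : inL2 (fsub (u j.+1) (u j)) by apply: inL2B.
have ma j : measurable_fun [set: n.-tuple R] (fun t => (a j t)%:E).
  by apply/measurable_EFinP; apply: measurable_cmod; exact: inL2_meas.
have a0 j t : (0 <= (a j t)%:E)%E by rewrite lee_fin /a cmod_ge0.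
pose G t : \bar R := (\sum_(j <oo) (a j t)%:E)%E.
have mG : measurable_fun [set: n.-tuple R] G.
  apply: ge0_emeasurable_sum => //.
have iG : mu.-integrable setT G.
  apply/integrableP; split=> //.
  under eq_integral do rewrite gee0_abs ?nneseries_ge0//.
  rewrite integral_nneseries//.
  apply: (@le_lt_trans _ _ 2%:E); last exact: ltry.
  apply: lime_le.
    by apply: is_cvg_nneseries => j _ _; apply: integral_ge0.
  apply: nearW => k; apply: (@le_trans _ _ (\sum_(0 <= j < k) ((2 ^+ j)^-1)%:E)%E).
    apply: lee_sum => j _.
    have ai := integrable_cmod (cintegrable_L2 (dL j)).
    rewrite -(fineK (integrable_fin_num measurableT ai)) lee_fin.
    exact: le_trans (Rint_cmod_le_L2norm (dL j)) (du j).
  by rewrite sumEFin lee_fin sum_half_le2.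
pose D := [set t | (G t < +oo)%E].
have mD : measurable D.
  by rewrite -[D]setTI; exact: emeasurable_fun_infty_o.
have aeD : {ae mu, forall t, D t}.
  apply: filterS (integrable_ae measurableT iG) => t /(_ I).
  by rewrite /D/= fin_numElt => /andP[].
(* Cutting off outside [D] makes convergence hold at every point, from which measurability of the
   limit follows. *)
pose v j : tfun n := fun t => ((\1_D t : R)%:C)%C * u j t.
have vu j t : D t -> v j t = u j t.
  by move=> Dt; rewrite /v indicE mem_set//= mul1r.
have mv j : measC (v j).
  by apply: measCM; [apply: measC_R; exact: measurable_indic|exact: inL2_meas].
have cv t : cvgn (fun j => complex.Re (v j t)) /\ cvgn (fun j => complex.Im (v j t)).
  have [Dt|nDt] := pselect (D t); last first.
    have v0 j : v j t = 0 by rewrite /v indicE memNset//= mul0r.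
    by split; under eq_fun do rewrite v0; exact: is_cvg_cst.
  have ca : cvgn (series (fun j => a j t)).
    apply: nondecreasing_is_cvgn.
      by apply: nondecreasing_series => j _ _; exact: cmod_ge0.
    exists (fine (G t)) => _ [k _ <-].
    rewrite -lee_fin fineK; last by rewrite ge0_fin_numE// nneseries_ge0.
    by rewrite /series/= -sumEFin; apply: nneseries_lim_ge => j _ _.
  have main (p : R[i] -> R) : (forall z w, p (z - w) = p z - p w) ->
      (forall z, `|p z| <= cmod z) -> cvgn (fun j => p (v j t)).
    move=> pB p_le.
    have cs : cvgn (series (fun j => p (u j.+1 t) - p (u j t))).
      apply: normed_cvg; apply: (series_le_cvg _ _ _ ca) => //= j.
        exact: cmod_ge0.
      by rewrite -pB; exact: p_le.
    under eq_fun do rewrite vu//.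
    have -> : (fun j => p (u j t)) = (fun j => p (u 0 t) + series (fun j => p (u j.+1 t) - p (u j t)) j).
      by apply/funext => j; rewrite /series/= telescope_sumr// addrC subrK.
    by apply: is_cvgD => //; exact: is_cvg_cst.
  split; apply: main.
  - by move=> z w; rewrite cReD cReN.
  - exact: le_Re_cmod.
  - by move=> z w; rewrite cImD cImN.
  - exact: le_Im_cmod.
pose f : tfun n := fun t => (limn (fun j => complex.Re (v j t)) +i*
                             limn (fun j => complex.Im (v j t)))%C.
have mf : measC f.
  split; apply: (@measurable_fun_cvg _ _ _ setT _ _).
  - by move=> j; case: (mv j) => + _; exact.
  - by move=> t _; case: (cv t).
  - by move=> j; case: (mv j) => _; exact.
  - by move=> t _; case: (cv t).
(* Geometric sum of the increments; keeping the subtracted tail lets the induction on [k] close. *)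
have unorm j k : L2norm (fsub (u (j + k)%N) (u j)) <= 2 * (2 ^+ j)^-1 - 2 * (2 ^+ (j + k))^-1.
  elim: k => [|k IH].
    rewrite addn0 subrr (_ : fsub _ _ = @fconst R n 0).
      suff -> : @L2norm R n (@fconst R n 0) = 0 by [].
      by apply: (ae_eq0_L2norm (inL2_meas (inL2_cst 0)) _).2; exact: aeW.
    by apply/funext => t; rewrite /fsub subrr.
  rewrite addnS.
  apply: le_trans (L2norm_triangle (uL (j + k).+1) (uL (j + k)%N) (uL j)) _.
  have := du (j + k)%N; rewrite exprS invfM; move: IH; lra.
have bound j : inL2 (fsub f (u j)) /\ L2norm (fsub f (u j)) <= 2 * (2 ^+ j)^-1.
  pose c : R := 2 * (2 ^+ j)^-1.
  have c0 : 0 <= c by rewrite /c mulr_ge0 ?invr_ge0 ?exprn_ge0.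
  have mfu : measC (fsub f (u j)).
    by apply: measCD => //; apply: measCN; exact: inL2_meas.
  pose h k t : \bar R := (cmod (v (j + k)%N t - v j t) ^+ 2)%:E.
  have mh k : measurable_fun [set: n.-tuple R] (h k).
    apply/measurable_EFinP; apply: measurable_funX; apply: measurable_cmod.
    by apply: measCD => //; exact: measCN.
  have hf t : D t -> limn_einf (h ^~ t) = (cmod (fsub f (u j) t) ^+ 2)%:E.
    move=> Dt; have [c1 c2] := cv t.
    apply/(cvg_limn_einf_sup _).1.
    rewrite /h; apply: cvg_EFin; first exact: nearW.
    rewrite /fsub sqr_cmod !(cReD, cImD, cReN, cImN)/=.
    under eq_fun do rewrite /= sqr_cmod !(cReD, cImD, cReN, cImN) !vu//.
    have shift (w : nat -> R) (l : R) : w @ \oo --> l -> (fun k => w (j + k)%N) @ \oo --> l.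
      by move=> wl; rewrite -(cvg_shiftn j) in wl; under eq_fun do rewrite addnC; exact: wl.
    have c1' : (fun k => complex.Re (u k t)) @ \oo --> limn (fun j => complex.Re (v j t)).
      by move: c1; rewrite /cvg_to /=; under eq_fun do rewrite vu//.
    have c2' : (fun k => complex.Im (u k t)) @ \oo --> limn (fun j => complex.Im (v j t)).
      by move: c2; rewrite /cvg_to /=; under eq_fun do rewrite vu//.
    have s1 := shift _ _ c1'; have s2 := shift _ _ c2'.
    by apply: cvgD; (under eq_fun do rewrite expr2); rewrite expr2;
      (apply: cvgM; apply: cvgB; [|exact: cvg_cst| |exact: cvg_cst]);
      (exact: s1 || exact: s2).
  have le : (\int[mu]_t (cmod (fsub f (u j) t) ^+ 2)%:E <= (c ^+ 2)%:E)%E.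
    have -> : (\int[mu]_t (cmod (fsub f (u j) t) ^+ 2)%:E = \int[mu]_t limn_einf (h ^~ t))%E.
      apply: ae_eq_integral => //.
      - by apply/measurable_EFinP; apply: measurable_funX; exact: measurable_cmod.
      - rewrite (_ : (fun t => limn_einf (h ^~ t)) = (fun t => - limn_esup (fun k => - h k t))%E)//.
        apply: measurableT_comp => //; apply: measurable_fun_limn_esup => // k.
        exact: measurableT_comp.
      - by apply: filterS aeD => t Dt _; rewrite hf.
    (* Fatou along [k] with [j] fixed; each integral in the sequence is at most [c ^+ 2] by
       [unorm]. *)
    apply: le_trans (fatou mu measurableT mh _) _.
      by move=> k t _; rewrite lee_fin sqr_ge0.
    apply: limn_einf_le => k.
    have ujk : inL2 (fsub (u (j + k)%N) (u j)) by apply: inL2B.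
    apply: (@le_trans _ _ (\int[mu]_t (cmod (fsub (u (j + k)%N) (u j) t) ^+ 2)%:E)%E).
      apply: ge0_le_integral => //.
      - by move=> t _; rewrite lee_fin sqr_ge0.
      - by apply/measurable_EFinP; apply: measurable_funX; apply: measurable_cmod; exact: inL2_meas.
      - move=> t _; rewrite lee_fin /v -mulrBr cmodM exprMn -[leRHS]mul1r ler_wpM2r ?sqr_ge0//.
        by rewrite cmodR real_normK ?num_real// indicE; case: (t \in D); rewrite /= ?expr1n ?expr0n.
    have ii := integrable_sqr_cmod ujk.
    rewrite -(fineK (integrable_fin_num measurableT ii)) lee_fin.
    rewrite -[fine _]/(Rintegral mu setT _) -sqr_L2norm//.
    apply: lerXn2r; [by rewrite nnegrE L2norm_ge0|by rewrite nnegrE|].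
    by apply: le_trans (unorm j k) _; rewrite gerBl mulr_ge0 ?invr_ge0 ?exprn_ge0.
  have fL : inL2 (fsub f (u j)).
    by split=> //; rewrite L2sqE// (le_lt_trans le)// ltry.
  split=> //; rewrite -(ler_pXn2r (ltn0Sn 1)) ?nnegrE ?L2norm_ge0// -/c.
  rewrite sqr_L2norm// -lee_fin /Rintegral fineK//.
  exact: (integrable_fin_num measurableT (integrable_sqr_cmod fL)).
exists f; split; last by move=> j; case: (bound j).
rewrite (_ : f = fadd (fsub f (u 0)) (u 0)); first by apply: inL2D => //; case: (bound 0).
by apply/funext => t; rewrite /fadd /fsub subrK.
Qed.

Definition L2cvg (u : nat -> tfun n) f :=
  forall e : R, 0 < e -> exists N, forall i, (N <= i)%N -> L2norm (fsub (u i) f) < e.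

Lemma half_pow_small (e : R) : 0 < e -> exists N : nat, (2 ^+ N)^-1 < e.
Proof.
move=> e0; have [N _ /(_ N (leqnn N))/=] := near_infty_natSinv_lt (PosNum e0).
move=> h; exists N; apply: le_lt_trans h.
rewrite lef_pV2 ?posrE ?exprn_gt0//.
by rewrite -natrX ler_nat ltn_expl.
Qed.

Lemma L2_complete (u : nat -> tfun n) : (forall j, inL2 (u j)) ->
  (forall e : R, 0 < e -> exists N, forall i j, (N <= i)%N -> (N <= j)%N ->
     L2norm (fsub (u i) (u j)) < e) ->
  exists f, inL2 f /\ L2cvg u f.
Proof.
move=> uL uC.
have pw j : 0 < (2 ^+ j : R)^-1 by rewrite invr_gt0 exprn_gt0.
have [N HN] := choice (fun j => uC _ (pw j)).
(* Partial sums make the extracted indices monotone and at least [N j], so consecutive terms differ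
   by less than [(2 ^+ j)^-1]. *)
pose s j := (\sum_(i < j.+1) N i)%N.
have sN j : (N j <= s j)%N by rewrite /s big_ord_recr/= leq_addl.
have sS j : (s j <= s j.+1)%N by rewrite /s [X in (_ <= X)%N]big_ord_recr/= leq_addr.
have [|f [fL fc]] := @L2_fast_complete (u \o s) (fun j => uL _).
  move=> j /=; apply: ltW; apply: HN; last exact: sN.
  exact: leq_trans (sN j) (sS j).
exists f; split=> // e e0.
(* One third of [e] goes to [u i] against [u (s J)], two thirds to the bound [2 * (2 ^+ J)^-1] from
   there to [f]. *)
have [J hJ] := half_pow_small (divr_gt0 e0 (ltr0n _ 3)).
exists (N J) => i Ni.
apply: le_lt_trans (L2norm_triangle (uL i) (uL (s J)) fL) _.
have := HN J i (s J) Ni (sN J); have := fc J; rewrite /= L2normBC; lra.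
Qed.

End Completeness.

(** * Least-norm elements, nested convex sets, orthogonal projections *)

Section Hilbert.
Context {R : realType} {n : nat}.
Implicit Types (f g h x y : @tfun R n) (C : set (@tfun R n)).

Definition L2closure C f := forall e : R, 0 < e -> exists c, C c /\ L2norm (fsub f c) < e.

Definition fconv (s : R) f g := fadd (fscale ((1 - s)%:C)%C f) (fscale (s%:C)%C g).

Definition convex_fset C :=
  forall f g s, 0 <= s -> s <= 1 -> C f -> C g -> C (fconv s f g).

Lemma inL2conv s f g : inL2 f -> inL2 g -> inL2 (fconv s f g).
Proof. by move=> fL gL; apply: inL2D; exact: inL2Z. Qed.

Lemma L2norm0 : L2norm (@fconst R n 0) = 0.
Proof. by apply: (ae_eq0_L2norm (inL2_meas (inL2_cst 0)) _).2; exact: aeW. Qed.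

Lemma fsub_self f : fsub f f = @fconst R n 0.
Proof. by apply/funext => t; rewrite /fsub subrr. Qed.

Lemma sub_L2closure C f : C f -> L2closure C f.
Proof. by move=> Cf e e0; exists f; split=> //; rewrite fsub_self L2norm0. Qed.

Lemma sqr_L2norm_conv s f g : inL2 f -> inL2 g ->
  L2norm (fconv s f g) ^+ 2 = (1 - s) ^+ 2 * L2norm f ^+ 2 + s ^+ 2 * L2norm g ^+ 2
    + 2 * s * (1 - s) * complex.Re (inner f g).
Proof.
move=> fL gL; rewrite sqr_L2normD; [|exact: inL2Z..].
rewrite !L2norm_scale// !cmodR !exprMn !real_normK ?num_real//.
rewrite innerZl ?innerZr//; last exact: inL2Z.
by rewrite conjcR !cReM/= !mul0r !subr0; ring.
Qed.

Lemma L2closure_conv C f g s : convex_fset C -> (forall x, C x -> inL2 x) ->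
  inL2 f -> inL2 g -> 0 <= s -> s <= 1 ->
  L2closure C f -> L2closure C g -> L2closure C (fconv s f g).
Proof.
move=> cC CL fL gL s0 s1 Cf Cg e e0.
have [x [Cx fx]] := Cf (e / 2) ltac:(lra).
have [y [Cy gy]] := Cg (e / 2) ltac:(lra).
exists (fconv s x y); split; first exact: cC.
rewrite (_ : fsub _ _ = fconv s (fsub f x) (fsub g y)); last first.
  by apply/funext => t; rewrite /fconv /fsub /fadd /fscale; ring.
apply: le_lt_trans (L2normD _ _) _; [by apply: inL2Z; apply: inL2B => //; exact: CL..|].
rewrite !L2norm_scale; [|by apply: inL2B => //; exact: CL..].
rewrite !cmodR !ger0_norm ?subr_ge0//.
have h1 : (1 - s) * L2norm (fsub f x) <= L2norm (fsub f x).
  by rewrite ler_piMl ?L2norm_ge0//; lra.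
have h2 : s * L2norm (fsub g y) <= L2norm (fsub g y) by rewrite ler_piMl ?L2norm_ge0.
lra.
Qed.

Lemma L2norm_le_sub f g : inL2 f -> inL2 g -> L2norm f <= L2norm g + L2norm (fsub f g).
Proof.
move=> fL gL; rewrite {1}(_ : f = fadd g (fsub f g)); last first.
  by apply/funext => t; rewrite /fadd /fsub addrC subrK.
by apply: L2normD => //; exact: inL2B.
Qed.

(** A minimizing sequence is Cauchy by the parallelogram law. Its limit lies only in the closure of
    [C], so the variational inequality is stated for closure points; it comes from moving from [g]
    towards [x]. *)
Lemma min_norm C : (forall x, C x -> inL2 x) -> convex_fset C -> (exists x, C x) ->
  exists g, [/\ inL2 g, L2closure C g &
    forall x, inL2 x -> L2closure C x -> L2norm g ^+ 2 <= complex.Re (inner g x)].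
Proof.
move=> CL cC [x0 Cx0].
pose E := [set L2norm x | x in C].
have hE : has_inf E.
  split; first by exists (L2norm x0); exists x0.
  by exists 0 => _ [x _ <-]; exact: L2norm_ge0.
pose D := inf E.
have D0 : 0 <= D by apply: lb_le_inf; [case: hE|move=> _ [x _ <-]; exact: L2norm_ge0].
have DC x : C x -> D <= L2norm x by move=> Cx; apply: ge_inf; [case: hE|exists x].
have eta j : 0 < (2 ^+ j : R)^-1 by rewrite invr_gt0 exprn_gt0.
have ex j : exists x, C x /\ L2norm x < D + (2 ^+ j)^-1.
  have [_ [x Cx <-] xl] := inf_adherent (eta j) hE.
  by exists x.
have [c Hc] := choice ex.
have CCc j := (Hc j).1; have cD j := (Hc j).2.
have cL j : inL2 (c j) by apply: CL.
have [e e0|g [gL cg]] := L2_complete cL.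
  (* With [q = (2 ^+ N)^-1 <= 1] the parallelogram law bounds the squared distance by
     [4 (D + q)^2 - 4 D^2 <= (8 D + 4) q]. *)
  have [N hN] := @half_pow_small R (e ^+ 2 / (8 * D + 4)) ltac:(apply: divr_gt0; [exact: exprn_gt0|lra]).
  have pN k : (N <= k)%N -> (2 ^+ k : R)^-1 <= (2 ^+ N)^-1.
    by move=> Nk; rewrite lef_pV2 ?posrE ?exprn_gt0// ler_weXn2l// ler1n.
  have N1 : (2 ^+ N : R)^-1 <= 1 by rewrite invf_le1 ?exprn_gt0// exprn_ege1// ler1n.
  exists N => i j Ni Nj.
  have Cm := cC _ _ (1 / 2) ltac:(lra) ltac:(lra) (CCc i) (CCc j).
  have := DC _ Cm; move=> Dm.
  have : D ^+ 2 <= L2norm (fconv (1 / 2) (c i) (c j)) ^+ 2.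
    by rewrite ler_pXn2r ?nnegrE ?L2norm_ge0.
  rewrite sqr_L2norm_conv// => Dm2.
  have := sqr_L2normB (cL i) (cL j) => dd.
  have ci := cD i; have cj := cD j; have pi_ := pN i Ni; have pj := pN j Nj.
  set q := (2 ^+ N : R)^-1 in hN pi_ pj N1.
  have q0 : 0 < q by rewrite /q.
  have ci2 : L2norm (c i) ^+ 2 <= (D + q) ^+ 2.
    by rewrite ler_pXn2r ?nnegrE ?L2norm_ge0 ?addr_ge0//; lra.
  have cj2 : L2norm (c j) ^+ 2 <= (D + q) ^+ 2.
    by rewrite ler_pXn2r ?nnegrE ?L2norm_ge0 ?addr_ge0//; lra.
  have qq : q ^+ 2 <= q by rewrite expr2 ler_piMl//; lra.
  move: hN; rewrite ltr_pdivlMr; last by lra.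
  move=> hN; rewrite -(ltr_pXn2r (ltn0Sn 1)) ?nnegrE ?L2norm_ge0//; last by lra.
  move: ci2 cj2; have -> : (D + q) ^+ 2 = D ^+ 2 + 2 * D * q + q ^+ 2 by ring.
  rewrite dd; move: Dm2 hN qq; lra.
have Ccl x : inL2 x -> L2closure C x -> D <= L2norm x.
  move=> xL Cx; apply/ler_addgt0Pr => e e0; have [y [Cy xy]] := Cx e e0.
  apply: le_trans (DC y Cy) _; apply: le_trans (L2norm_le_sub (CL _ Cy) xL) _.
  by rewrite L2normBC lerD2l ltW.
have gcl : L2closure C g.
  move=> e e0; have [N hN] := cg e e0; exists (c N); split=> //.
  by rewrite L2normBC; exact: hN.
have gD : L2norm g <= D.
  apply/ler_addgt0Pr => e e0; have [N hN] := cg (e / 2) ltac:(lra).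
  have [M hM] := @half_pow_small R (e / 2) ltac:(lra).
  have := hN (maxn N M) (leq_maxl _ _); have := cD (maxn N M).
  have : (2 ^+ (maxn N M) : R)^-1 <= (2 ^+ M)^-1.
    by rewrite lef_pV2 ?posrE ?exprn_gt0// ler_weXn2l// ?ler1n// leq_maxr.
  have := L2norm_le_sub gL (cL (maxn N M)); rewrite L2normBC; lra.
exists g; split=> // x xL Cx; rewrite leNgt; apply/negP.
set G := L2norm g ^+ 2; set r := complex.Re _ => rG.
have A0 : 0 <= L2norm (fsub g x) ^+ 2 by apply: sqr_ge0.
rewrite sqr_L2normB// -/G -/r in A0.
have key s : 0 <= s -> s <= 1 -> G <= (1 - s) ^+ 2 * G + s ^+ 2 * L2norm x ^+ 2 + 2 * s * (1 - s) * r.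
  move=> s0 s1; rewrite -sqr_L2norm_conv//.
  have h := Ccl _ (inL2conv s gL xL) (L2closure_conv cC CL gL xL s0 s1 gcl Cx).
  by rewrite ler_pXn2r ?nnegrE ?L2norm_ge0// (le_trans gD).
set A := (G + _ - _) in A0; pose d := G - r.
have d0 : 0 < d by rewrite /d; lra.
(* On the segment the squared norm is [G + s (s A - 2 d)], with [A] the squared distance from [g] to
   [x]. This [s] gives [s A <= d], hence a value below the minimum [G]; the [d] in the denominator
   ensures [s <= 1] and covers [A = 0]. *)
pose s := d / (A + d).
have Ad : 0 < A + d by lra.
have s0 : 0 < s by rewrite /s divr_gt0.
have s1 : s <= 1 by rewrite /s ler_pdivrMr// mul1r; lra.
have := key s (ltW s0) s1.
rewrite (_ : _ + 2 * s * (1 - s) * r = G + s * (s * A - 2 * d)); last first.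
  by rewrite /A /d; ring.
rewrite lerDl pmulr_rge0// subr_ge0 => h.
have : s * A <= d by rewrite /s mulrAC ler_pdivrMr// ler_pM2l//; lra.
lra.
Qed.

(** For [j <= l] the least-norm point [g l] lies in the closure of [C j], and the variational
    inequality for [g j] gives [||g j - g l||^2 <= ||g l||^2 - ||g j||^2]. The norms increase and
    are bounded by [M], so the points form a Cauchy sequence. *)
Lemma nested_convex (C : nat -> set (@tfun R n)) (M : R) :
  (forall j x, C j x -> inL2 x) -> (forall j, convex_fset (C j)) ->
  (forall j, exists x, C j x) -> (forall j, C j.+1 `<=` C j) ->
  (forall j x, C j x -> L2norm x <= M) ->
  exists f, inL2 f /\ forall j, L2closure (C j) f.
Proof.
move=> CL cC C0 Cdec CM.
have [g Hg] := choice (fun j => min_norm (CL j) (cC j) (C0 j)).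
have gL j : inL2 (g j) by case: (Hg j).
have sub j l : (j <= l)%N -> C l `<=` C j.
  move=> jl; rewrite -(subnKC jl); elim: (l - j)%N => [|k IH]; first by rewrite addn0.
  by rewrite addnS; apply: subset_trans IH; exact: Cdec.
have clsub j l x : (j <= l)%N -> L2closure (C l) x -> L2closure (C j) x.
  by move=> jl Cx e /Cx[c [Cc xc]]; exists c; split=> //; exact: (sub _ _ jl).
have gcl j l : (j <= l)%N -> L2closure (C j) (g l).
  by move=> jl; apply: (clsub _ _ _ jl); case: (Hg l).
have key j l : (j <= l)%N ->
    L2norm (fsub (g j) (g l)) ^+ 2 <= L2norm (g l) ^+ 2 - L2norm (g j) ^+ 2.
  move=> jl; have [_ _ /(_ _ (gL l) (gcl _ _ jl))] := Hg j.
  by rewrite sqr_L2normB//; lra.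
pose G j := L2norm (g j) ^+ 2.
have ndG : nondecreasing_seq G.
  by move=> j l jl; have := le_trans (sqr_ge0 _) (key j l jl); rewrite /G; lra.
have M0 : 0 <= M by have [x Cx] := C0 0%N; exact: le_trans (L2norm_ge0 _) (CM _ _ Cx).
have ubG : has_ubound (range G).
  exists (M ^+ 2) => _ [j _ <-]; rewrite /G ler_pXn2r ?nnegrE ?L2norm_ge0//.
  apply/ler_addgt0Pr => e e0; have [_ /(_ e e0)[c [Cc gc]] _] := Hg j.
  apply: le_trans (L2norm_le_sub (gL j) (CL _ _ Cc)) _.
  by apply: lerD (CM _ _ Cc) (ltW gc).
have cG := nondecreasing_cvgn ndG ubG.
have Gle j : G j <= limn G by apply: nondecreasing_cvgn_le => //; exact: cvgP cG.
have [e e0|f [fL gf]] := L2_complete gL.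
  have e2 : 0 < e ^+ 2 by exact: exprn_gt0.
  have [N _ hN] : \forall k \near \oo, limn G - e ^+ 2 < G k.
    move: (cG); rewrite -(cvg_lim _ cG)// => /cvgr_gt; apply.
    by rewrite gtrBl.
  exists N; suff H i j : (N <= i)%N -> (i <= j)%N -> L2norm (fsub (g i) (g j)) < e.
    move=> i j Ni Nj; case: (leqP i j) => ij; first exact: H.
    by rewrite L2normBC; apply: H => //; exact: ltnW.
  move=> Ni ij; rewrite -(ltr_pXn2r (ltn0Sn 1)) ?nnegrE ?L2norm_ge0//; last exact: ltW.
  have := key i j ij; have := hN i Ni; have := Gle j; rewrite /G/=; lra.
exists f; split=> // j e e0.
have [N hN] := gf (e / 2) ltac:(lra).
have [c [Cc gc]] := gcl _ _ (leq_maxr N j) (e / 2) ltac:(lra).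
exists c; split=> //.
apply: le_lt_trans (L2norm_triangle fL (gL (maxn N j)) (CL _ _ Cc)) _.
have := hN _ (leq_maxl N j); rewrite L2normBC; lra.
Qed.

Lemma Re_conj_mul_ge0 (a : R[i]) : (forall c, 0 <= complex.Re (conjc c * a)) -> a = 0.
Proof.
move=> h; have := h (- a); rewrite conjcN mulNr mulrC mul_conjc cReN/= oppr_ge0 => h'.
by apply/eqP; rewrite -cmod_eq0 -sqrf_eq0 eq_le h' sqr_ge0.
Qed.

(** The least-norm element [x] for the convex set [F - Q] is the residual: the variational
    inequality at [x + c h] says that [Re (conj c <x, h>)] is nonnegative for every [c]. *)
Lemma projection_exists (Q : set (@tfun R n)) (F : @tfun R n) : closed_subspace Q -> inL2 F -> exists q, is_proj Q F q.
Proof.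
move=> [QL Q0 QD QZ Qcl] FL.
pose C := [set fsub F q | q in Q].
have [|||x [xL Cx xm]] := @min_norm C.
- by move=> _ [q Qq <-]; apply: inL2B => //; exact: QL.
- move=> _ _ s s0 s1 [q Qq <-] [q' Qq' <-].
  exists (fconv s q q'); first by apply: QD; exact: QZ.
  by apply/funext => t; rewrite /fconv /fsub /fadd /fscale rmorphB; ring.
- by exists (fsub F (@fconst R n 0)); exists (@fconst R n 0).
have Qq : Q (fsub F x).
  apply: Qcl => [|e /Cx[_ [[q Qq <-] h]]]; first exact: inL2B.
  exists q; split=> //; rewrite (_ : L2norm _ = L2norm (fsub x (fsub F q)))//.
  by apply: L2norm_ext => t; rewrite /fsub cmodB; congr cmod; ring.
exists (fsub F x); split=> // h Qh; have hL := QL _ Qh.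
rewrite (_ : fsub F (fsub F x) = x); last by apply/funext => t; rewrite /fsub; ring.
apply: Re_conj_mul_ge0 => c.
have := xm (fadd x (fscale c h)) (inL2D xL (inL2Z c hL)).
rewrite innerDr ?innerZr ?inner_self//; last exact: inL2Z.
rewrite cReD/= lerDl; apply; apply: sub_L2closure.
exists (fadd (fsub F x) (fscale (- c) h)); first by apply: QD => //; exact: QZ.
by apply/funext => t; rewrite /fsub /fadd /fscale; ring.
Qed.

End Hilbert.

(** * Characters of the circle *)

Section Expi.
Context {R : realType}.
Implicit Types x y : R.

Lemma expiD x y : expi (x + y) = expi x * expi y.
Proof. by apply: complex_ext; rewrite ?cReM ?cImM/= ?cosD ?sinD//; ring. Qed.

Lemma expi0 : expi 0 = 1 :> R[i].
Proof. by rewrite /expi cos0 sin0. Qed.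

Lemma expiN x : expi (- x) = conjc (expi x).
Proof. by rewrite /expi /conjc cosN sinN. Qed.

Lemma cmod_expi x : cmod (expi x) = 1.
Proof. by rewrite /cmod/= cos2Dsin2 sqrtr1. Qed.

Lemma expi2pi_int (k : int) : expi (2 * pi * k%:~R : R) = 1.
Proof.
have nat_case (m : nat) : expi (2 * pi * m%:R : R) = 1.
  elim: m => [|m IH]; first by rewrite mulr0 expi0.
  rewrite -[m.+1]addn1 natrD mulrDr mulr1 expiD IH mul1r /expi mulrC mulr_natr cos2pi sin2pi.
  by [].
case: k => m; first exact: nat_case.
by rewrite NegzE mulrNz mulrN expiN nat_case conjc1.
Qed.

End Expi.

(** * Integrals of sines and cosines over a period *)

Section Integral01.
Context {R : realType}.

Lemma uniform_FTC2 (f F : R -> R) : (forall x, 0 <= f x) -> continuous f ->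
  (forall x : R, is_derive x (1 : R) F (f x)) -> Rintegral (@mu01 R) setT f = F 1 - F 0.
Proof.
move=> f0 cf dF; rewrite /Rintegral integral_uniform; last 2 first.
- by apply/measurable_EFinP; exact: continuous_measurable_fun.
- by move=> x; rewrite lee_fin.
rewrite subr0 invr1 mul1e (@continuous_FTC2 _ _ F)//.
- exact: continuous_subspaceT.
- have cF x : {for x, continuous F} by apply/differentiable_continuous/derivable1_diffP.
  split=> [x _| |].
  + exact: (@ex_derive _ _ _ _ _ _ _ (dF x)).
  + by apply: cvg_at_right_filter; exact: cF.
  + by apply: cvg_at_left_filter; exact: cF.
- by move=> x _; rewrite derive1E; exact: derive_val.
Qed.

Lemma integrable_mu01 (f : R -> R) (M : R) : continuous f -> (forall x, `|f x| <= M) ->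
  (@mu01 R).-integrable setT (fun x => (f x)%:E).
Proof.
move=> cf fM; apply: (@le_integrable _ _ _ _ _ measurableT _ (fun=> M%:E)).
- by apply/measurable_EFinP; exact: continuous_measurable_fun.
- by move=> x _; rewrite !abse_EFin lee_fin (le_trans (fM x))// ler_norm.
- exact: finite_measure_integrable_cst.
Qed.

Lemma continuous_comp_scale (g : R -> R) (a : R) : continuous g -> continuous (fun x => g (a * x)).
Proof.
move=> cg x; apply: continuous_comp; last exact: cg.
by apply: cvgM; [exact: cvg_cst|exact: cvg_id].
Qed.

Lemma is_derive_scale_arg (a x : R) : is_derive x 1 (fun y : R => a * y) a.
Proof.
have -> : (fun y : R => a * y) = a *: (id : R -> R) by [].
by apply: is_derive_eq; rewrite /GRing.scale/= mulr1.
Qed.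

Lemma is_derive_sin_arg (a x : R) : a != 0 ->
  is_derive x 1 (fun y : R => y + sin (a * y) / a) (1 + cos (a * x)).
Proof.
move=> a0.
have h := is_derive_scale_arg a x.
have -> : (fun y : R => y + sin (a * y) / a) = id + a^-1 *: (sin \o (fun y => a * y)).
  by apply/funext => y; rewrite fctE /= /GRing.scale/= mulrC.
by apply: is_derive_eq; rewrite /GRing.scale/= mulrCA mulVf// mulr1.
Qed.

Lemma is_derive_cos_arg (a x : R) : a != 0 ->
  is_derive x 1 (fun y : R => y - cos (a * y) / a) (1 + sin (a * x)).
Proof.
move=> a0.
have h := is_derive_scale_arg a x.
have -> : (fun y : R => y - cos (a * y) / a) = id - a^-1 *: (cos \o (fun y => a * y)).
  by apply/funext => y; rewrite fctE /= /GRing.scale/= mulrC.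
by apply: is_derive_eq; rewrite /GRing.scale/= mulrCA mulVf// mulr1 opprK.
Qed.

(** [uniform_FTC2] takes a nonnegative integrand, hence the added 1, whose own integral accounts for
    all of [F 1 - F 0]. *)
Lemma integral01_trig (g F : R -> R) (a : R) : (forall x, `|g x| <= 1) -> continuous g ->
  (forall x : R, is_derive x (1 : R) F (1 + g (a * x))) -> F 1 - F 0 = 1 ->
  Rintegral (@mu01 R) setT (fun x => g (a * x)) = 0.
Proof.
move=> g1 cg dF F1.
have cc : continuous (fun x : R => g (a * x)) by exact: continuous_comp_scale.
have := @uniform_FTC2 (fun x => 1 + g (a * x)) F _ _ dF.
rewrite F1 RintegralD//=; last 2 first.
- exact: finite_measure_integrable_cst.
- by apply: (@integrable_mu01 _ 1).
rewrite Rintegral_cst//= probability_setT mul1r => h.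
have : 1 + Rintegral (@mu01 R) setT (fun x => g (a * x)) = 1.
  apply: h => x; first by have := g1 (a * x); rewrite ler_norml; lra.
  by apply: cvgD; [exact: cvg_cst|exact: cc].
by move/eqP; rewrite -subr_eq0 addrAC subrr add0r => /eqP.
Qed.

Lemma integral_expi_int (k : int) : k != 0 ->
  Rintegral (@mu01 R) setT (fun x => cos (2 * pi * k%:~R * x)) = 0 /\
  Rintegral (@mu01 R) setT (fun x => sin (2 * pi * k%:~R * x)) = 0.
Proof.
move=> k0; set a : R := 2 * pi * k%:~R.
have a0 : a != 0 by rewrite !mulf_neq0 ?intr_eq0// gt_eqF// pi_gt0.
have [ca sa] : cos a = 1 /\ sin a = 0.
  have E : expi a = 1 := expi2pi_int k.
  by split; [exact: (congr1 (@complex.Re R) E)|exact: (congr1 (@complex.Im R) E)].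
split.
- apply: (@integral01_trig cos _ a (@cos_max R) (@continuous_cos R)).
    by move=> x; exact: is_derive_sin_arg.
  by rewrite /= mulr1 mulr0 sa sin0; lra.
- apply: (@integral01_trig sin _ a (@sin_max R) (@continuous_sin R)).
    by move=> x; exact: is_derive_cos_arg.
  by rewrite /= mulr1 mulr0 ca cos0; lra.
Qed.

End Integral01.

(** * Monomials and their orthonormality *)

Section Monomials.
Context {R : realType}.

Lemma integrable_bounded n (g : n.-tuple R -> R) (M : R) :
  measurable_fun [set: n.-tuple R] g -> (forall t, `|g t| <= M) ->
  (@torus_measure R n).-integrable setT (fun t => (g t)%:E).
Proof.
move=> mg gM; apply: (@le_integrable _ _ _ _ _ measurableT _ (fun=> M%:E)).
- exact/measurable_EFinP.
- by move=> x _; rewrite !abse_EFin lee_fin (le_trans (gM x))// ler_norm.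
- exact: finite_measure_integrable_cst.
Qed.

Lemma Rintegral_tcons n (g : n.+1.-tuple R -> R) (M : R) :
  measurable_fun [set: n.+1.-tuple R] g -> (forall t, `|g t| <= M) ->
  Rintegral (@torus_measure R n.+1) setT g =
  Rintegral (@mu01 R) setT (fun x =>
    Rintegral (@torus_measure R n) setT (fun t => g (@tcons R n (x, t)))).
Proof.
move=> mg gM; rewrite /Rintegral; congr fine.
pose P : probability (measurableTypeR R * n.-tuple R)%type R := (mu01 \x torus_measure n)%E.
have gi : P.-integrable setT
    ((fun t => (g t)%:E) \o @tcons R n).
  apply: (@le_integrable _ _ _ _ _ measurableT _ (fun=> M%:E)).
  - by apply/measurable_EFinP; apply: measurableT_comp => //; exact: measurable_tcons.
  - by move=> x _; rewrite /= lee_fin (le_trans (gM _))// ler_norm.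
  - exact: finite_measure_integrable_cst.
rewrite [LHS]/= integral_distribution//; last exact/measurable_EFinP.
rewrite -[LHS](integral12_prod_meas1 gi).
apply: eq_integral => x _; rewrite /fubini_F fineK//.
apply: integrable_fin_num => //.
apply: (@integrable_bounded _ _ M) => [|t]; last exact: gM.
apply: (measurableT_comp mg); exact: (measurable_cons (measurable_cst x) (@measurable_id _ _ setT)).
Qed.

Variable n : nat.
Implicit Types (k l : 'I_n -> int).

Lemma measC_monom k : measC (@monom R n k).
Proof.
have mp : measurable_fun [set: n.-tuple R]
    (fun t => 2 * pi * \sum_(i < n) (k i)%:~R * tnth t i).
  apply: measurable_funM => //; apply: measurable_sum => i.
  by apply: measurable_funM => //; exact: measurable_tnth.
split=> /=.
- apply: measurableT_comp => //; apply: continuous_measurable_fun; exact: continuous_cos.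
- apply: measurableT_comp => //; apply: continuous_measurable_fun; exact: continuous_sin.
Qed.

Lemma cmod_monom k t : cmod (@monom R n k t) = 1.
Proof. exact: cmod_expi. Qed.

Lemma bdd_monom k : bdd 1 (@monom R n k).
Proof. by apply: bdd_everywhere => [|t]; [exact: measC_monom|rewrite cmod_monom]. Qed.

Lemma inL2_monom k : inL2 (@monom R n k).
Proof. exact: (bdd_inL2 ler01 (bdd_monom k)). Qed.

Lemma monomD k l t : @monom R n (fun i => k i + l i) t = monom k t * monom l t.
Proof.
rewrite /monom -expiD -mulrDr -big_split/=; congr (expi (_ * _)).
by apply: eq_bigr => i _; rewrite intrD mulrDl.
Qed.

Lemma monomN k t : @monom R n (fun i => - k i) t = conjc (monom k t).
Proof.
rewrite /monom -expiN -mulrN -sumrN; congr (expi (_ * _)).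
by apply: eq_bigr => i _; rewrite mulrNz mulNr.
Qed.

Lemma monomB k l t : @monom R n (fun i => k i - l i) t = monom k t * conjc (monom l t).
Proof. by rewrite -monomN -monomD. Qed.

Lemma monom0 k t : (forall i, k i = 0) -> @monom R n k t = 1.
Proof.
by move=> k0; rewrite /monom big1 ?mulr0 ?expi0// => i _; rewrite k0 mul0r.
Qed.

End Monomials.

Lemma cint_monom_eq0 (R : realType) n (k : 'I_n -> int) : (forall i, k i = 0) ->
  cint (@monom R n k) = 1.
Proof.
move=> k0; have -> : @monom R n k = @fconst R n 1 by apply/funext => t; exact: monom0.
have := inner_self (inL2_cst 1 : inL2 (@fconst R n 1)).
rewrite /inner (_ : (fun t => _) = @fconst R n 1); last first.
  by apply/funext => t; rewrite /fconst conjc1 mulr1.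
move=> ->; rewrite sqr_L2norm; last exact: inL2_cst.
under eq_Rintegral do rewrite /fconst cmod1 expr1n.
by rewrite Rintegral_cst//= mul1r probability_setT.
Qed.

Lemma monom_tcons (R : realType) n (k : 'I_n.+1 -> int) (x : R) (t : n.-tuple R) :
  monom k (tcons (x, t)) =
  expi (2 * pi * (k ord0)%:~R * x) * monom (fun i => k (lift ord0 i)) t.
Proof.
rewrite /monom big_ord_recl mulrDr expiD mulrA tnth0; congr (_ * expi (_ * _)).
by apply: eq_bigr => i _; rewrite tnthS.
Qed.

(** Fubini splits off the first coordinate. Either the other exponents are not all zero and the
    inner integral vanishes by induction, or the inner integral is 1 and the first exponent is
    nonzero. *)
Lemma cint_monom_neq0 (R : realType) n (k : 'I_n -> int) : (exists i, k i != 0) ->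
  cint (@monom R n k) = 0.
Proof.
elim: n k => [k [[]]//|n IH k kN0].
pose k' i := k (lift ord0 i).
have ci m (l : 'I_m -> int) : cintegrable (@monom R m l).
  exact: cintegrable_L2 (inL2_monom l).
have [m1 m2] := @measC_monom R _ k.
have inner_int x : cint (fun t => monom k (tcons (x, t))) =
    expi (2 * pi * (k ord0)%:~R * x) * cint (@monom R n k').
  by rewrite -cintZ//; congr cint; apply/funext => t; rewrite monom_tcons.
have ci' x : cintegrable (fun t => monom k (@tcons R n (x, t))).
  by under eq_fun do rewrite monom_tcons; exact: cintegrableZ.
rewrite cintE// !(@Rintegral_tcons _ _ _ 1)//; last 2 first.
- by move=> t; rewrite (le_trans (le_Im_cmod _))// cmod_monom.
- by move=> t; rewrite (le_trans (le_Re_cmod _))// cmod_monom.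
have RE x : Rintegral (@torus_measure R n) setT (fun t => complex.Re (monom k (tcons (x, t))))
    = complex.Re (expi (2 * pi * (k ord0)%:~R * x) * cint (@monom R n k')).
  by rewrite -inner_int cintE.
have IE x : Rintegral (@torus_measure R n) setT (fun t => complex.Im (monom k (tcons (x, t))))
    = complex.Im (expi (2 * pi * (k ord0)%:~R * x) * cint (@monom R n k')).
  by rewrite -inner_int cintE.
under eq_Rintegral do rewrite RE.
under [X in (_ +i* X)%C]eq_Rintegral do rewrite IE.
have [k'N0|k'0] := pselect (exists i, k' i != 0).
  rewrite IH//; under eq_Rintegral do rewrite mulr0/=.
  under [X in (_ +i* X)%C]eq_Rintegral do rewrite mulr0/=.
  by rewrite !Rintegral_cst//= mul0r.
have k'0' i : k' i = 0 by apply: contrapT => /eqP ki; apply: k'0; exists i.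
have k0 : k ord0 != 0.
  case: kN0 => i; case: (unliftP ord0 i) => [j ->|->]//.
  by rewrite -/(k' j) k'0' eqxx.
rewrite cint_monom_eq0//; under eq_Rintegral do rewrite mulr1/=.
under [X in (_ +i* X)%C]eq_Rintegral do rewrite mulr1/=.
by have [-> ->] := @integral_expi_int R _ k0.
Qed.

Lemma inner_monom (R : realType) n (k l : 'I_n -> int) :
  inner (@monom R n k) (monom l) = ((k == l)%:R).
Proof.
rewrite /inner (_ : (fun t => _) = @monom R n (fun i => k i - l i)); last first.
  by apply/funext => t; rewrite monomB.
case: eqVneq => [->|kl].
  by apply: cint_monom_eq0 => i; rewrite subrr.
apply: cint_monom_neq0; apply: contrapT => h; case/eqP: kl; apply/funext => i.
by apply: contrapT => /eqP kli; apply: h; exists i; rewrite subr_eq0.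
Qed.

(** * The open cube has full measure *)

Section OpenCube.
Context {R : realType}.

Lemma mu01_open : @mu01 R (~` `]0%R, 1%R[) = 0%E.
Proof.
suff h : @mu01 R `]0%R, 1%R[ = 1%E by rewrite probability_setC// h subee.
rewrite [LHS]integral_uniform_pdf setIidl; last first.
  by apply: subset_itvW.
rewrite (eq_integral (fun=> 1%E)); last first.
  by move=> x; rewrite inE/= in_itv/= /uniform_pdf => /andP[/ltW-> /ltW->]; rewrite subr0 invr1.
by rewrite integral_cst//= lebesgue_measure_itv/= lte_fin ltr01 mul1e sube0.
Qed.

(** Tuples range over all of R^n, while monomials have period 1 in each coordinate; they can
    recognize a half-space only inside the open cube. *)
Lemma ae_open_cube n (i : 'I_n) :
  {ae @torus_measure R n, forall t, 0 < tnth t i < 1}.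
Proof.
have mI : measurable (~` `]0%R, 1%R[ : set (measurableTypeR R)) by apply: measurableC.
elim: n i => [[]//|n IH i].
pose A : set (n.+1.-tuple R) := (fun t => tnth t i) @^-1` (~` `]0%R, 1%R[).
have mA : measurable A by rewrite -[A]setTI; exact: measurable_tnth.
exists A; split; [exact: mA| |by move=> t /=; rewrite /A/= in_itv/=].
rewrite /= /distribution /pushforward.
case: (unliftP ord0 i) => [j ij|i0].
- have [B [mB B0 BS]] := IH j.
  pose C := ([set: measurableTypeR R] `*` B).
  apply/eqP; rewrite -measure_le0.
  apply: (@le_trans _ _ ((mu01 \x torus_measure n)%E C)).
    apply: le_measure; rewrite ?inE.
    + by rewrite -[X in measurable X]setTI; exact: measurable_tcons.
    + exact: measurableX.
    + move=> [x t]; rewrite /A/= ij tnthS => h; split=> //; apply: BS => /=.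
      by rewrite in_itv/= in h.
  by rewrite /C product_measure1E// [X in (_ * X)%E]B0 mule0.
- apply/eqP; rewrite -measure_le0.
  apply: (@le_trans _ _ ((mu01 \x torus_measure n)%E (~` `]0%R, 1%R[ `*` setT))).
    apply: le_measure; rewrite ?inE.
    + by rewrite -[X in measurable X]setTI; exact: measurable_tcons.
    + exact: measurableX.
    + by move=> [x t]; rewrite /A/= i0 tnth0.
  by rewrite product_measure1E//= [X in (X * _)%E]mu01_open mul0e.
Qed.

End OpenCube.

(** * Completeness of the monomials *)

Section TrigComplete.
Context {R : realType} {n : nat}.
Local Notation mu := (@torus_measure R n).
Implicit Types (f g h : @tfun R n) (u v : n.-tuple R -> R).

Definition null_fourier f := inL2 f /\ forall k, fourier f k = 0.

Lemma null_fourierD f g : null_fourier f -> null_fourier g -> null_fourier (fadd f g).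
Proof.
move=> [fL f0] [gL g0]; split=> [|k]; first exact: inL2D.
by rewrite /fourier innerDl// -/(fourier f k) -/(fourier g k) ?f0 ?g0 ?addr0//; exact: inL2_monom.
Qed.

Lemma null_fourierZ c f : null_fourier f -> null_fourier (fscale c f).
Proof.
move=> [fL f0]; split=> [|k]; first exact: inL2Z.
by rewrite /fourier innerZl// -/(fourier f k) ?f0 ?mulr0//; exact: inL2_monom.
Qed.

Lemma null_fourier_monom l f : null_fourier f -> null_fourier (fmul (monom l) f).
Proof.
move=> [fL f0]; split=> [|k]; first by have [] := bdd_mul ler01 (bdd_monom l) fL.
rewrite -(f0 (fun i => k i - l i)) /fourier /inner; congr cint; apply/funext => t.
by rewrite /fmul monomB conjcM conjcK; ring.
Qed.

(** Multiplications that preserve the orthogonal complement of the monomials. They form an algebra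
    containing the shifted sines and closed under bounded limits, so indicators are reached by
    explicit approximation. *)
Definition multiplier u := [/\ measurable_fun [set: n.-tuple R] u,
  exists M : R, forall t, `|u t| <= M &
  forall f, null_fourier f -> null_fourier (fun t => ((u t)%:C)%C * f t)].

Lemma multiplier_cst (c : R) : multiplier (fun=> c).
Proof.
split=> //; first by exists `|c|.
by move=> f f0; exact: (null_fourierZ _ f0).
Qed.

Lemma multiplierD u v : multiplier u -> multiplier v -> multiplier (fun t => u t + v t).
Proof.
move=> [mu_ [M uM] u0] [mv [N vN] v0]; split; first exact: measurable_funD.
  by exists (M + N) => t; rewrite (le_trans (ler_normD _ _))// lerD.
move=> f f0; have := null_fourierD (u0 _ f0) (v0 _ f0); congr null_fourier.
by apply/funext => t; rewrite /fadd rmorphD/= mulrDl.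
Qed.

Lemma multiplierM u v : multiplier u -> multiplier v -> multiplier (fun t => u t * v t).
Proof.
move=> [mu_ [M uM] u0] [mv [N vN] v0]; split; first exact: measurable_funM.
  by exists (M * N) => t; rewrite normrM ler_pM.
move=> f f0; have := u0 _ (v0 _ f0); congr null_fourier.
by apply/funext => t; rewrite rmorphM/= mulrA.
Qed.

Lemma multiplierZ (c : R) u : multiplier u -> multiplier (fun t => c * u t).
Proof. by move=> mu_; apply: multiplierM => //; exact: multiplier_cst. Qed.

Lemma multiplierN u : multiplier u -> multiplier (fun t => - u t).
Proof. by move=> /(multiplierZ (-1)); under eq_fun do rewrite mulN1r. Qed.

Lemma multiplierB u v : multiplier u -> multiplier v -> multiplier (fun t => u t - v t).
Proof. by move=> ? ?; apply: multiplierD => //; exact: multiplierN. Qed.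

Lemma multiplierX u k : multiplier u -> multiplier (fun t => u t ^+ k).
Proof.
move=> mu_; elim: k => [|k IH]; first exact: (multiplier_cst 1).
by under eq_fun do rewrite exprS; exact: multiplierM.
Qed.

(** [u_ N f] tends to [u f] in L^2 by dominated convergence with bound [4 |f|^2], and Fourier
    coefficients are continuous on L^2. *)
Lemma multiplier_lim (u_ : nat -> n.-tuple R -> R) u :
  (forall N, multiplier (u_ N)) -> (forall N t, `|u_ N t| <= 1) ->
  {ae mu, forall t, u_ ^~ t @ \oo --> u t} -> measurable_fun [set: n.-tuple R] u ->
  (forall t, `|u t| <= 1) -> multiplier u.
Proof.
move=> mu_ u1 ul mu0 uu1; split=> //; first by exists 1.
move=> f f0; have fL := f0.1; have fi := integrable_sqr_cmod fL.
pose uf : tfun n := fun t => ((u t)%:C)%C * f t.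
have bu v : measurable_fun [set: n.-tuple R] v -> (forall t, `|v t| <= 1) ->
    bdd 1 (fun t => ((v t)%:C)%C).
  by move=> mv v1; apply: bdd_everywhere => [|t]; [exact: measC_R|rewrite cmodR].
have ufL : inL2 uf by have [] := bdd_mul ler01 (bu u mu0 uu1) fL.
pose d N : tfun n := fun t => ((u_ N t - u t)%:C)%C * f t.
have mN N : measurable_fun [set: n.-tuple R] (u_ N) by case: (mu_ N).
have d_eq N : d N = fsub (fun t => ((u_ N t)%:C)%C * f t) uf.
  by apply/funext => t; rewrite /d /fsub /uf rmorphB/= mulrBl.
have uNL N : inL2 (fun t => ((u_ N t)%:C)%C * f t).
  by have [] := bdd_mul ler01 (bu _ (mN N) (u1 N)) fL.
have dL N : inL2 (d N) by rewrite d_eq; exact: inL2B.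
have cvg0 : (fun N => L2norm (d N) ^+ 2) @ \oo --> (0 : R).
  have [|||||] := @dominated_convergence _ _ _ mu setT measurableT
    (fun N t => (cmod (d N t) ^+ 2)%:E) (fun=> 0%E) (fun t => (4 * cmod (f t) ^+ 2)%:E).
  - move=> N; apply/measurable_EFinP; apply: measurable_funX; apply: measurable_cmod.
    exact: inL2_meas.
  - exact: measurable_cst.
  - apply: filterS ul => t ul _.
    have c : (fun N => (u_ N t - u t) * (u_ N t - u t) * cmod (f t) ^+ 2) @ \oo -->
        (u t - u t) * (u t - u t) * cmod (f t) ^+ 2.
      by apply: cvgM; [apply: cvgM; apply: cvgB => //|]; exact: cvg_cst.
    rewrite subrr !mul0r in c.
    apply: cvg_EFin; first exact: nearW.
    rewrite (_ : _ \o _ = (fun N => (u_ N t - u t) * (u_ N t - u t) * cmod (f t) ^+ 2))//.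
    by apply/funext => N /=; rewrite cmodM cmodR exprMn real_normK ?num_real// expr2.
  - exact: integrable_RZ.
  - apply: aeW => t N _; rewrite abse_EFin lee_fin ger0_norm ?sqr_ge0//.
    rewrite cmodM cmodR exprMn ler_wpM2r ?sqr_ge0//.
    rewrite (_ : 4 = 2 ^+ 2); last by ring.
    rewrite ler_pXn2r ?nnegrE//.
    by rewrite (le_trans (ler_normB _ _))// (le_trans (lerD (u1 N t) (uu1 t))).
  move=> _ _; rewrite integral0 => /fine_cvg h.
  rewrite (_ : (fun N => _) = fine \o [sequence (\int[mu]_t (cmod (d N t) ^+ 2)%:E)%E]_N)//.
  by apply/funext => N; rewrite sqr_L2norm.
split=> // k; apply/eqP; rewrite -cmod_eq0 -sqrf_eq0 eq_le sqr_ge0 andbT.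
have kL := @inL2_monom R n k.
have le N : cmod (fourier uf k) ^+ 2 <= L2norm (d N) ^+ 2.
  have [_ /(_ k) h] := (let: And3 _ _ h := mu_ N in h) f f0.
  have -> : cmod (fourier uf k) = cmod (inner (d N) (monom k)).
    by rewrite d_eq innerBl// -/(fourier _ k) h sub0r cmodN.
  apply: lerXn2r; rewrite ?nnegrE ?cmod_ge0 ?L2norm_ge0//.
  apply: (le_trans (cauchy_schwarz (dL N) kL)).
  suff -> : L2norm (@monom R n k) = 1 by rewrite mulr1.
  apply/eqP; rewrite -(eqrXn2 (ltn0Sn 1)) ?L2norm_ge0// expr1n.
  by rewrite -(inj_eq (@complexI _)) -inner_self// inner_monom eqxx.
by rewrite -(cvg_lim _ cvg0)//; apply: limr_ge; [exact: cvgP cvg0|exact: nearW].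
Qed.

Lemma multiplier_norm u : multiplier u -> (forall t, `|u t| <= 1) ->
  multiplier (fun t => `|u t|).
Proof.
move=> mu_ u1.
(* the iteration p <- p + (u^2 - p^2)/2 increases to |u| *)
pose p := fix p k t := if k is k'.+1 then p k' t + (u t ^+ 2 - p k' t ^+ 2) / 2 else 0.
have mp k : multiplier (p k).
  elim: k => [|k IH]; first exact: multiplier_cst.
  apply: multiplierD => //=; under eq_fun do rewrite mulrC.
  by apply: multiplierZ; apply: multiplierB; exact: multiplierX.
have pb k t : 0 <= p k t <= `|u t|.
  elim: k => [|k /andP[IH1 IH2]]/=; first by rewrite lexx normr_ge0.
  have := u1 t; have <- : `|u t| ^+ 2 = u t ^+ 2 by rewrite real_normK ?num_real.
  by move: IH1 IH2; set a := `|u t|; set q := p k t => q0 qa a1; apply/andP; split; nra.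
(* With [a = |u t|] and [q = p k t] the new error is [(a - q) (1 - (a + q) / 2)], so a step shrinks
   it at least by the factor [1 - a / 2]. *)
have pe k t : `|u t| - p k t <= `|u t| * (1 - `|u t| / 2) ^+ k.
  elim: k => [|k IH]/=; first by rewrite expr0 mulr1 subr0.
  have := u1 t; have <- : `|u t| ^+ 2 = u t ^+ 2 by rewrite real_normK ?num_real.
  rewrite [(1 - _) ^+ k.+1]exprSr mulrA.
  have /andP[] := pb k t; move: IH; set a := `|u t|; set q := p k t; set r := a * _ ^+ k.
  move=> h q0 qa a1.
  apply: (@le_trans _ _ ((a - q) * (1 - a / 2))); first by nra.
  by apply: ler_wpM2r => //; lra.
apply: (@multiplier_lim p) => //.
- by move=> N t; have /andP[h1 h2] := pb N t; rewrite ger0_norm// (le_trans h2).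
- apply: aeW => t; have [u0|u0] := eqVneq (u t) 0.
    have p0 k : p k t = 0 by apply/eqP; have := pb k t; rewrite u0 normr0 => /andP[? ?]; rewrite eq_le; apply/andP.
    by under eq_fun do rewrite p0; rewrite u0 normr0; exact: cvg_cst.
  have nu : 0 < `|u t| by rewrite normr_gt0.
  have c0 : (fun k => `|u t| - `|u t| * (1 - `|u t| / 2) ^+ k) @ \oo --> `|u t|.
    rewrite -[X in _ --> X](subr0 `|u t|) -[X in _ --> _ - X](mulr0 `|u t|).
    apply: cvgB; first exact: cvg_cst.
    apply: cvgM; first exact: cvg_cst.
    apply: cvg_expr; have := u1 t => ut.
    by rewrite ger0_norm; lra.
  have c1 : (fun _ : nat => `|u t|) @ \oo --> `|u t| by exact: cvg_cst.
  apply: (squeeze_cvgr _ c0 c1); apply: nearW => k.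
  by have := pe k t; have /andP[_ ->] := pb k t; lra.
- by apply: measurableT_comp => //; case: mu_.
- by move=> t; rewrite normr_id.
Qed.

Definition mset (A : set (n.-tuple R)) := multiplier (\1_A).

(** With [v] the positive part of [u], the powers of [1 - v] tend to 0 where [u] is positive and
    stay 1 elsewhere. *)
Lemma multiplier_gt0 u : multiplier u -> (forall t, `|u t| <= 1) ->
  mset [set t | 0 < u t].
Proof.
move=> mu_ u1; have mn := multiplier_norm mu_ u1.
have mA : measurable [set t | 0 < u t].
  have [h _ _] := mu_; rewrite -[X in measurable X]setTI.
  have -> : [set t | 0 < u t] = u @^-1` `]0, +oo[.
    by apply/seteqP; split=> t /=; rewrite in_itv/= andbT.
  exact: h.
pose v t := 2^-1 * (u t + `|u t|).
have mv : multiplier v by apply: multiplierZ; exact: multiplierD.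
have vE t : v t = if 0 < u t then u t else 0.
  by rewrite /v; case: (ltP 0 (u t)) => h; [rewrite gtr0_norm//; lra|rewrite ler0_norm//; lra].
have v01 t : 0 <= v t <= 1.
  by rewrite vE; case: ifP => h; rewrite ?lexx ?ler01// ltW//= (le_trans (ler_norm _)).
apply: (@multiplier_lim (fun N t => 1 - (1 - v t) ^+ N)).
- move=> N; apply: multiplierB; first exact: multiplier_cst.
  by apply: multiplierX; apply: multiplierB => //; exact: multiplier_cst.
- move=> N t; have /andP[v0 v1] := v01 t.
  have : 0 <= (1 - v t) ^+ N <= 1 by rewrite exprn_ge0 ?exprn_ile1//; lra.
  by move=> /andP[? ?]; rewrite ger0_norm; lra.
- apply: aeW => t; rewrite indicE.
  have /andP[v0 v1] := v01 t.
  have [ut|ut] := ltP 0 (u t).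
    rewrite mem_set//= -[X in _ --> X]subr0; apply: cvgB; first exact: cvg_cst.
    apply: cvg_expr; move: v0 v1; rewrite vE ut => *.
    by rewrite ger0_norm; lra.
  rewrite memNset/=; last by rewrite ltNge ut.
  under eq_fun do rewrite vE ltNge ut/= subr0 expr1n subrr.
  exact: cvg_cst.
- exact: measurable_indic.
- by move=> t; rewrite indicE; case: (_ \in _); rewrite ?normr1 ?normr0.
Qed.

Lemma mset_measurable A : mset A -> measurable A.
Proof. by case=> /measurable_indicP. Qed.

Lemma normr_indic_le1 (A : set (n.-tuple R)) t : `|\1_A t : R| <= 1.
Proof. by rewrite indicE; case: (_ \in _); rewrite ?normr1 ?normr0. Qed.

Lemma msetC A : mset A -> mset (~` A).
Proof.
move=> mA; rewrite /mset indicC.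
rewrite (_ : (fun _ => _) = fun t => 1 - \1_A t); last first.
  by apply/funext => t; rewrite indicE; case: (_ \in _); rewrite /= ?subrr ?subr0.
by apply: multiplierB => //; exact: multiplier_cst.
Qed.

Lemma msetI A B : mset A -> mset B -> mset (A `&` B).
Proof. by move=> mA mB; rewrite /mset indicI; exact: multiplierM. Qed.

Lemma mset0 : mset set0.
Proof. by rewrite /mset indic0; exact: multiplier_cst. Qed.

Lemma msetT : mset setT.
Proof. by rewrite -setC0; apply: msetC; exact: mset0. Qed.

Lemma mset_bigcup (F : nat -> set (n.-tuple R)) : (forall k, mset (F k)) -> mset (\bigcup_k F k).
Proof.
move=> mF.
have mcap N : mset (\bigcap_(k < N) ~` F k).
  elim: N => [|N IH]; first by rewrite bigcap_mkord big_ord0; exact: msetT.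
  have -> : \bigcap_(k < N.+1) ~` F k = (\bigcap_(k < N) ~` F k) `&` ~` F N.
    by rewrite !bigcap_mkord big_ord_recr.
  by apply: msetI => //; exact: msetC.
rewrite -[X in mset X]setCK setC_bigcup; apply: msetC.
apply: (@multiplier_lim (fun N => \1_(\bigcap_(k < N) ~` F k))).
- exact: mcap.
- by move=> N t; exact: normr_indic_le1.
- apply: aeW => t; rewrite !indicE.
  have [h|h] := pselect ((\bigcap_i ~` F i) t).
    rewrite (mem_set h); apply: cvg_near_cst; apply: nearW => N.
    by rewrite indicE mem_set// => k _; exact: h.
  rewrite (memNset h); apply: cvg_near_cst.
  have [k Fk] : exists k, F k t.
    by apply: contrapT => nF; apply: h => k _ Fk; apply: nF; exists k.
  exists k.+1 => // N /= kN; rewrite indicE memNset//= => /(_ k kN); exact.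
- apply: measurable_indic; apply: bigcapT_measurable => k.
  by apply: measurableC; exact: mset_measurable.
- by move=> t; exact: normr_indic_le1.
Qed.

Lemma mset_ae A B : mset A -> measurable B -> {ae mu, forall t, A t <-> B t} -> mset B.
Proof.
move=> mA mB AB; apply: (@multiplier_lim (fun=> \1_A)) => //.
- by move=> N t; exact: normr_indic_le1.
- apply: filterS AB => t AB; rewrite !indicE.
  rewrite (_ : (t \in A) = (t \in B)); first exact: cvg_cst.
  by apply/idP/idP; rewrite !inE => /AB.
- by move=> t; exact: normr_indic_le1.
Qed.

Lemma multiplier_trig (i : 'I_n) (b : R) :
  multiplier (fun t => sin (2 * pi * (tnth t i - b))).
Proof.
pose e : 'I_n -> int := fun j => (j == i)%:Z.
have eE t : monom e t = expi (2 * pi * tnth t i).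
  rewrite /monom (bigD1 i)//= /e eqxx mul1r big1 ?addr0// => j /negPf ->.
  by rewrite mul0r.
pose w : R[i] := expi (2 * pi * b).
have mm : measurable_fun [set: n.-tuple R] (fun t => sin (2 * pi * (tnth t i - b))).
  apply: measurableT_comp; first by apply: continuous_measurable_fun; exact: continuous_sin.
  apply: measurable_funM => //; apply: measurable_funB => //; exact: measurable_tnth.
split=> //; first by exists 1 => t; exact: sin_max.
move=> f f0.
have h1 := null_fourierZ (conjc w) (null_fourier_monom e f0).
have h2 := null_fourierZ w (null_fourier_monom (fun j => - e j) f0).
(* Euler's formula: the scalar is [1 / (2 i)], and [h1] and [h2] carry the two exponentials. *)
have := null_fourierZ ((0 -i* 2^-1)%C) (null_fourierD h1 (null_fourierZ (-1) h2)).
congr null_fourier; apply/funext => t.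
rewrite /fscale /fadd /fmul monomN !eE mulrBr sinB.
rewrite /w !mulrA -mulrDl mulrA; congr (_ * _).
by apply: complex_ext; rewrite /expi /conjc !(cReM, cImM, cReD, cImD, cReN, cImN)/= ?(cReN, cImN)/=; field.
Qed.

Lemma sin_le0_pi2pi (x : R) : pi <= x <= pi *+ 2 -> sin x <= 0.
Proof.
move=> /andP[h1 h2]; rewrite -[x](subrK pi) sinDpi oppr_le0 sin_ge0_pi//.
by move: h2; rewrite mulr2n subr_ge0 h1 lerBlDr.
Qed.

Lemma sin_leN0 (x : R) : - pi <= x <= 0 -> sin x <= 0.
Proof.
by move=> /andP[h1 h2]; rewrite -[x]opprK sinN oppr_le0 sin_ge0_pi// oppr_ge0 h2 lerNl.
Qed.

(** On the circle [0 < sin (2 pi (x - c))] describes the open arc from [c] to [c + 1/2]. Within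
    (0,1) the set [b < x] is, for [0 < b < 1/2], the complement of the part of (0,1/2) outside the
    arc at [b], and for [1/2 <= b < 1] the intersection of that arc with (1/2,1). *)
Lemma mset_halfspace (i : 'I_n) (b : R) : mset [set t | b < tnth t i].
Proof.
have mB : measurable [set t : n.-tuple R | b < tnth t i].
  rewrite -[X in measurable X]setTI.
  have -> : [set t : n.-tuple R | b < tnth t i] = (fun t => tnth t i) @^-1` `]b, +oo[.
    by apply/seteqP; split=> t /=; rewrite in_itv/= andbT.
  by apply: measurable_tnth.
have p0 := @pi_gt0 R.
have gt0 c : mset [set t | 0 < sin (2 * pi * (tnth t i - c))].
  by apply: multiplier_gt0 => [|t]; [exact: multiplier_trig|exact: sin_max].
have lt0 c : mset [set t | 0 < - sin (2 * pi * (tnth t i - c))].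
  apply: multiplier_gt0 => [|t]; first by apply: multiplierN; exact: multiplier_trig.
  by rewrite normrN; exact: sin_max.
have aec := @ae_open_cube R n i.
have [b0|b0] := leP b 0.
  apply: (mset_ae msetT) => //; apply: filterS aec => t /andP[t0 t1]; split=> //= _.
  exact: le_lt_trans b0 t0.
have [b1|b1] := leP 1 b.
  apply: (mset_ae mset0) => //; apply: filterS aec => t /andP[t0 t1]; split=> //=.
  by rewrite ltNge (le_trans (ltW t1)).
have [b2|b2] := ltP b 2^-1.
  apply: (@mset_ae (~` ([set t | 0 < sin (2 * pi * (tnth t i - 0))] `&`
                       ~` [set t | 0 < sin (2 * pi * (tnth t i - b))]))) => //.
    by apply: msetC; apply: msetI => //; exact: msetC.
  apply: filterS aec => t /andP[]; rewrite /= subr0; set x := tnth t i => x0 x1.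
  split=> [h|bx [h1 h2]].
    rewrite ltNge; apply/negP => xb; apply: h; split.
      by apply: sin_gt0_pi; apply/andP; split; nra.
    by apply/negP; rewrite -leNgt; apply: sin_leN0; apply/andP; split; nra.
  have [x2|x2] := ltP x 2^-1.
    by apply: h2; apply: sin_gt0_pi; apply/andP; split; nra.
  by move: h1; rewrite ltNge sin_le0_pi2pi// mulr2n; apply/andP; split; nra.
apply: (@mset_ae ([set t | 0 < - sin (2 * pi * (tnth t i - 0))] `&`
                  [set t | 0 < sin (2 * pi * (tnth t i - b))])) => //.
  exact: msetI.
apply: filterS aec => t /andP[]; rewrite /= subr0; set x := tnth t i => x0 x1.
split=> [[h1 h2]|bx].
  rewrite ltNge; apply/negP => xb.
  have [x2|x2] := leP x 2^-1.
    move: h1; rewrite oppr_gt0 ltNge sin_ge0_pi//; apply/andP; split; nra.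
  by move: h2; rewrite ltNge sin_leN0//; apply/andP; split; nra.
split; last by apply: sin_gt0_pi; apply/andP; split; nra.
rewrite -(subrK pi (2 * pi * x)) sinDpi opprK; apply: sin_gt0_pi; apply/andP; split; nra.
Qed.

Lemma mset_all A : measurable A -> mset A.
Proof.
(* Measurability is membership in every sigma-algebra containing the coordinate preimages; it is
   applied to the one formed by [mset]. *)
move=> mA; apply: mA; split; first split.
- exact: mset0.
- by move=> B mB; rewrite setTD; exact: msetC.
- exact: mset_bigcup.
- rewrite -bigcup_seq/= => B [i _ [C mC <-]]; rewrite setTI.
  have : (@RGenOInfty.G R).-sigma.-measurable C.
    by rewrite -RGenOInfty.measurableE; exact: mC.
  move=> /(_ (fun D => mset ((fun t => tnth t i) @^-1` D))); apply; split; first split.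
  + by rewrite preimage_set0; exact: mset0.
  + by move=> D mD; rewrite setTD preimage_setC; exact: msetC.
  + by move=> F mF; rewrite preimage_bigcup; exact: mset_bigcup.
  + move=> _ [b ->]; have := mset_halfspace i b; congr mset.
    by apply/seteqP; split=> t /=; rewrite in_itv/= andbT.
Qed.

(** Multiplying by the indicator of [Re f > 0] keeps all coefficients zero, and the real part of the
    coefficient at 0 is then the integral of the positive part of [Re f]. *)
Lemma null_fourier_Re_le0 f : null_fourier f -> {ae mu, forall t, complex.Re (f t) <= 0}.
Proof.
move=> f0; have [fL _] := f0; have [m1 m2] := inL2_meas fL.
pose A := [set t | 0 < complex.Re (f t)].
have mA : measurable A.
  rewrite -[A]setTI.
  have -> : A = (fun t => complex.Re (f t)) @^-1` `]0, +oo[.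
    by apply/seteqP; split=> t /=; rewrite in_itv/= andbT.
  exact: m1.
have [_ _ /(_ _ f0)[gL /(_ (fun=> 0))]] := mset_all mA.
rewrite /fourier /inner.
have -> : (fun t => (\1_A t)%:C%C * f t * conjc (@monom R n (fun=> 0) t)) =
          (fun t => (\1_A t)%:C%C * f t).
  by apply/funext => t; rewrite monom0// conjc1 mulr1.
have gi := cintegrable_L2 gL; have [gi1 _] := gi.
rewrite cintE// => -[h _].
pose r t := complex.Re ((\1_A t)%:C%C * f t).
have rE t : r t = if 0 < complex.Re (f t) then complex.Re (f t) else 0.
  rewrite /r cReM/= mul0r subr0 indicE; case: ifPn => ht.
    by rewrite mem_set//= mul1r.
  by rewrite memNset//= ?mul0r//; exact/negP.
have r0 t : 0 <= r t by rewrite rE; case: ifP => // /ltW.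
have : (\int[mu]_t `|(r t)%:E| = 0)%E.
  under eq_integral do rewrite abse_EFin ger0_norm//.
  rewrite -(fineK (integrable_fin_num measurableT gi1)); congr EFin; exact: h.
have mr : measurable_fun [set: n.-tuple R] (fun t => (r t)%:E).
  by case/integrableP: gi1.
move/(ae_eq_integral_abs mu measurableT mr); apply: filterS => t /(_ I)[].
by rewrite rE; case: ifPn => [+ e|]; [rewrite e ltxx|rewrite -leNgt].
Qed.

Lemma trig_complete f : null_fourier f -> L2norm f = 0.
Proof.
move=> f0.
have h1 := null_fourier_Re_le0 f0.
have h2 := null_fourier_Re_le0 (null_fourierZ (-1) f0).
have h3 := null_fourier_Re_le0 (null_fourierZ ('i)%C f0).
have h4 := null_fourier_Re_le0 (null_fourierZ (- 'i)%C f0).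
apply: (ae_eq0_L2norm (inL2_meas f0.1) _).2.
apply: filterS2 (filterI h1 h2) (filterI h3 h4) => t [a1 a2] [a3 a4].
move: a2 a3 a4; rewrite /fscale mulN1r mulNr !cReN !cReM/= mul0r mul1r sub0r => a2 a3 a4.
by apply: complex_ext => /=; lra.
Qed.

End TrigComplete.

(** * Closed subspaces, density of polynomials, and H^2 *)

Section ClosedSubspaces.
Context {R : realType} {n : nat}.
Implicit Types (f g h : @tfun R n) (k l : 'I_n -> int).

Definition cto0 (z : nat -> R[i]) :=
  forall e : R, 0 < e -> exists N0, forall N, (N0 <= N)%N -> cmod (z N) < e.

(** Uniform boundedness of the functionals makes the set closed; with [L2_monom_ind] this reduces
    weak convergence to monomials. *)
Lemma closed_subspace_to0 (ell : nat -> @tfun R n -> R[i]) (M : R) :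
  (forall N f g, inL2 f -> inL2 g -> ell N (fadd f g) = ell N f + ell N g) ->
  (forall N c f, inL2 f -> ell N (fscale c f) = c * ell N f) ->
  (forall N f, inL2 f -> cmod (ell N f) <= M * L2norm f) ->
  closed_subspace [set f | inL2 f /\ cto0 (ell ^~ f)].
Proof.
move=> eD eZ eM; split.
- by move=> f [].
- split=> [|e e0]; first exact: inL2_cst.
  exists 0%N => N _; rewrite (le_lt_trans (eM _ _ (inL2_cst 0)))//.
  by rewrite L2norm0 mulr0.
- move=> f g [fL f0] [gL g0]; split=> [|e e0]; first exact: inL2D.
  have [N1 h1] := f0 (e / 2) ltac:(lra); have [N2 h2] := g0 (e / 2) ltac:(lra).
  exists (maxn N1 N2) => N; rewrite geq_max => /andP[/h1 l1 /h2 l2].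
  by rewrite eD// (le_lt_trans (cmodD _ _))//; lra.
- move=> c f [fL f0]; split=> [|e e0]; first exact: inL2Z.
  have c0 := cmod_ge0 c.
  have [N1 h1] := f0 (e / (cmod c + 1)) ltac:(apply: divr_gt0 => //; lra).
  exists N1 => N /h1; rewrite eZ// cmodM ltr_pdivlMr; last by lra.
  by have := cmod_ge0 (ell N f); nra.
- move=> f fL fcl; split=> // e e0.
  have M1 : 0 < `|M| + 1 by have := normr_ge0 M; lra.
  have [g [[gL g0] fg]] := fcl (e / 2 / (`|M| + 1)) ltac:(apply: divr_gt0 => //; lra).
  have [N1 h1] := g0 (e / 2) ltac:(lra).
  exists N1 => N /h1 h.
  have -> : f = fadd (fsub f g) g by apply/funext => t; rewrite /fadd /fsub subrK.
  rewrite eD//; last exact: inL2B.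
  rewrite (le_lt_trans (cmodD _ _))//.
  have := eM N _ (inL2B fL gL); have := L2norm_ge0 (fsub f g).
  move: fg; rewrite ltr_pdivlMr// => fg d0.
  have : M * L2norm (fsub f g) <= `|M| * L2norm (fsub f g) by rewrite ler_wpM2r// ler_norm.
  by lra.
Qed.

Lemma closed_subspace_ker (ell : @tfun R n -> R[i]) (M : R) :
  (forall f g, inL2 f -> inL2 g -> ell (fadd f g) = ell f + ell g) ->
  (forall c f, inL2 f -> ell (fscale c f) = c * ell f) ->
  (forall f, inL2 f -> cmod (ell f) <= M * L2norm f) ->
  closed_subspace [set f | inL2 f /\ ell f = 0].
Proof.
move=> eD eZ eM.
have := @closed_subspace_to0 (fun=> ell) M (fun _ => eD) (fun _ => eZ) (fun _ => eM).
congr closed_subspace; apply/seteqP; split=> f [fL h]; split=> //.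
  apply/eqP; rewrite -cmod_eq0 eq_le cmod_ge0 andbT.
  by apply/ler_addgt0Pr => e /h[N /(_ N (leqnn N)) /ltW]; rewrite add0r.
by move=> e e0; exists 0%N => N _; rewrite h cmod0.
Qed.

Lemma closed_subspace_inner g : inL2 g -> closed_subspace [set f | inL2 f /\ inner f g = 0].
Proof.
move=> gL; apply: (@closed_subspace_ker _ (L2norm g)).
- by move=> *; rewrite innerDl.
- by move=> *; rewrite innerZl.
- by move=> f fL; rewrite mulrC cauchy_schwarz.
Qed.

Lemma closed_subspace_innerJ g : inL2 g ->
  closed_subspace [set f | inL2 f /\ inner g (fconj f) = 0].
Proof.
move=> gL; apply: (@closed_subspace_ker _ (L2norm g)).
- move=> f h fL hL; rewrite (_ : fconj _ = fadd (fconj f) (fconj h)).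
    by rewrite innerDr//; exact: inL2J.
  by apply/funext => t; rewrite /fconj /fadd conjcD.
- move=> c f fL; rewrite (_ : fconj _ = fscale (conjc c) (fconj f)).
    by rewrite innerZr ?conjcK//; exact: inL2J.
  by apply/funext => t; rewrite /fconj /fscale conjcM.
- by move=> f fL; rewrite -[L2norm f]L2norm_fconj cauchy_schwarz//; exact: inL2J.
Qed.

(** The conjunct [inL2 f] carries the statement when [I] is empty, as are the exponents with a
    negative entry for n = 0. *)
Lemma closed_subspace_bigcap (I : Type) (W : I -> set (@tfun R n)) :
  (forall i, closed_subspace (W i)) ->
  closed_subspace [set f | inL2 f /\ forall i, W i f].
Proof.
move=> cW; split.
- by move=> f [].
- by split=> [|i]; [exact: inL2_cst|case: (cW i)].
- move=> f g [fL fW] [gL gW]; split=> [|i]; first exact: inL2D.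
  by case: (cW i) => _ _ h _ _; exact: h.
- move=> c f [fL fW]; split=> [|i]; first exact: inL2Z.
  by case: (cW i) => _ _ _ h _; exact: h.
- move=> f fL h; split=> // i; case: (cW i) => _ _ _ _; apply=> //.
  by move=> e /h[g [[_ /(_ i)] ? ?]]; exists g.
Qed.

Lemma closed_subspaceI (V W : set (@tfun R n)) :
  closed_subspace V -> closed_subspace W -> closed_subspace (V `&` W).
Proof.
move=> cV cW.
have := @closed_subspace_bigcap bool (fun b => if b then V else W).
rewrite (_ : [set f | _] = V `&` W) => [|]; first by apply; case.
apply/seteqP; split=> f; first by move=> [_ h]; split; [exact: (h true)|exact: (h false)].
by move=> [Vf Wf]; split; [case: cV => + _ _ _ _; exact|case].
Qed.

Lemma closed_subspace_eq (W : set (@tfun R n)) f g : closed_subspace W ->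
  inL2 f -> W g -> L2norm (fsub f g) = 0 -> W f.
Proof.
move=> [_ _ _ _ cl] fL Wg fg; apply: cl => // e e0.
by exists g; split=> //; rewrite fg.
Qed.

(** Density of trigonometric polynomials as an induction principle: the residual of the projection
    onto [W] is orthogonal to every monomial, hence null. *)
Lemma L2_monom_ind (W : set (@tfun R n)) : closed_subspace W ->
  (forall k, W (monom k)) -> forall f, inL2 f -> W f.
Proof.
move=> cW Wm f fL; have [q [Wq qo]] := projection_exists cW fL.
have qL : inL2 q by case: cW => h _ _ _ _; exact: h.
apply: (closed_subspace_eq cW fL Wq); apply: trig_complete; split; first exact: inL2B.
by move=> k; exact: qo.
Qed.

Lemma closed_subspace_H2 : closed_subspace (@H2 R n).
Proof.
have h (k : {k : 'I_n -> int | exists i, k i < 0}) :=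
  closed_subspace_inner (@inL2_monom R n (sval k)).
have := closed_subspace_bigcap h; congr closed_subspace.
apply/seteqP; split=> f [fL fk]; split=> //.
  by move=> k kn; case: (fk (exist _ k kn)).
by move=> [k kn]; split=> //; exact: fk.
Qed.

Lemma H2_monom k : (forall i, 0 <= k i) -> H2 (@monom R n k).
Proof.
move=> k0; split; first exact: inL2_monom.
move=> l [i li]; rewrite /fourier inner_monom; case: eqP => // kl.
by move: li; rewrite -kl ltNge k0.
Qed.

Lemma H2_monom_ind (W : set (@tfun R n)) : closed_subspace W ->
  (forall k, (forall i, 0 <= k i) -> W (monom k)) -> forall f, H2 f -> W f.
Proof.
move=> cW Wm f fH; have [fL _] := fH.
(* Projecting onto the part of [W] inside H^2 keeps the residual in H^2, so its coefficients at the
   other exponents vanish as well. *)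
have cW' := closed_subspaceI cW closed_subspace_H2.
have [q [[Wq qH] qo]] := projection_exists cW' fL.
have qL : inL2 q by case: qH.
apply: (closed_subspace_eq cW fL Wq); apply: trig_complete; split; first exact: inL2B.
move=> k; have [k0|kn] := pselect (forall i, 0 <= k i).
  by apply: qo; split; [exact: Wm|exact: H2_monom].
have kn' : exists i, k i < 0.
  by apply: contrapT => h; apply: kn => i; rewrite leNgt; apply/negP => ki; apply: h; exists i.
rewrite /fourier innerBl//; last exact: inL2_monom.
rewrite -!/(fourier _ k).
by case: fH => _ /(_ k kn') ->; case: qH => _ /(_ k kn') ->; rewrite subr0.
Qed.

Lemma H2_inL2 f : H2 f -> inL2 f. Proof. by case. Qed.

(** By density [g] may be taken to be [z^k]. The pairing is then the coefficient of [f] at [-k],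
    which has a negative entry or is the zero exponent. *)
Lemma H2_0_orth_conjH2 f g : H2_0 f -> H2 g -> inner f (fconj g) = 0.
Proof.
move=> [[fL fn] f0] gH.
have [//|_ //] := @H2_monom_ind _ (closed_subspace_innerJ fL) _ g gH.
move=> k k0; split; first exact: inL2_monom.
rewrite (_ : fconj _ = monom (fun i => - k i)); last first.
  by apply/funext => t; rewrite monomN.
rewrite -/(fourier f _); have [kz|kn] := pselect (forall i, k i = 0).
  by rewrite -[RHS]f0; congr fourier; apply/funext => i; rewrite kz oppr0.
apply: fn; apply: contrapT => h; apply: kn => i.
apply: contrapT => /eqP ki; apply: h; exists i.
by rewrite oppr_lt0 lt_def ki k0.
Qed.

Lemma fourier_monom_mul k l f : fourier (fmul (monom l) f) k = fourier f (fun i => k i - l i).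
Proof.
rewrite /fourier /inner; congr cint; apply/funext => t.
by rewrite /fmul monomB conjcM conjcK; ring.
Qed.

Lemma inL2_monom_mul l f : inL2 f -> inL2 (fmul (monom l) f).
Proof. by move=> fL; have [] := bdd_mul ler01 (bdd_monom l) fL. Qed.

Lemma H2_monom_mul l f : (forall i, 0 <= l i) -> H2 f -> H2 (fmul (monom l) f).
Proof.
move=> l0 [fL fn]; split; first exact: inL2_monom_mul.
move=> k [i ki]; rewrite fourier_monom_mul; apply: fn; exists i.
by rewrite subr_lt0 (lt_le_trans ki).
Qed.

End ClosedSubspaces.

(** * Finite sums of functions *)

Section FiniteSums.
Context {R : realType} {n : nat} {I : Type}.
Implicit Types (F : I -> @tfun R n) (f : @tfun R n) (r : seq I).

Definition fsum r F : @tfun R n := fun t => \sum_(i <- r) F i t.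

Lemma fsum_nil F : fsum [::] F = @fconst R n 0.
Proof. by apply/funext => t; rewrite /fsum big_nil. Qed.

Lemma fsum_cons i r F : fsum (i :: r) F = fadd (F i) (fsum r F).
Proof. by apply/funext => t; rewrite /fsum big_cons. Qed.

Lemma inL2_fsum r F : (forall i, inL2 (F i)) -> inL2 (fsum r F).
Proof.
move=> FL; elim: r => [|i r IH]; first by rewrite fsum_nil; exact: inL2_cst.
by rewrite fsum_cons; exact: inL2D.
Qed.

Lemma inner_suml r F f : (forall i, inL2 (F i)) -> inL2 f ->
  inner (fsum r F) f = \sum_(i <- r) inner (F i) f.
Proof.
move=> FL fL; elim: r => [|i r IH].
  by rewrite fsum_nil big_nil L2norm_eq0_inner ?L2norm0//; exact: inL2_cst.
by rewrite fsum_cons big_cons innerDl// ?IH//; exact: inL2_fsum.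
Qed.

Lemma inner_sumr r F f : (forall i, inL2 (F i)) -> inL2 f ->
  inner f (fsum r F) = \sum_(i <- r) inner f (F i).
Proof.
move=> FL fL; rewrite (innerC (inL2_fsum r FL) fL) inner_suml//.
rewrite (big_morph _ (@conjcD _) (conjc0 _)); apply: eq_bigr => i _.
by rewrite -innerC.
Qed.

End FiniteSums.

(** * Multiplicities in the Fejer kernel *)

Section FejerCount.
Context {R : realType}.

(** The unnormalized one-dimensional Fejer weight, [N + 1 - |m|] cut off at 0. *)
Definition pair_count (N : nat) (m : int) : R :=
  \sum_(a < N.+1) \sum_(b < N.+1) ((a%:Z - b%:Z == m)%:R).

Lemma pair_countN N m : pair_count N (- m) = pair_count N m.
Proof.
rewrite /pair_count exchange_big/=; apply: eq_bigr => a _; apply: eq_bigr => b _.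
by rewrite -eqr_opp opprB opprK.
Qed.

Lemma pair_count_nat N (m : nat) : pair_count N m%:Z = (N.+1 - m)%:R.
Proof.
have count M : (\sum_(b < M) (b + m < N.+1) = minn M (N.+1 - m))%N.
  elim: M => [|M IH]; first by rewrite big_ord0 min0n.
  by rewrite big_ord_recr/= IH; lia.
rewrite /pair_count exchange_big/=.
have <- : minn N.+1 (N.+1 - m) = (N.+1 - m)%N by lia.
rewrite -count natr_sum; apply: eq_bigr => b _.
have [bm|bm] := ltnP (b + m) N.+1.
  rewrite (bigD1 (Ordinal bm))//= big1 ?addr0 => [|a].
    by rewrite PoszD addrAC subrr add0r eqxx.
  by move=> /eqP ha; case: eqP => // h; case: ha; apply: val_inj => /=; lia.
rewrite big1// => a _; case: eqP => // h; have := ltn_ord a; lia.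
Qed.

Lemma pair_count_cvg m : (fun N => pair_count N m / N.+1%:R) @ \oo --> (1 : R).
Proof.
wlog [k ->] : m / exists k : nat, m = k%:Z => [H|].
  case: m => k; first by apply: H; exists k.
  rewrite NegzE; under eq_fun do rewrite pair_countN.
  by apply: H; exists k.+1.
have c : (fun N => 1 - k%:R * N.+1%:R^-1) @ \oo --> (1 - k%:R * 0 : R).
  apply: cvgB; first exact: cvg_cst.
  by apply: cvgM; [exact: cvg_cst|exact: cvg_harmonic].
rewrite mulr0 subr0 in c.
apply: cvg_trans c; apply: near_eq_cvg.
exists k => // N /= kN; rewrite pair_count_nat natrB; last by lia.
by rewrite mulrBl divff.
Qed.

End FejerCount.

(** * Fejer means of bounded functions *)

Section Fejer.
Context {R : realType} {n : nat}.
Local Notation mu := (@torus_measure R n).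
Variable phi : @tfun R n.
Hypothesis phi1 : bdd 1 phi.
Implicit Types (f g q : @tfun R n) (k : 'I_n -> int).

Let J N := {ffun 'I_n -> 'I_N.+1}.
Let zof N (j : J N) : 'I_n -> int := fun i => (j i : nat)%:Z.
Let diff N (p : J N * J N) : 'I_n -> int := fun i => zof p.1 i - zof p.2 i.
Let cst N : R[i] := ((#|J N|%:R : R)^-1%:C)%C.

Let card_gt0 N : 0 < #|J N|%:R :> R.
Proof. by rewrite ltr0n card_ffun !card_ord expn_gt0. Qed.

(** Summing over pairs of exponents in a box, not over their differences, gives each coefficient its
    Fejer weight as a multiplicity and shows the kernel as a square modulus. *)
Definition fejer N : @tfun R n :=
  fscale (cst N) (fsum (index_enum _)
    (fun p : J N * J N => fscale (fourier phi (diff p)) (monom (diff p)))).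

Let phiL : inL2 phi. Proof. exact: bdd_inL2 ler01 phi1. Qed.

Let termL N (p : J N * J N) : inL2 (fscale (fourier phi (diff p)) (monom (diff p))).
Proof. by apply: inL2Z; exact: inL2_monom. Qed.

Lemma inL2_fejer N : inL2 (fejer N).
Proof. by apply: inL2Z; exact: inL2_fsum. Qed.

(* sum over j, l of z^(j-l)(t) conj(z^(j-l)(s)) is the square modulus of
   sum over j of conj(z^j(t)) z^j(s), so the kernel is nonnegative *)
Lemma cmod_fejer_le1 N t : cmod (fejer N t) <= 1.
Proof.
pose c (j : J N) := conjc (@monom R n (zof j) t).
pose E := fsum (index_enum _) (fun j : J N => fscale (c j) (monom (zof j))).
have cL j : inL2 (fscale (c j) (monom (zof j))) by apply: inL2Z; exact: inL2_monom.
have EL : inL2 E by exact: inL2_fsum.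
have Enorm : L2norm E ^+ 2 = #|J N|%:R.
  apply: complexI; rewrite -inner_self// /E inner_suml//.
  under eq_bigr => j _ do rewrite inner_sumr//.
  under eq_bigr => j _.
    rewrite (bigD1 j)//= big1 ?addr0.
      rewrite innerZl ?innerZr; [|exact: inL2_monom..|exact: inL2Z (inL2_monom _)].
      rewrite inner_monom eqxx mulr1 mul_conjc cmodJ cmod_monom expr1n.
      over.
    move=> l lj; rewrite innerZl ?innerZr; [|exact: inL2_monom..|exact: inL2Z (inL2_monom _)].
    rewrite inner_monom; case: eqP => [e|]; last by rewrite !mulr0.
    case/eqP: lj; apply/ffunP => i; apply: val_inj => /=.
    by have := congr1 (fun w : 'I_n -> int => w i) e; rewrite /zof => -[].
  by rewrite /= sumr_const rmorph_nat.
have key : fejer N t = cst N * inner (fmul phi E) E.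
  rewrite /fejer /fscale /fsum; congr (_ * _).
  have -> : inner (fmul phi E) E =
      inner phi (fsum (index_enum _) (fun p : J N * J N =>
        fscale (conjc (monom (diff p) t)) (monom (diff p)))).
    rewrite /inner; congr cint; apply/funext => s; rewrite /fmul -mulrA; congr (_ * _).
    rewrite mul_conjc -[LHS]conjcR -mul_conjc; congr conjc.
    rewrite /E /fsum !(big_morph _ (@conjcD _) (conjc0 _)) big_distrlr/= pair_bigA/=.
    apply: eq_bigr => p _; rewrite /fscale !monomB !conjcM !conjcK /c; ring.
  rewrite inner_sumr//; last by move=> p; apply: inL2Z; exact: inL2_monom.
  apply: eq_bigr => p _; rewrite innerZr//; last exact: inL2_monom.
  by rewrite conjcK mulrC.
(* [|<phi E, E>|] is at most [||E||^2], the cardinal of [J N]; the bound thus holds at every [t]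
   although [phi] is bounded only almost everywhere. *)
have [pL pE] := bdd_mul ler01 phi1 EL; rewrite mul1r in pE.
rewrite key cmodM /cst cmodR ger0_norm; last by rewrite invr_ge0 ltW.
rewrite ler_pdivrMl// mulr1.
apply: (le_trans (cauchy_schwarz pL EL)).
by rewrite -Enorm expr2 ler_wpM2r// L2norm_ge0.
Qed.

Lemma count_diff N k :
  \sum_(p : J N * J N) ((diff p == k)%:R : R) = \prod_(i < n) pair_count N (k i).
Proof.
rewrite /pair_count bigA_distr_bigA/=.
under [RHS]eq_bigr => j _ do rewrite bigA_distr_bigA/=.
rewrite pair_bigA/=; apply: eq_bigr => p _.
case: eqP => [<-|kN].
  by rewrite big1// => i _; rewrite /diff /zof eqxx.
have [i ki] : exists i, diff p i != k i.
  by apply: contrapT => h; apply: kN; apply/funext => i; apply: contrapT => /eqP ?; apply: h; exists i.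
by rewrite (bigD1 i)//= -/(diff p i) (negPf ki) mul0r.
Qed.

Definition fejer_ratio N k : R := \prod_(i < n) (pair_count N (k i) / N.+1%:R).

Lemma fourier_fejer N k :
  fourier (fejer N) k = ((fejer_ratio N k)%:C)%C * fourier phi k.
Proof.
have kL := @inL2_monom R n k.
rewrite /fourier /fejer innerZl//; last exact: inL2_fsum.
rewrite inner_suml//.
under eq_bigr => p _.
  rewrite innerZl//; last exact: inL2_monom.
  rewrite inner_monom (_ : fourier phi (diff p) * _ = fourier phi k * (((diff p == k)%:R : R)%:C)%C).
    over.
  by case: eqP => [->|]; rewrite ?mulr1 ?mulr0// ?mulr1.
rewrite -mulr_sumr -rmorph_sum/= count_diff mulrCA mulrC -rmorphM/=.
congr (_%:C%C * _); rewrite /fejer_ratio big_split/= mulrC; congr (_ * _).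
by rewrite prodr_const card_ffun !card_ord natrX exprVn.
Qed.

Lemma cvg_prod_seq (I : Type) (r : seq I) (F : I -> nat -> R) (l : I -> R) :
  (forall i, F i @ \oo --> l i) ->
  (fun N => \prod_(i <- r) F i N) @ \oo --> \prod_(i <- r) l i.
Proof.
move=> Fl; elim: r => [|i r IH].
  by rewrite big_nil; under eq_fun do rewrite big_nil; exact: cvg_cst.
by rewrite big_cons; under eq_fun do rewrite big_cons; exact: cvgM.
Qed.

Lemma fejer_ratio_cvg k : (fun N => fejer_ratio N k) @ \oo --> (1 : R).
Proof.
have := @cvg_prod_seq _ (index_enum 'I_n) (fun i N => pair_count N (k i) / N.+1%:R)
  (fun=> 1) (fun i => @pair_count_cvg R (k i)).
by rewrite big1.
Qed.

Let err N : @tfun R n := fsub (fejer N) phi.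

Let err_bdd N : bdd 2 (err N).
Proof.
case: phi1 => mphi aphi; split.
  by apply: measCD; [exact: inL2_meas (inL2_fejer N)|exact: measCN].
apply: filterS aphi => t pt; rewrite /err /fsub (le_trans (cmodD _ _))// cmodN.
by have := cmod_fejer_le1 N t; lra.
Qed.

Let errL N f : inL2 f -> inL2 (fmul (err N) f).
Proof. by move=> fL; have [] := bdd_mul (ler0n _ 2) (err_bdd N) fL. Qed.

Let err_le N f g : inL2 f -> inL2 g ->
  cmod (inner (fmul (err N) f) g) <= 2 * L2norm f * L2norm g.
Proof.
move=> fL gL; apply: (le_trans (cauchy_schwarz (errL N fL) gL)).
by have [_ h] := bdd_mul (ler0n _ 2) (err_bdd N) fL; rewrite ler_wpM2r// L2norm_ge0.
Qed.

Let err_monom k l : cto0 (fun N => inner (fmul (err N) (monom k)) (monom l)).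
Proof.
move=> e e0; pose m i := l i - k i.
have E N : inner (fmul (err N) (monom k)) (monom l) = fourier (err N) m.
  rewrite /fourier /inner; congr cint; apply/funext => t.
  by rewrite /fmul /m monomB conjcM conjcK; ring.
have E' N : fourier (err N) m = ((fejer_ratio N m - 1)%:C)%C * fourier phi m.
  rewrite {1}/fourier innerBl//; [|exact: inL2_fejer|exact: inL2_monom].
  by rewrite -!/(fourier _ m) fourier_fejer rmorphB/= mulrBl mul1r.
have d0 : 0 < e / (cmod (fourier phi m) + 1).
  by apply: divr_gt0 => //; have := cmod_ge0 (fourier phi m); lra.
have /cvgrPdist_lt/(_ _ d0)[N0 _ h] := @fejer_ratio_cvg m.
exists N0 => N /h /=; rewrite E E' cmodM cmodR distrC ltr_pdivlMr; last first.
  by have := cmod_ge0 (fourier phi m); lra.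
by have := normr_ge0 (fejer_ratio N m - 1); have := cmod_ge0 (fourier phi m); nra.
Qed.

(** The errors are bounded by 2 uniformly in [N], so density applies twice: in [g] with [f] a
    monomial, then in [f]. On monomials this is the convergence of the Fejer weights to 1. *)
Lemma fejer_weak_cvg f g : inL2 f -> inL2 g ->
  cto0 (fun N => inner (fmul (fsub (fejer N) phi) f) g).
Proof.
(* The conjugation makes the pairing linear in [f'], as [closed_subspace_to0] demands. *)
have step k f' : inL2 f' -> cto0 (fun N => inner (fmul (err N) (monom k)) (fconj f')).
  move=> fL; have kL := @inL2_monom R n k.
  suff [] : [set f | inL2 f /\ cto0 (fun N => inner (fmul (err N) (monom k)) (fconj f))] f' by [].
  apply: L2_monom_ind fL => [|l].
    apply: (@closed_subspace_to0 _ _ (fun N f => inner (fmul (err N) (monom k)) (fconj f))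
      (2 * L2norm (@monom R n k))).
    - move=> N f1 f2 f1L f2L; rewrite -innerDr; [|exact: errL|exact: inL2J..].
      by congr inner; apply/funext => t; rewrite /fconj /fadd conjcD.
    - move=> N c f1 f1L; rewrite -{2}(conjcK c) -innerZr; [|exact: errL|exact: inL2J].
      by congr inner; apply/funext => t; rewrite /fconj /fscale conjcM.
    - by move=> N f1 f1L; rewrite -[L2norm f1]L2norm_fconj; apply: err_le => //; exact: inL2J.
  split; first exact: inL2_monom.
  rewrite (_ : fconj (monom l) = monom (fun i => - l i)); first exact: err_monom.
  by apply/funext => t; rewrite monomN.
move=> fL gL.
suff [] : [set f | inL2 f /\ cto0 (fun N => inner (fmul (err N) f) g)] f by [].
apply: L2_monom_ind fL => [|k].
  apply: (@closed_subspace_to0 _ _ (fun N f => inner (fmul (err N) f) g) (2 * L2norm g)).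
  - move=> N f1 f2 f1L f2L; rewrite -innerDl; [|exact: errL..|by []].
    by congr inner; apply/funext => t; rewrite /fmul /fadd mulrDr.
  - move=> N c f1 f1L; rewrite -innerZl; [|exact: errL|by []].
    by congr inner; apply/funext => t; rewrite /fmul /fscale; ring.
  - by move=> N f1 f1L; rewrite mulrAC; exact: err_le.
split; first exact: inL2_monom.
by rewrite -(fconjK g); apply: step; exact: inL2J.
Qed.

(* If polynomials p tend to phi in L2, then p g tends to phi g only in L1, which
   does not control the pairing with q; hence the bounded Fejer means. *)
Lemma Hinfty_orth g q : (forall k, (exists i, k i < 0) -> fourier phi k = 0) ->
  inL2 g -> inL2 q ->
  (forall k, (forall i, 0 <= k i) -> inner (fmul (monom k) g) q = 0) ->
  inner (fmul phi g) q = 0.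
Proof.
move=> phin gL qL gq.
have [pL _] := bdd_mul ler01 phi1 gL.
have f0 N : inner (fmul (fejer N) g) q = 0.
  have -> : fmul (fejer N) g = fscale (cst N) (fsum (index_enum _) (fun p : J N * J N =>
      fscale (fourier phi (diff p)) (fmul (monom (diff p)) g))).
    apply/funext => t; rewrite /fmul /fejer /fscale /fsum -mulrA big_distrl/=.
    by congr (_ * _); apply: eq_bigr => p _; rewrite mulrA.
  have tL (p : J N * J N) : inL2 (fscale (fourier phi (diff p)) (fmul (monom (diff p)) g)).
    by apply: inL2Z; exact: inL2_monom_mul.
  rewrite innerZl//; last exact: inL2_fsum.
  rewrite inner_suml// big1 ?mulr0// => p _.
  rewrite innerZl//; last exact: inL2_monom_mul.
  have [h|h] := pselect (forall i, 0 <= diff p i); first by rewrite gq// mulr0.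
  rewrite phin ?mul0r//; apply: contrapT => h'; apply: h => i.
  by rewrite leNgt; apply/negP => hi; apply: h'; exists i.
have fjL N : inL2 (fmul (fejer N) g).
  have b : bdd 1 (fejer N).
    by apply: bdd_everywhere => [|t]; [exact: inL2_meas (inL2_fejer N)|exact: cmod_fejer_le1].
  by have [] := bdd_mul ler01 b gL.
apply/eqP; rewrite -cmod_eq0 eq_le cmod_ge0 andbT; apply/ler_addgt0Pr => e e0.
have [N /(_ N (leqnn N))] := fejer_weak_cvg gL qL e0.
rewrite (_ : fmul (fsub _ _) _ = fsub (fmul (fejer N) g) (fmul phi g)); last first.
  by apply/funext => t; rewrite /fmul /fsub mulrBl.
by rewrite innerBl// f0 sub0r cmodN add0r => /ltW.
Qed.

End Fejer.

(** * The Schur class and the unit ball of L^infinity *)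

Section SchurClass.
Context {R : realType} {n : nat}.
Local Notation mu := (@torus_measure R n).
Implicit Types (f g phi : @tfun R n) (k : 'I_n -> int).

Lemma cmod_le1_aeP phi : measC phi ->
  itint (fun t => (if 1 < cmod (phi t) then 1 else 0 : R)%:E) = 0%E <->
  {ae mu, forall t, cmod (phi t) <= 1}.
Proof.
move=> mphi.
pose r t : R := if 1 < cmod (phi t) then 1 else 0.
have mr : measurable_fun [set: n.-tuple R] (fun t => (r t)%:E).
  apply/measurable_EFinP; apply: measurable_fun_ifT => //.
  by apply: measurable_fun_ltr => //; exact: measurable_cmod.
have r0 t : 0 <= r t by rewrite /r; case: ifP.
have r0E t : (0 <= (r t)%:E)%E by rewrite lee_fin.
rewrite (itintE mr r0E).
have -> : (\int[mu]_t (r t)%:E = \int[mu]_t `|(r t)%:E|)%E.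
  by apply: eq_integral => t _; rewrite abse_EFin ger0_norm.
rewrite (ae_eq_integral_abs mu measurableT mr); split; apply: filterS => t.
- by move=> /(_ I)[]; rewrite /r; case: ltP => // _ /eqP; rewrite oner_eq0.
- by move=> h _; rewrite /r ltNge h.
Qed.

Lemma schurP phi : schur phi <->
  bdd 1 phi /\ forall k, (exists i, k i < 0) -> fourier phi k = 0.
Proof.
split=> [[mphi /(cmod_le1_aeP mphi) ? ?]|[[mphi /(cmod_le1_aeP mphi)] ? ?]]//.
Qed.

Lemma schur_H2 phi : schur phi -> H2 phi.
Proof. by move=> /schurP[b pn]; split=> //; exact: bdd_inL2 ler01 b. Qed.

Lemma L1norm_bdd_mul phi f : bdd 1 phi -> inL2 f -> (L1norm (fmul phi f) <= L1norm f)%E.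
Proof.
move=> [mphi phi1] fL; have mf := inL2_meas fL.
have mpf : measC (fmul phi f) by exact: measCM.
rewrite !L1normE//; apply: ae_ge0_le_integral => //.
- by move=> t _; rewrite lee_fin cmod_ge0.
- by apply/measurable_EFinP; exact: measurable_cmod.
- by move=> t _; rewrite lee_fin cmod_ge0.
- by apply/measurable_EFinP; exact: measurable_cmod.
- by apply: filterS phi1 => t h _; rewrite lee_fin cmodM ler_piMl ?cmod_ge0.
Qed.

Lemma bdd1_closed phi : inL2 phi -> L2closure (bdd 1) phi -> bdd 1 phi.
Proof.
move=> pL pcl; have mp := inL2_meas pL; split=> //.
(* the excess (|phi| - 1)^+ is dominated by |phi - psi| for |psi| <= 1 *)
pose w : tfun n := fun t => ((Num.max (cmod (phi t) - 1) 0)%:C)%C.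
have mw : measC w.
  apply: measC_R; apply: measurable_maxr => //; apply: measurable_funB => //.
  exact: measurable_cmod.
have [wL w0] : inL2 w /\ L2norm w = 0.
  have le psi : bdd 1 psi -> inL2 w /\ L2norm w ^+ 2 <= L2norm (fsub phi psi) ^+ 2.
    move=> bpsi; have sL := bdd_inL2 ler01 bpsi.
    have dL := inL2B pL sL.
    rewrite [in X in _ /\ X](sqr_L2norm dL).
    apply: sqr_L2norm_le_ae => //; first exact: integrable_sqr_cmod.
    apply: filterS bpsi.2 => t h; rewrite cmodR.
    rewrite ler_pXn2r ?nnegrE ?cmod_ge0// ger0_norm; last by rewrite le_max lexx orbT.
    rewrite ge_max cmod_ge0 andbT.
    have := cmodD (fsub phi psi t) (psi t); rewrite /fsub subrK; lra.
  have [psi [bpsi _]] := pcl 1 ltr01; have [wL _] := le psi bpsi; split=> //.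
  apply/eqP; rewrite eq_le L2norm_ge0 andbT; apply/ler_addgt0Pr => e e0.
  have [psi' [bpsi' h]] := pcl e e0; rewrite add0r.
  have [_] := le _ bpsi'; rewrite ler_pXn2r ?nnegrE ?L2norm_ge0// => h'.
  exact: le_trans h' (ltW h).
apply: filterS (L2norm_eq0_ae wL w0) => t; rewrite /w => -[] h.
by rewrite -subr_le0 -h le_max lexx.
Qed.

(** The value is 0 where [f] vanishes, since [0^-1 = 0]. *)
Definition phase f : @tfun R n := fun t => (((cmod (f t))^-1)%:C)%C * f t.

Lemma bdd_phase f : inL2 f -> bdd 1 (phase f).
Proof.
move=> fL; have mf := inL2_meas fL; apply: bdd_everywhere => [|t].
  apply: measCM => //; apply: measC_R.
  rewrite (_ : (fun t => _) = fun t => cmod (f t) `^ (-1)); last first.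
    by apply/funext => t; rewrite powR_inv1// cmod_ge0.
  exact: (measurableT_comp (@measurable_powR R (-1)) (measurable_cmod mf)).
rewrite cmodM cmodR ger0_norm ?invr_ge0 ?cmod_ge0//.
have [->|h] := eqVneq (cmod (f t)) 0; first by rewrite mulr0.
by rewrite mulVf.
Qed.

Lemma Re_inner_phase f : inL2 f ->
  complex.Re (inner f (phase f)) = Rintegral mu setT (fun t => cmod (f t)).
Proof.
move=> fL; have pL := bdd_inL2 ler01 (bdd_phase fL).
rewrite /inner cintE/=; last exact: cintegrable_inner.
apply: eq_Rintegral => t _; rewrite /phase conjcM conjcR mulrCA mul_conjc -rmorphM/=.
have [->|h] := eqVneq (cmod (f t)) 0; first by rewrite expr0n mulr0.
by rewrite expr2 mulrA mulVf// mul1r.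
Qed.

End SchurClass.

(** * Quotient modules and the description of M_Q *)

Section QuotientModule.
Context {R : realType} {n : nat} (Q : set (@tfun R n)).
Hypothesis qm : quotient_module Q.
Local Notation mu := (@torus_measure R n).
Implicit Types (f g h q F phi : @tfun R n) (k : 'I_n -> int).

Let cQ : closed_subspace Q. Proof. by case: qm. Qed.

Lemma Q_H2 f : Q f -> H2 f. Proof. by case: qm => _ h _; exact: h. Qed.

Lemma Q_L2 f : Q f -> inL2 f. Proof. by move=> /Q_H2[]. Qed.

Lemma PQ_proj F : inL2 F -> is_proj Q F (PQ Q F).
Proof. by move=> FL; apply: ClassicalEpsilon.epsilon_spec; exact: projection_exists. Qed.

Lemma Q_PQ F : inL2 F -> Q (PQ Q F). Proof. by move=> /PQ_proj[]. Qed.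

Lemma inner_PQ F h : inL2 F -> Q h -> inner (PQ Q F) h = inner F h.
Proof.
move=> FL Qh; have [Qp /(_ h Qh)] := PQ_proj FL.
rewrite innerBl//; [|exact: Q_L2..].
by move/eqP; rewrite subr_eq0 => /eqP.
Qed.

Definition evec (i : 'I_n) : 'I_n -> int := fun j => (j == i)%:Z.

Lemma zcoordE i : @zcoord R n i = monom (evec i).
Proof.
apply/funext => t; rewrite /zcoord /monom (bigD1 i)//= /evec eqxx mul1r big1 ?addr0// => j /negPf ->.
by rewrite mul0r.
Qed.

Lemma evec_ge0 i j : 0 <= evec i j. Proof. by rewrite /evec; case: eqP. Qed.

(** A quotient module provides adjoints for single coordinates, so statements about [z^k] are proved
    one unit vector at a time, by induction on the total degree. *)
Lemma nonneg_exponent_ind (P : ('I_n -> int) -> Prop) : P (fun=> 0) ->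
  (forall k i, (forall j, 0 <= k j) -> P k -> P (fun j => k j + evec i j)) ->
  forall k, (forall j, 0 <= k j) -> P k.
Proof.
move=> P0 PS k; have [m] := ubnP (\sum_j `|k j|)%N; elim: m k => // m IH k.
rewrite ltnS => km k0.
have [kz|kn] := pselect (forall j, k j = 0).
  by rewrite (_ : k = fun=> 0)//; apply/funext.
have [i ki] : exists i, k i != 0.
  by apply: contrapT => h; apply: kn => j; apply: contrapT => /eqP ?; apply: h; exists j.
have ki1 : 0 < k i by rewrite lt_def ki k0.
have -> : k = fun j => (k j - evec i j) + evec i j by apply/funext => j; rewrite subrK.
have k0' j : 0 <= k j - evec i j.
  by rewrite /evec; case: eqP => [->|_]; rewrite ?subr0//; lia.
apply: PS => //; apply: IH => //; apply: leq_trans km.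
rewrite (bigD1 i)//= [X in (_ < X)%N](bigD1 i)//= /evec eqxx.
rewrite (eq_bigr (fun j => `|k j|%N)) => [|j /negPf ->]; last by rewrite subr0.
by lia.
Qed.

Definition Sperp g := H2 g /\ forall q, Q q -> inner g q = 0.

Lemma closed_Sperp : closed_subspace Sperp.
Proof.
have h (q : {q | Q q}) := closed_subspace_inner (Q_L2 (svalP q)).
have := closed_subspaceI (@closed_subspace_H2 R n) (closed_subspace_bigcap h).
congr closed_subspace; apply/seteqP; split=> g.
  by move=> [gH [gL gq]]; split=> // q Qq; case: (gq (exist _ q Qq)).
by move=> [gH gq]; split=> //; split=> [|[q Qq]]; [|split]; try exact: H2_inL2; exact: gq.
Qed.

Lemma zcoord_adj i h : Q h -> exists h', Q h' /\
  forall g, H2 g -> inner (fmul (monom (evec i)) g) h = inner g h'.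
Proof.
case: qm => _ _ /(_ i h) + Qh => /(_ Qh)[h' [Qh' hh']]; exists h'; split=> // g gH.
have gL := H2_inL2 gH; have hL := Q_L2 Qh; have h'L := Q_L2 Qh'.
rewrite (innerC hL (inL2_monom_mul _ gL)) -zcoordE -hh'//.
by rewrite -innerC.
Qed.

(** S is a submodule, dually to the invariance of [Q] under the adjoints of the coordinates. *)
Lemma Sperp_monom k g : (forall j, 0 <= k j) -> Sperp g -> Sperp (fmul (monom k) g).
Proof.
move=> k0 Sg; move: k k0; apply: nonneg_exponent_ind.
  rewrite (_ : fmul _ _ = g)//; apply/funext => t.
  by rewrite /fmul monom0// mul1r.
move=> k i k0 [kH kq].
have -> : fmul (monom (fun j => k j + evec i j)) g = fmul (monom (evec i)) (fmul (monom k) g).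
  by apply/funext => t; rewrite /fmul monomD; ring.
split=> [|q Qq]; first by apply: H2_monom_mul => // j; exact: evec_ge0.
by have [q' [Qq' ->//]] := zcoord_adj i Qq; exact: kq.
Qed.

Lemma Sperp_sub_PQ F : H2 F -> Sperp (fsub F (PQ Q F)).
Proof.
move=> FH; have FL := H2_inL2 FH; have [Qp po] := PQ_proj FL; split=> //.
case: (@closed_subspace_H2 R n) => _ _ hD hZ _; rewrite fsubE; apply: hD => //.
by apply: hZ; exact: Q_H2.
Qed.

Lemma schur_Sperp phi g q : schur phi -> Sperp g -> Q q -> inner (fmul phi g) q = 0.
Proof.
move=> /schurP[b pn] Sg Qq; have [gH _] := Sg.
apply: (Hinfty_orth b) => //; [exact: H2_inL2|exact: Q_L2|].
by move=> k k0; have [_ h] := Sperp_monom k0 Sg; exact: h.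
Qed.

(** Weak form of [P_Q T_phi P_Q = P_Q T_phi] on H^2, because [F - P_Q F] lies in S. It allows
    [S_phi] to be computed on unprojected monomials. *)
Lemma schur_PQ phi F q : schur phi -> H2 F -> Q q ->
  inner (fmul phi (PQ Q F)) q = inner (fmul phi F) q.
Proof.
move=> sp FH Qq; have /schurP[b _] := sp; have FL := H2_inL2 FH.
have := schur_Sperp sp (Sperp_sub_PQ FH) Qq.
rewrite (_ : fmul _ (fsub _ _) = fsub (fmul phi F) (fmul phi (PQ Q F))); last first.
  by apply/funext => t; rewrite /fmul /fsub mulrBr.
have [L1 _] := bdd_mul ler01 b FL; have [L2 _] := bdd_mul ler01 b (Q_L2 (Q_PQ FL)).
rewrite innerBl//; last exact: Q_L2.
by move/eqP; rewrite subr_eq0 => /eqP.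
Qed.

Lemma cint_fmul f g : cint (fmul f g) = inner g (fconj f).
Proof. by congr cint; apply/funext => t; rewrite /fmul /fconj conjcK mulrC. Qed.

Lemma inner_fconj f g : inner (fconj f) (fconj g) = inner g f.
Proof. by congr cint; apply/funext => t; rewrite /fconj conjcK mulrC. Qed.

(** The bilinear pairing with an analytic [a] is the inner product against [conj a], and both M_n
    and H^2_0 are orthogonal to conj H^2; only the component from Q survives. *)
Lemma cint_MQ a q (m h0 : @tfun R n) : H2 a -> inL2 q -> Mn m -> H2_0 h0 ->
  cint (fmul a (fadd (fadd (fconj q) m) h0)) = inner a q.
Proof.
move=> aH qL [mL [_ m2]] h0H; have aL := H2_inL2 aH.
have h0L : inL2 h0 by case: h0H => -[].
have aJ := inL2J aL; have qJ := inL2J qL; have qm_ := inL2D qJ mL.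
rewrite cint_fmul innerDl// innerDl// (m2 a aH) (H2_0_orth_conjH2 h0H aH).
by rewrite !addr0 inner_fconj.
Qed.

Lemma MQ_inL2 f : MQ Q f -> inL2 f.
Proof.
move=> [_ [m [h0 [[q [Qq ->]] [mL _] [[h0L _] _] ->]]]].
by apply: inL2D => //; apply: inL2D => //; apply: inL2J; exact: Q_L2.
Qed.

Lemma H2_cst c : H2 (@fconst R n c).
Proof.
case: (@closed_subspace_H2 R n) => _ _ _ hZ _.
have -> : @fconst R n c = fscale c (@monom R n (fun=> 0)).
  by apply/funext => t; rewrite /fscale monom0// mulr1.
by apply: hZ; apply: H2_monom.
Qed.

Lemma closed_subspace_H2_0 : closed_subspace (@H2_0 R n).
Proof.
have := closed_subspaceI (@closed_subspace_H2 R n)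
  (closed_subspace_inner (@inL2_monom R n (fun=> 0))).
congr closed_subspace; apply/seteqP; split=> f; first by move=> [fH [_ f0]].
by move=> [fH f0]; split=> //; split=> //; exact: H2_inL2.
Qed.

(** The components are [conj (P_Q g)], the projection [h0] of [conj g] onto H^2_0, and the remainder
    [m]. The hypothesis makes [g - P_Q g] orthogonal to S and to Q, hence to H^2, so [m] is
    orthogonal to conj H^2. *)
Lemma perp_Sperp_MQ g : inL2 g -> (forall v, Sperp v -> inner g v = 0) -> MQ Q (fconj g).
Proof.
move=> gL gS; have gJ := inL2J gL.
have [h0 [h0H h0o]] := projection_exists closed_subspace_H2_0 gJ.
have h0L : inL2 h0 by case: h0H => -[].
have [Qq qo] := PQ_proj gL; set q := PQ Q g in Qq qo.
have qL := Q_L2 Qq; have qJ := inL2J qL; have qH := Q_H2 Qq.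
pose m := fsub (fsub (fconj g) (fconj q)) h0.
have mL : inL2 m by apply: inL2B => //; exact: inL2B.
have m2 f : H2 f -> inner m (fconj f) = 0.
  move=> fH; have fL := H2_inL2 fH; have fJ := inL2J fL.
  rewrite innerBl//; last exact: inL2B.
  rewrite (H2_0_orth_conjH2 h0H fH) subr0 innerBl// !inner_fconj.
  have [Qp po] := PQ_proj fL; have [sH so] := Sperp_sub_PQ fH.
  have pL := Q_L2 Qp; have sL := H2_inL2 sH.
  have -> : f = fadd (PQ Q f) (fsub f (PQ Q f)).
    by apply/funext => t; rewrite /fadd /fsub addrC subrK.
  rewrite (innerDl pL sL gL) (innerDl pL sL qL) (innerC gL sL) (gS _ (Sperp_sub_PQ fH)) conjc0 so// !addr0.
  apply/eqP; rewrite subr_eq0; apply/eqP.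
  by rewrite (innerC gL pL) (innerC qL pL) -(inner_PQ gL Qp).
exists (fconj q), m, h0; split=> //; first by exists q.
  split=> //; split=> // f fH; have fL := H2_inL2 fH.
  pose c := fourier f (fun=> 0).
  pose f0 := fsub f (@fconst R n c).
  have cL : inL2 (@fconst R n c) by exact: inL2_cst.
  have cE : @fconst R n c = fscale c (@monom R n (fun=> 0)).
    by apply/funext => t; rewrite /fscale monom0// mulr1.
  have z0L := @inL2_monom R n (fun=> 0).
  have f0H : H2_0 f0.
    split.
      case: (@closed_subspace_H2 R n) => _ _ hD hZ _; rewrite /f0 fsubE; apply: hD => //.
      by apply: hZ; exact: H2_cst.
    by rewrite /fourier innerBl// -/(fourier f _) -/c cE innerZl// inner_monom eqxx mulr1 subrr.
  have f0L : inL2 f0 by case: f0H => -[].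
  (* Constants lie in H^2 and in its conjugate, so [m2] treats them; on H^2_0 the projection
     property of [h0] applies. *)
  have -> : f = fadd f0 (@fconst R n c).
    by apply/funext => t; rewrite /fadd /f0 /fsub subrK.
  rewrite innerDr//.
  have -> : @fconst R n c = fconj (@fconst R n (conjc c)).
    by apply/funext => t; rewrite /fconj /fconst conjcK.
  rewrite m2 ?addr0; last exact: H2_cst.
  have -> : m = fsub (fsub (fconj g) h0) (fconj q).
    by apply/funext => t; rewrite /m /fsub; ring.
  rewrite innerBl//; last exact: inL2B.
  by rewrite h0o// sub0r (innerC f0L qJ) (H2_0_orth_conjH2 f0H qH) conjc0 oppr0.
by apply/funext => t; rewrite /fadd /m /fsub; ring.
Qed.

End QuotientModule.

(** * From a lift to (2), and from a Schur extension of psi to a lift *)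

Section Lifting.
Context {R : realType} {n : nat} (Q : set (@tfun R n)) (X : @tfun R n -> @tfun R n).
Hypotheses (qm : quotient_module Q) (Xc : contraction_on Q X) (Xm : module_map Q X).
Local Notation mu := (@torus_measure R n).
Implicit Types (f g h q F phi : @tfun R n) (k : 'I_n -> int).

Let cQ : closed_subspace Q. Proof. by case: qm. Qed.
Let QL := Q_L2 qm.
Let one := @fconst R n 1.
Let psi := X (PQ Q one).

Let oneL : inL2 one. Proof. exact: inL2_cst. Qed.

Lemma Q_X f : Q f -> Q (X f). Proof. by case: Xc => h _ _ _; exact: h. Qed.

Lemma Q_psi : Q psi. Proof. by apply: Q_X; exact: Q_PQ. Qed.

Lemma Q_add f g : Q f -> Q g -> Q (fadd f g). Proof. by case: cQ => _ _ h _ _; exact: h. Qed.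
Lemma Q_scale c f : Q f -> Q (fscale c f). Proof. by case: cQ => _ _ _ h _; exact: h. Qed.
Lemma Q_sub f g : Q f -> Q g -> Q (fsub f g).
Proof. by move=> ? ?; rewrite fsubE; apply: Q_add => //; exact: Q_scale. Qed.

(** [X] is additive only up to null functions, which an inner product does not see; the same holds
    for homogeneity below. *)
Lemma innerXD f g h : Q f -> Q g -> inL2 h ->
  inner (X (fadd f g)) h = inner (X f) h + inner (X g) h.
Proof.
move=> Qf Qg hL; have [_ XD _ _] := Xc.
have f1 := QL (Q_X Qf); have g1 := QL (Q_X Qg).
rewrite -(innerDl f1 g1 hL).
apply: L2norm_sub0_inner (XD _ _ Qf Qg) => //; last exact: inL2D.
by apply: QL; apply: Q_X; exact: Q_add.
Qed.

Lemma innerXZ c f h : Q f -> inL2 h -> inner (X (fscale c f)) h = c * inner (X f) h.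
Proof.
move=> Qf hL; have [_ _ XZ _] := Xc; have f1 := QL (Q_X Qf).
rewrite -(innerZl c f1 hL).
apply: L2norm_sub0_inner (XZ c _ Qf) => //; last exact: inL2Z.
by apply: QL; apply: Q_X; exact: Q_scale.
Qed.

Lemma innerX_le f h : Q f -> inL2 h -> cmod (inner (X f) h) <= L2norm f * L2norm h.
Proof.
move=> Qf hL; have [_ _ _ XM] := Xc.
by rewrite (le_trans (cauchy_schwarz (QL (Q_X Qf)) hL))// ler_wpM2r ?L2norm_ge0// XM.
Qed.

(** Contractivity, applied to the difference, makes [X] respect equality almost everywhere. *)
Lemma innerX_eq f g h : Q f -> Q g -> inL2 h -> L2norm (fsub f g) = 0 ->
  inner (X f) h = inner (X g) h.
Proof.
move=> Qf Qg hL fg.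
have -> : f = fadd (fsub f g) g by apply/funext => t; rewrite /fadd /fsub subrK.
rewrite innerXD//; last exact: Q_sub.
suff -> : inner (X (fsub f g)) h = 0 by rewrite add0r.
apply/eqP; rewrite -cmod_eq0 eq_le cmod_ge0 andbT.
by rewrite (le_trans (innerX_le (Q_sub Qf Qg) hL))// fg mul0r.
Qed.

Lemma Q_eq_weak f g : Q f -> Q g -> (forall h, Q h -> inner f h = inner g h) ->
  L2norm (fsub f g) = 0.
Proof.
move=> Qf Qg fg; have fgL := QL (Q_sub Qf Qg).
apply/eqP; rewrite -sqrf_eq0 -(inj_eq (@complexI _)) -inner_self//.
by rewrite {1}/fsub -/(fsub f g) (innerBl (QL Qf) (QL Qg) fgL) fg ?subrr//; exact: Q_sub.
Qed.

Lemma liftable_contractive : liftable Q X ->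
  forall f, MQ Q f -> ((cmod (cint (fmul psi f)))%:E <= L1norm f)%E.
Proof.
move=> [phi [sp lift]] f fM; have fL := MQ_inL2 qm fM.
have /schurP[b _] := sp; have phiH := schur_H2 sp.
have [pfL _] := bdd_mul ler01 b fL.
apply: le_trans (L1norm_bdd_mul b fL).
suff -> : cint (fmul psi f) = cint (fmul phi f).
  by apply: cmod_cint_leL1; apply: cintegrable_L2.
move: fM => [_ [m [h0 [[q [Qq ->]] mM h0H ->]]]]; have qL := QL Qq.
rewrite !cint_MQ//; last exact: (Q_H2 qm Q_psi).
have Qp := Q_PQ qm oneL.
have [pL _] := bdd_mul ler01 b (QL Qp).
(* The lifting equation at [P_Q 1] gives [psi = S_phi P_Q 1], which pairs with [q] as [phi] does. *)
have -> : inner psi q = inner (Scomp Q phi (PQ Q one)) q.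
  apply: L2norm_sub0_inner (lift _ Qp) => //; first exact: (QL Q_psi).
  by apply: QL; exact: Q_PQ.
rewrite /Scomp inner_PQ// schur_PQ//; last exact: H2_cst.
by congr inner; apply/funext => t; rewrite /fmul /one /fconst mulr1.
Qed.

Section Lift.
Variable phi : @tfun R n.
Hypotheses (sp : schur phi) (phi_psi : forall q, Q q -> inner psi q = inner phi q).

Let b : bdd 1 phi. Proof. by have /schurP[] := sp. Qed.
Let phiL f : inL2 f -> inL2 (fmul phi f).
Proof. by move=> fL; have [] := bdd_mul ler01 b fL. Qed.

(** One induction step is [X P_Q z_i z^k = X S_{z_i} P_Q z^k = S_{z_i} X P_Q z^k]: first the
    invariance of S under [z_i], then the module property. The adjoint of [z_i] moves the coordinate
    onto [h], where the induction hypothesis applies. *)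
Lemma innerX_PQ_monom k : (forall j, 0 <= k j) -> forall h, Q h ->
  inner (X (PQ Q (monom k))) h = inner (fmul phi (monom k)) h.
Proof.
move: k; apply: nonneg_exponent_ind => [h Qh|k i k0 IH h Qh].
  have -> : @monom R n (fun=> 0) = one by apply/funext => t; exact: monom0.
  rewrite -/psi phi_psi//; congr inner; apply/funext => t.
  by rewrite /fmul /one /fconst mulr1.
have hL := QL Qh.
have kL := @inL2_monom R n k; have kH := @H2_monom R n k k0.
set p := PQ Q (monom k) in IH; have Qp : Q p by exact: Q_PQ.
have zpL : inL2 (fmul (monom (evec i)) p) by apply: inL2_monom_mul; exact: QL.
set k' := fun j => _; have k'L := @inL2_monom R n k'.
have Qzp : Q (Scomp Q (zcoord i) p) by rewrite zcoordE; exact: Q_PQ.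
have k'E : @monom R n k' = fmul (monom (evec i)) (monom k).
  by apply/funext => t; rewrite /k' monomD /fmul mulrC.
have -> : inner (X (PQ Q (monom k'))) h = inner (X (Scomp Q (zcoord i) p)) h.
  apply: innerX_eq => //; first exact: Q_PQ.
  apply: Q_eq_weak => //; first exact: Q_PQ.
  move=> q Qq; rewrite /Scomp zcoordE !inner_PQ//.
  have := (Sperp_monom qm (@evec_ge0 n i) (Sperp_sub_PQ qm kH)).2 q Qq.
  rewrite (_ : fmul _ (fsub _ _) = fsub (monom k') (fmul (monom (evec i)) p)); last first.
    by rewrite k'E; apply/funext => t; rewrite /fmul /fsub mulrBr.
  rewrite innerBl//; last exact: QL.
  by move/eqP; rewrite subr_eq0 => /eqP.
have QXp := Q_X Qp; have XpL := QL QXp.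
have -> : inner (X (Scomp Q (zcoord i) p)) h = inner (Scomp Q (zcoord i) (X p)) h.
  apply: L2norm_sub0_inner (Xm i Qp) => //; apply: QL; first exact: Q_X.
  by rewrite zcoordE; apply: Q_PQ => //; exact: inL2_monom_mul.
rewrite /Scomp zcoordE inner_PQ//; last exact: inL2_monom_mul.
have [h' [Qh' adj]] := zcoord_adj qm i Qh.
rewrite adj; last exact: Q_H2 QXp.
rewrite IH// -adj; last first.
  rewrite (_ : fmul phi (monom k) = fmul (monom k) phi).
    by apply: H2_monom_mul => //; exact: schur_H2.
  by apply/funext => t; rewrite /fmul mulrC.
by congr inner; apply/funext => t; rewrite k'E /fmul; ring.
Qed.

(** The subspace [W] of agreement is closed and contains every [P_Q z^k]; an element of [Q]
    orthogonal to all of these has no nonzero Fourier coefficient. *)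
Lemma innerX_phi f h : Q f -> Q h -> inner (X f) h = inner (fmul phi f) h.
Proof.
move=> Qf Qh.
pose W := [set f | Q f /\ forall h, Q h -> inner (X f) h = inner (fmul phi f) h].
suff [_ ->//] : W f.
have phiD f1 f2 : fmul phi (fadd f1 f2) = fadd (fmul phi f1) (fmul phi f2).
  by apply/funext => t; rewrite /fmul /fadd mulrDr.
have phiZ c f1 : fmul phi (fscale c f1) = fscale c (fmul phi f1).
  by apply/funext => t; rewrite /fmul /fscale; ring.
have cW : closed_subspace W.
  split.
  - by move=> g [/QL].
  - have Q0 : Q (@fconst R n 0) by case: cQ.
    split=> // q Qq; have qL := QL Qq.
    rewrite L2norm_eq0_inner ?L2norm_eq0_inner//.
    + by apply: phiL; exact: inL2_cst.
    + apply/eqP; rewrite eq_le L2norm_ge0 andbT.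
      by rewrite (le_trans (bdd_mul ler01 b (inL2_cst 0)).2)// L2norm0 mulr0.
    + by apply: QL; exact: Q_X.
    + apply/eqP; rewrite eq_le L2norm_ge0 andbT.
      by case: Xc => _ _ _ /(_ _ Q0); rewrite L2norm0.
  - move=> f1 f2 [Q1 h1] [Q2 h2]; split=> [|q Qq]; first exact: Q_add.
    have qL := QL Qq; have L1 := phiL (QL Q1); have L2 := phiL (QL Q2).
    by rewrite innerXD// phiD innerDl// h1// h2.
  - move=> c f1 [Q1 h1]; split=> [|q Qq]; first exact: Q_scale.
    have qL := QL Qq; have L1 := phiL (QL Q1).
    by rewrite innerXZ// phiZ innerZl// h1.
  - move=> g gL gcl; have Qg : Q g.
      by case: cQ => _ _ _ _; apply=> // e /gcl[w [[Qw _] ?]]; exists w.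
    split=> // q Qq; have qL := QL Qq.
    apply/eqP; rewrite -subr_eq0 -cmod_eq0 eq_le cmod_ge0 andbT.
    apply/ler_addgt0Pr => e e0; rewrite add0r.
    (* The two functionals differ on [g - w] by at most [2 ||g - w|| ||q||]; the added 1 avoids a
       zero denominator. *)
    have q1 : 0 < 2 * L2norm q + 1 by have := L2norm_ge0 q; lra.
    have [w [[Qw hw]]] := gcl (e / (2 * L2norm q + 1)) (divr_gt0 e0 q1).
    rewrite ltr_pdivlMr// => gw.
    have d := Q_sub Qg Qw; have dL := QL d; have wL := QL Qw.
    have [pdL pd] := bdd_mul ler01 b dL; rewrite mul1r in pd.
    have E : g = fadd (fsub g w) w by apply/funext => t; rewrite /fadd /fsub subrK.
    have -> : inner (X g) q - inner (fmul phi g) q =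
        inner (X (fsub g w)) q - inner (fmul phi (fsub g w)) q.
      rewrite {1 2}E innerXD// phiD (innerDl pdL (phiL wL) qL) hw//; ring.
    have n0 := L2norm_ge0 (fsub g w).
    have := innerX_le d qL; have := cauchy_schwarz pdL qL.
    have : L2norm (fmul phi (fsub g w)) * L2norm q <= L2norm (fsub g w) * L2norm q.
      by rewrite ler_wpM2r// L2norm_ge0.
    have := cmodD (inner (X (fsub g w)) q) (- inner (fmul phi (fsub g w)) q).
    rewrite cmodN; have := ler_wpM2l n0 (L2norm_ge0 q); lra.
have [w [[Qw Ww] wo]] := projection_exists cW (QL Qf).
have fL := QL Qf; have wL := QL Qw.
have d := Q_sub Qf Qw; have dL := QL d.
apply: (closed_subspace_eq cW fL (conj Qw Ww)); apply: trig_complete.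
split=> // k; have kL := @inL2_monom R n k.
have [k0|kn] := pselect (forall i, 0 <= k i); last first.
  case: (Q_H2 qm d) => _; apply.
  by apply: contrapT => hn; apply: kn => i; rewrite leNgt; apply/negP => ki; apply: hn; exists i.
rewrite /fourier (innerC kL dL) -(inner_PQ qm kL d) -innerC//; last exact: QL (Q_PQ qm kL).
apply: wo; split; first exact: Q_PQ.
move=> q Qq; rewrite innerX_PQ_monom// schur_PQ//; exact: H2_monom.
Qed.

Lemma liftable_of_extension : liftable Q X.
Proof.
exists phi; split=> // f Qf; have pfL := phiL (QL Qf).
apply: Q_eq_weak; [exact: Q_X|exact: Q_PQ|].
by move=> h Qh; rewrite /Scomp inner_PQ// innerX_phi.
Qed.

End Lift.

End Lifting.

(** * From (2) to a Schur function with the pairings of psi on Q *)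

Section Extension.
Context {R : realType} {n : nat} (Q : set (@tfun R n)) (psi : @tfun R n).
Hypotheses (qm : quotient_module Q) (Qpsi : Q psi).
Hypothesis psi_contr :
  forall f, MQ Q f -> ((cmod (cint (fmul psi f)))%:E <= L1norm f)%E.
Local Notation mu := (@torus_measure R n).
Implicit Types (f g h q v phi : @tfun R n).

Let psiL := Q_L2 qm Qpsi.
Let cS := closed_Sperp qm.

Let S_L2 v : Sperp Q v -> inL2 v. Proof. by case=> /H2_inL2. Qed.

Lemma bounded_Re_eq0 (a : R[i]) (A : R) :
  (forall c, complex.Re (conjc c * a) <= A) -> a = 0.
Proof.
move=> h; apply/eqP; rewrite -cmod_eq0 -sqrf_eq0; apply/negPn/negP => a0.
(* At this [c] the product [conj c * a] equals [A + 1]. *)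
have := h ((((A + 1) / cmod a ^+ 2)%:C)%C * a).
rewrite conjcM conjcR -mulrA [conjc a * a]mulrC mul_conjc -rmorphM/= divfK//.
by rewrite gerDl ler10.
Qed.

Lemma bdd1_conv phi1 phi2 (s : R) : 0 <= s -> s <= 1 -> bdd 1 phi1 -> bdd 1 phi2 ->
  bdd 1 (fconv s phi1 phi2).
Proof.
move=> s0 s1 [m1 b1] [m2 b2]; split.
  by apply: measCD; apply: measCM => //; exact: measC_cst.
apply: filterS2 b1 b2 => t h1 h2; rewrite /fconv /fadd /fscale.
rewrite (le_trans (cmodD _ _))// !cmodM !cmodR !ger0_norm ?subr_ge0//.
have : (1 - s) * cmod (phi1 t) <= (1 - s) * 1 by rewrite ler_wpM2l ?subr_ge0.
have : s * cmod (phi2 t) <= s * 1 by rewrite ler_wpM2l.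
lra.
Qed.

Lemma bdd1_cst0 : bdd 1 (@fconst R n 0).
Proof.
by apply: bdd_everywhere => [|t]; [exact: inL2_meas (inL2_cst 0)|rewrite /fconst cmod0].
Qed.

Lemma Sperp_conv s v1 v2 : Sperp Q v1 -> Sperp Q v2 -> Sperp Q (fconv s v1 v2).
Proof. by case: cS => _ _ hD hZ _ *; apply: hD; exact: hZ. Qed.

Definition residual : set (@tfun R n) :=
  [set x | exists phi v, [/\ bdd 1 phi, Sperp Q v & x = fsub (fsub psi phi) v]].

(** The minimizer [g] lies in the closure of [residual] only, so [g = 0] yields small residuals and
    not yet a vanishing one. *)
Lemma residual_dense0 e : 0 < e ->
  exists phi v, [/\ bdd 1 phi, Sperp Q v & L2norm (fsub (fsub psi phi) v) < e].
Proof.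
move=> e0.
have S0 : Sperp Q (@fconst R n 0) by case: cS.
have CL x : residual x -> inL2 x.
  move=> [phi [v [b Sv ->]]]; apply: inL2B; last exact: S_L2.
  by apply: inL2B => //; exact: bdd_inL2 ler01 b.
have [|||g [gL gcl gm]] := @min_norm _ _ residual.
- exact: CL.
- move=> _ _ s s0 s1 [phi1 [v1 [b1 S1 ->]]] [phi2 [v2 [b2 S2 ->]]].
  exists (fconv s phi1 phi2), (fconv s v1 v2); split.
  + exact: bdd1_conv.
  + exact: Sperp_conv.
  + by apply/funext => t; rewrite /fconv /fadd /fsub /fscale rmorphB; ring.
- exists (fsub (fsub psi (@fconst R n 0)) (@fconst R n 0)).
  by exists (@fconst R n 0), (@fconst R n 0); split=> //; exact: bdd1_cst0.
have gm' phi v : bdd 1 phi -> Sperp Q v ->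
    L2norm g ^+ 2 <= complex.Re (inner g psi) - complex.Re (inner g phi) - complex.Re (inner g v).
  move=> b Sv; have pL := bdd_inL2 ler01 b; have vL := S_L2 Sv.
  have ppL := inL2B psiL pL.
  have := gm _ (inL2B ppL vL).
  rewrite (innerBr gL ppL vL) (innerBr gL psiL pL) !cReD !cReN; apply.
  by apply: sub_L2closure; exists phi, v.
(* All multiples [c v] lie in S, so [Re <g, c v>] is bounded above over all [c], which forces
   [<g, v> = 0]. *)
have gS v : Sperp Q v -> inner g v = 0.
  move=> Sv; have vL := S_L2 Sv.
  apply: (@bounded_Re_eq0 _ (complex.Re (inner g psi) -
    complex.Re (inner g (@fconst R n 0)) - L2norm g ^+ 2)) => c.
  have Scv : Sperp Q (fscale c v) by case: cS => _ _ _ hZ _; exact: hZ.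
  have := gm' _ _ bdd1_cst0 Scv.
  by rewrite (innerZr c gL vL); lra.
have := psi_contr (perp_Sperp_MQ qm gL gS).
rewrite cint_fmul inner_fconj => h.
have g0 : L2norm g = 0.
  have := gm' _ _ (bdd_phase gL) S0.
  rewrite Re_inner_phase// (_ : inner g (@fconst R n 0) = 0); last first.
    have zL : inL2 (@fconst R n 0) by exact: inL2_cst.
    by rewrite (innerC zL gL) L2norm_eq0_inner ?conjc0// L2norm0.
  rewrite subr0 => h2.
  have gi := integrable_cmod (cintegrable_L2 gL).
  have gJ := inL2J gL.
  have L1E : L1norm (fconj g) = (Rintegral mu setT (fun t => cmod (g t)))%:E.
    rewrite (L1normE (inL2_meas gJ)) /Rintegral fineK.
      by apply: eq_integral => t _; rewrite cmodJ.
    exact: (integrable_fin_num measurableT gi).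
  move: h; rewrite L1E lee_fin (innerC gL psiL) cmodJ => h.
  have h3 := le_trans (ler_norm _) (le_Re_cmod (inner g psi)).
  apply/eqP; rewrite -sqrf_eq0 eq_le sqr_ge0 andbT; lra.
have [_ [[phi [v [b Sv ->]]] gx]] := gcl e e0.
exists phi, v; split=> //; set x := fsub _ v in gx *.
have xL : inL2 x by apply: CL; exists phi, v.
by have := L2norm_le_sub xL gL; rewrite g0 add0r L2normBC => /le_lt_trans; apply.
Qed.

(** [C j] collects the members of K from which psi differs by an element of S up to [2^-j]. A common
    closure point belongs to K because K is closed, and its difference from psi belongs to S because
    S is. *)
Lemma extension_exists : exists phi, schur phi /\ forall q, Q q -> inner psi q = inner phi q.
Proof.
pose C (j : nat) : set (@tfun R n) := [set phi | bdd 1 phi /\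
  exists v, Sperp Q v /\ L2norm (fsub (fsub psi phi) v) < (2 ^+ j)^-1].
have pw j : 0 < (2 ^+ j : R)^-1 by rewrite invr_gt0 exprn_gt0.
have [|||||phi [phiL phicl]] := @nested_convex _ _ C (L2norm (@fconst R n 1)).
- by move=> j x [b _]; exact: bdd_inL2 ler01 b.
- move=> j phi1 phi2 s s0 s1 [b1 [v1 [S1 h1]]] [b2 [v2 [S2 h2]]]; split.
    exact: bdd1_conv.
  exists (fconv s v1 v2); split; first exact: Sperp_conv.
  have L1 : inL2 (fsub (fsub psi phi1) v1).
    by apply: inL2B; [apply: inL2B => //; exact: bdd_inL2 ler01 b1|exact: S_L2].
  have L2 : inL2 (fsub (fsub psi phi2) v2).
    by apply: inL2B; [apply: inL2B => //; exact: bdd_inL2 ler01 b2|exact: S_L2].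
  rewrite (_ : fsub _ _ = fconv s (fsub (fsub psi phi1) v1) (fsub (fsub psi phi2) v2)); last first.
    by apply/funext => t; rewrite /fconv /fadd /fsub /fscale rmorphB; ring.
  apply: le_lt_trans (L2normD (inL2Z _ L1) (inL2Z _ L2)) _.
  rewrite !L2norm_scale// !cmodR !ger0_norm ?subr_ge0//.
  have := L2norm_ge0 (fsub (fsub psi phi1) v1); have := L2norm_ge0 (fsub (fsub psi phi2) v2).
  move: h1 h2; set a := L2norm _; set b := L2norm _; set d := (2 ^+ j)^-1 => h1 h2 _ _.
  (* The bound is strict while a weight may be 0; the larger weight is positive and carries the
     strictness. *)
  have [s2|s2] := leP s 2^-1.
    have : s * b <= s * d by rewrite ler_wpM2l// ltW.
    have : (1 - s) * a < (1 - s) * d by rewrite ltr_pM2l//; lra.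
    lra.
  have : s * b < s * d by rewrite ltr_pM2l//; lra.
  have : (1 - s) * a <= (1 - s) * d by rewrite ler_wpM2l ?subr_ge0// ltW.
  lra.
- by move=> j; have [phi [v [b Sv h]]] := residual_dense0 (pw j); exists phi; split=> //; exists v.
- move=> j phi [b [v [Sv h]]]; split=> //; exists v; split=> //; apply: lt_le_trans h _.
  by rewrite lef_pV2 ?posrE ?exprn_gt0// exprS ler_peMl ?exprn_ge0// ler1n.
- move=> j phi [b _]; have [_] := bdd_mul ler01 b (inL2_cst 1).
  rewrite mul1r (_ : fmul _ _ = phi)//.
  by apply/funext => t; rewrite /fmul /fconst mulr1.
have b : bdd 1 phi.
  apply: bdd1_closed => // e e0; have [c [[bc _] h]] := phicl 0%N e e0.
  by exists c.
have Sd : Sperp Q (fsub psi phi).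
  have pL := inL2B psiL phiL.
  case: cS => _ _ _ _; apply=> // e e0.
  have [j hj] := @half_pow_small R (e / 2) ltac:(lra).
  have [c [[bc [v [Sv hv]]] hc]] := phicl j (e / 2) ltac:(lra).
  exists v; split=> //.
  have cL := bdd_inL2 ler01 bc; have vL := S_L2 Sv; have pcL := inL2B psiL cL.
  apply: le_lt_trans (L2norm_triangle pL pcL vL) _.
  have -> : L2norm (fsub (fsub psi phi) (fsub psi c)) = L2norm (fsub phi c).
    by apply: L2norm_ext => t; rewrite /fsub cmodB; congr cmod; ring.
  lra.
exists phi; split.
  apply/schurP; split=> //.
  (* [phi] is analytic as the difference of psi in [Q] and [psi - phi] in S, both inside H^2. *)
  have [] : H2 phi by
    have -> : phi = fsub psi (fsub psi phi) by [apply/funext => t; rewrite /fsub; ring];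
    case: (@closed_subspace_H2 R n) => _ _ hD hZ _; rewrite fsubE; apply: hD;
    [exact: Q_H2 Qpsi|apply: hZ; case: Sd].
  by [].
move=> q Qq; have qL := Q_L2 qm Qq; have [_ /(_ q Qq)] := Sd.
by rewrite (innerBl psiL phiL qL) => /eqP; rewrite subr_eq0 => /eqP.
Qed.

End Extension.

(** * The distance condition *)

Section Distance.
Context {R : realType} {n : nat} (Q : set (@tfun R n)) (psi : @tfun R n).
Hypotheses (qm : quotient_module Q) (Qpsi : Q psi) (psi0 : L2norm psi != 0).
Implicit Types (f g h : @tfun R n).

Let psiL := Q_L2 qm Qpsi.
Let cQ : closed_subspace Q. Proof. by case: qm. Qed.
Let c0 : R[i] := ((((L2norm psi ^+ 2)^-1)%R) +i* 0%R)%C.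

Lemma Mn_scale c f : Mn f -> Mn (fscale c f).
Proof.
move=> [fL [f1 f2]]; split; [exact: inL2Z|split=> h hH].
  by rewrite (innerZl c fL (H2_inL2 hH)) f1// mulr0.
by rewrite (innerZl c fL (inL2J (H2_inL2 hH))) f2// mulr0.
Qed.

Lemma H2_0_scale c f : H2_0 f -> H2_0 (fscale c f).
Proof. by case: (@closed_subspace_H2_0 R n) => _ _ _ h _; exact: h. Qed.

Let inner_cpsi : inner psi (fscale c0 psi) = 1.
Proof.
rewrite innerZr// inner_self// -[c0]/(((L2norm psi ^+ 2)^-1%:C)%C) conjcR -rmorphM/=.
by rewrite mulVf// sqrf_eq0.
Qed.

Let conj_c0 : conjc c0 = c0. Proof. exact: conjcR. Qed.

(** The differences [conj psi / ||psi||^2 - h], with [h] in the subspace of (3), are the elements of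
    M_Q that pair to 1 with psi; any element with nonzero pairing is rescaled to one of them. *)
Lemma contractive_distP :
  (forall f, MQ Q f -> ((cmod (cint (fmul psi f)))%:E <= L1norm f)%E) <->
  (1%:E <= distL1 (fscale c0 (fconj psi)) (MtQ Q psi))%E.
Proof.
have Qadd f g : Q f -> Q g -> Q (fadd f g) by case: cQ => _ _ h _ _; exact: h.
have QZ c f : Q f -> Q (fscale c f) by case: cQ => _ _ _ h _; exact: h.
have psiH := Q_H2 qm Qpsi.
split=> [contr|dist f].
  apply: le_ereal_inf_tmp => _ [h [_ [m [h0 [[[q [Qq ->]] qo] mM h0H ->]]]] <-].
  have qL := Q_L2 qm Qq; have qo' : inner psi q = 0 by rewrite -qo inner_fconj.
  (* Since [q] is orthogonal to [psi], the pairing of [psi] with [q'] is 1. *)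
  pose q' := fadd (fscale c0 psi) (fscale (-1) q).
  have Qq' : Q q' by apply: Qadd; exact: QZ.
  have -> : fsub (fscale c0 (fconj psi)) (fadd (fadd (fconj q) m) h0) =
      fadd (fadd (fconj q') (fscale (-1) m)) (fscale (-1) h0).
    apply/funext => t; rewrite /fsub /fadd /fscale /q' /fconj /fadd /fscale.
    by rewrite conjcD !conjcM conj_c0 conjcN conjc1; ring.
  have MQf : MQ Q (fadd (fadd (fconj q') (fscale (-1) m)) (fscale (-1) h0)).
    exists (fconj q'), (fscale (-1) m), (fscale (-1) h0); split=> //.
    - by exists q'.
    - exact: Mn_scale.
    - exact: H2_0_scale.
  apply: le_trans (contr _ MQf).
  rewrite cint_MQ//; [|exact: Q_L2 Qq'|exact: Mn_scale|exact: H2_0_scale].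
  rewrite innerDr//; [|exact: inL2Z|exact: inL2Z].
  by rewrite inner_cpsi innerZr// qo' mulr0 addr0 cmod1.
move=> MQf; have fL := MQ_inL2 qm MQf.
have [_ [m [h0 [[q [Qq ->]] mM h0H fE]]]] := MQf.
have qL := Q_L2 qm Qq.
have aE : cint (fmul psi f) = inner psi q by rewrite fE cint_MQ.
rewrite aE; set a := inner psi q.
have [->|a0] := eqVneq a 0.
  rewrite cmod0 L1normE; last exact: inL2_meas.
  by apply: integral_ge0 => t _; rewrite lee_fin cmod_ge0.
(* Chosen so that [h] is [conj psi / ||psi||^2 - f / a]; the scalar on [q] is conjugated because [f]
   contains [fconj q]. *)
pose q' := fadd (fscale c0 psi) (fscale (- (conjc a)^-1) q).
have Qq' : Q q' by apply: Qadd; exact: QZ.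
pose h := fadd (fadd (fconj q') (fscale (- a^-1) m)) (fscale (- a^-1) h0).
have Mh : MtQ Q psi h.
  exists (fconj q'), (fscale (- a^-1) m), (fscale (- a^-1) h0); split=> //.
  - split; first by exists q'.
    rewrite inner_fconj innerDr//; [|exact: inL2Z|exact: inL2Z].
    rewrite inner_cpsi innerZr// conjcN -/a conjc_inv conjcK mulNr mulVf//.
    by rewrite subrr.
  - exact: Mn_scale.
  - exact: H2_0_scale.
have := le_trans dist (ereal_inf_lbound (imageP _ Mh)).
have -> : fsub (fscale c0 (fconj psi)) h = fscale a^-1 f.
  apply/funext => t; rewrite fE /h /fsub /fadd /fscale /q' /fconj /fadd /fscale.
  by rewrite conjcD !conjcM conj_c0 conjcN conjc_inv conjcK; ring.
have fi := integrable_cmod (cintegrable_L2 fL).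
have am : 0 < cmod a by rewrite lt_def cmod_eq0 a0 cmod_ge0.
have faL := inL2Z a^-1 fL.
rewrite (L1normE (inL2_meas faL)) (L1normE (inL2_meas fL)).
under eq_integral do rewrite /fscale cmodM EFinM.
rewrite ge0_integralZl//; last 3 first.
- by case/integrableP: fi.
- by move=> t _; rewrite lee_fin cmod_ge0.
- by rewrite lee_fin cmod_ge0.
have -> : cmod a^-1 = (cmod a)^-1.
  apply: (mulfI (lt0r_neq0 am)); rewrite -cmodM !divff ?cmod1//.
  exact: lt0r_neq0.
rewrite -(fineK (integrable_fin_num measurableT fi)) -EFinM !lee_fin.
by rewrite ler_pdivlMl// mulr1.
Qed.

End Distance.

(** For null psi the normalization in (3) is meaningless: as [0^-1 = 0], the distance would be 0
    although (1) and (2) hold. Hence the guard on the second equivalence. *)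
Theorem theorem4p4 (R : realType) (n : nat) (Q : set (n.-tuple R -> R[i]))
    (X : (n.-tuple R -> R[i]) -> (n.-tuple R -> R[i])) :
  (1 <= n)%N -> quotient_module Q -> contraction_on Q X -> module_map Q X ->
  let psi := X (PQ Q (@fconst R n 1)) in
  let cond2 := forall f, MQ Q f ->
      ((cmod (cint (fmul psi f)))%:E <= L1norm f)%E in
  let cond3 := (1%:E <= distL1 (fscale (((L2norm psi ^+ 2)^-1)%R +i* 0%R)%C (fconj psi))
                                  (MtQ Q psi))%E in
  (liftable Q X <-> cond2) /\ (L2norm psi != 0 -> (liftable Q X <-> cond3)).
Proof.
move=> _ qm Xc Xm psi cond2 cond3.
have Qpsi : Q psi by exact: (Q_psi qm Xc).
have P12 : liftable Q X <-> cond2.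
  split=> [|contr]; first exact: (liftable_contractive qm Xc).
  have [phi [sp h]] := extension_exists qm Qpsi contr.
  exact: (liftable_of_extension qm Xc Xm sp h).
split=> // psi0; rewrite P12.
exact: (contractive_distP qm Qpsi psi0).
Qed.
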